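(* Let $P,Q$ be probability measures on $\mathbb{R}^d$ with compact supports $\Omega,\Omega'$. Assume: (1) $c$ is Lipschitz on $\Omega\times\Omega'$ with constant $L>0$; (2) $\phi$ satisfies the standing regularization assumption (see context) and, in addition, $\psi\in\mathcal{C}^{1,1}_{loc}(\mathbb{R})$ with $\psi''\in L^\infty_{loc}(\mathbb{R})$ non-decreasing (a monotone measurable representative of the a.e. second derivative $\psi''$ is fixed); (3) $\Omega$ is (bounded and) convex and $P$ admits a Lebesgue density $\rho$ with $0<\lambda_P\le\rho(x)\le\Lambda_P<\infty$ for $x\in\Omega$. Let $(\delta_\psi,t_\psi)$ be as in the standing regularization assumption with $\psi''(t_\psi-\delta_\psi)>0$, and let $\gamma:\mathbb{N}\times(0,\infty)\to(0,\infty)$ be such that for every $n\in\mathbb{N}$ and $\varepsilon\in(0,\infty)$, $$\mathbb{P}\Bigl(\max_j\frac1n\sum_i\pi^{(1)}_{i,j}\le\gamma(n,\varepsilon)\Bigr)=1\quad\text{and}\quad\mathbb{P}\Bigl(\max_i\frac1n\sum_j\pi^{(1)}_{i,j}\le\gamma(n,\varepsilon)\Bigr)=1,$$ where $\pi^{(1)}_{i,j}=\psi''\Bigl(\frac{\widehat f(X_i)+\widehat g(Y_j)-c(X_i,Y_j)}{\varepsilon}+\frac{\delta_\psi}{4}\Bigr)$. Define $$\beta_{n,\varepsilon}=\min\Biggl(\frac{4\alpha_{n,\varepsilon}\,\psi''(t_\psi-\delta_\psi)\min_{x\in\Omega}P(\mathbb{B}_{\frac{\delta_\psi\varepsilon}{8L}}(x))}{\psi''(t_\psi-\delta_\psi)\min_{x\in\Omega}P(\mathbb{B}_{\frac{\delta_\psi\varepsilon}{8L}}(x))+8\gamma(n,\varepsilon)},\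 \frac12\psi''(t_\psi-\delta_\psi)\min_{x\in\Omega}P(\mathbb{B}_{\frac{\delta_\psi\varepsilon}{8L}}(x))\Biggr),$$ $$\alpha_{n,\varepsilon}=\frac{\lambda_P^2\,\psi''(t_\psi-\delta_\psi)^2\,\min_{y\in\Omega'}Q(\mathbb{B}_{\frac{\delta_\psi\varepsilon}{8L}}(y))}{8\Lambda_P^2\,\gamma(n,\varepsilon)\,\Bigl\lceil\frac{16L\,\mathrm{diam}(\Omega)}{\delta_\psi\varepsilon}\Bigr\rceil^{d+2}}.$$ For every fixed $u>\max(d,2)$ there exist $K>0$, $C>0$ and $n_0\in\mathbb{N}$ (independent of $n$ and $\varepsilon$) such that for all $n\ge n_0$ and $\varepsilon\in(0,1]$, $$\bigl(\mathbb{E}[\widehat{\mathrm{OT}}_{\phi,\varepsilon}]-\mathrm{OT}_{\phi,\varepsilon}\bigr)^2\le K\Biggl[\frac{\bigl(\mathrm{Var}_{P\otimes Q}[\rho_\varepsilon]\bigr)^2}{(\beta_{n,\varepsilon})^2n^2}+\frac{\mathrm{Var}_{P\otimes Q}[\rho_\varepsilon]}{n^2}\Biggl(\frac1{\varepsilon^u}+\frac{C}{\bigl(\min_{x\in\Omega}P(\mathbb{B}_{\frac{\delta_\psi\varepsilon}{8L}}(x))\bigr)^2}+\frac{C}{\bigl(\min_{y\in\Omega'}Q(\mathbb{B}_{\frac{\delta_\psi\varepsilon}{8L}}(y))\bigr)^2}\Biggr)\Biggr].$$ As a consequence, if $d\ge2$, if moreover $\Omega'$ is convex and $Q$ admits a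 Lebesgue density bounded between two positive finite constants on $\Omega'$, and if $\gamma(n,\varepsilon)$ is bounded uniformly in $n$ and $\varepsilon$, then there exist $K'>0$ and $n_0\in\mathbb{N}$ such that for all $n\ge n_0$ and $\varepsilon\in(0,1]$, $$\bigl(\mathbb{E}[\widehat{\mathrm{OT}}_{\phi,\varepsilon}]-\mathrm{OT}_{\phi,\varepsilon}\bigr)^2\le K'\Biggl[\frac{\varepsilon^{-(6d+4)}\bigl(\mathrm{Var}_{P\otimes Q}[\rho_\varepsilon]\bigr)^2}{n^2}+\frac{\varepsilon^{-2d}\,\mathrm{Var}_{P\otimes Q}[\rho_\varepsilon]}{n^2}\Biggr].$$
   Context: Standing regularization assumption: $\phi:[0,\infty)\to\mathbb{R}$ is strictly convex with $\phi(x)/x\to\infty$ as $x\to\infty$; its conjugate $\psi(y)=\sup_{x\ge0}\{xy-\phi(x)\}$ belongs to $\mathcal{C}^1(\mathbb{R})$, satisfies $\psi'(x)\to\infty$ as $x\to\infty$, and there exist $t_\psi>0$, $\delta_\psi>0$ with $\psi'(t_\psi)=1$ and $\psi$ strictly convex on $[t_\psi-\delta_\psi,\infty)$. For probability measures $\mu$ on $\Omega$, $\nu$ on $\Omega'$, $\Pi(\mu,\nu)$ is the set of couplings and $$\mathrm{OT}_{\phi,\varepsilon}(\mu,\nu)=\inf_{\pi\in\Pi(\mu,\nu)}\int c\,d\pi+\varepsilon\int\phi\Bigl(\frac{d\pi}{d(\mu\otimes\nu)}\Bigr)d(\mu\otimes\nu)$$ (the last integral being $\infty$ if $\pi\not\ll\mu\otimes\nu$).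 $\rho_\varepsilon=\frac{d\pi_\varepsilon}{d(P\otimes Q)}$ is the density of the unique optimizer $\pi_\varepsilon$ for $(P,Q)$. Sampling: $X_1,\dots,X_n,Y_1,\dots,Y_n$ are independent with $X_i\sim P$, $Y_j\sim Q$; $\widehat P=\frac1n\sum_i\delta_{X_i}$, $\widehat Q=\frac1n\sum_j\delta_{Y_j}$; $\mathrm{OT}_{\phi,\varepsilon}=\mathrm{OT}_{\phi,\varepsilon}(P,Q)$, $\widehat{\mathrm{OT}}_{\phi,\varepsilon}=\mathrm{OT}_{\phi,\varepsilon}(\widehat P,\widehat Q)$. Empirical potentials $(\widehat f,\widehat g)$: a fixed measurable (in the sample) choice of bounded measurable $\widehat f:\Omega\to\mathbb{R}$, $\widehat g:\Omega'\to\mathbb{R}$ with $$\int\psi'\Bigl(\tfrac{\widehat f(x)+\widehat g(y)-c(x,y)}{\varepsilon}\Bigr)d\widehat Q(y)=1\ \ \forall x\in\Omega,\qquad \int\psi'\Bigl(\tfrac{\widehat f(x)+\widehat g(y)-c(x,y)}{\varepsilon}\Bigr)d\widehat P(x)=1\ \ \forall y\in\Omega',$$ normalized by $\int\widehat f\,d\widehat P=0$. $\mathbb{B}_r(x)$ denotes the open Euclidean ball. *)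

(* Defs.v *)
From HB Require Import structures.
From mathcomp Require Import all_boot all_order all_algebra.
From mathcomp Require Import all_classical all_reals all_analysis.

Set Implicit Arguments.
Unset Strict Implicit.
Unset Printing Implicit Defensive.

Import Order.TTheory GRing.Theory Num.Theory.
Import numFieldNormedType.Exports.

Local Open Scope classical_set_scope.
Local Open Scope ring_scope.

(* The sigma-algebra on row vectors is generated by the coordinates, as for
   [n.-tuple T]. Over the reals this is the Borel sigma-algebra of R^n. *)
Definition rV_display : measure_display -> measure_display.
Proof. exact. Qed.

Section measurable_rV.
Context {d} {T : measurableType d}.
Variable n : nat.

Let coord : 'I_n -> 'rV[T]_n -> T := fun i v => v ord0 i.

Let rV_set0 : g_sigma_preimage coord set0.
Proof. exact: sigma_algebra0. Qed.

Let rV_setC A : g_sigma_preimage coord A -> g_sigma_preimage coord (~` A).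
Proof. exact: sigma_algebraC. Qed.

Let rV_bigcup (F : _^nat) : (forall i, g_sigma_preimage coord (F i)) ->
  g_sigma_preimage coord (\bigcup_i (F i)).
Proof. exact: sigma_algebra_bigcup. Qed.

HB.instance Definition _ := @isMeasurable.Build (rV_display d)
  'rV[T]_n (g_sigma_preimage coord) rV_set0 rV_setC rV_bigcup.

End measurable_rV.

Lemma measurable_coord d (T : measurableType d) n (i : 'I_n) :
  measurable_fun [set: 'rV[T]_n] (fun v => v ord0 i).
Proof.
move=> _ Y mY; rewrite setTI; apply: sub_sigma_algebra => /=.
rewrite -bigcup_seq/=; exists i => /=; first by rewrite mem_index_enum.
by exists Y => //; rewrite setTI.
Qed.

Lemma measurable_fun_rV d1 d2 (T1 : measurableType d1) (T2 : measurableType d2)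
    n (f : T1 -> 'rV[T2]_n) :
  (forall i, measurable_fun [set: T1] (fun x => f x ord0 i)) ->
  measurable_fun [set: T1] f.
Proof.
move=> mf.
move=> _ Y mY; rewrite setTI.
have {}mf i (B : set T2) : measurable B ->
    measurable (f @^-1` ((fun v : 'rV[T2]_n => v ord0 i) @^-1` B)).
  by move=> mB; rewrite -[X in measurable X]setTI; exact: (mf i).
suff : <<s \big[setU/set0]_(i < n) preimage_set_system [set: 'rV[T2]_n]
      (fun v : 'rV[T2]_n => v ord0 i) measurable >> `<=`
    [set A | measurable (f @^-1` A)] by exact.
apply: smallest_sub.
  split => /= [|A mA|F mF]; first by rewrite preimage_set0.
  - by rewrite setTD -preimage_setC; exact: measurableC.
  - by rewrite preimage_bigcup; exact: bigcup_measurable.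
rewrite -bigcup_seq => A [i /= _ [B mB <-]].
by rewrite setTI; exact: mf.
Qed.

Section lebesgue_rV.
Context {R : realType}.

Definition rV_cons n (z : 'rV[R]_n * R) : 'rV[R]_n.+1 :=
  row_mx (const_mx z.2 : 'rV_1) z.1.

Fixpoint lebesgue_rV n : set 'rV[R]_n -> \bar R :=
  match n with
  | 0 => dirac (0 : 'rV[R]_0)
  | m.+1 => pushforward (lebesgue_rV (n := m) \x lebesgue_measure)%E
              (@rV_cons m)
  end.

Lemma measurable_rV_cons n :
  measurable_fun [set: 'rV[R]_n * measurableTypeR R] (@rV_cons n).
Proof.
apply: measurable_fun_rV => i.
have [->|i0] := eqVneq i ord0.
  rewrite (_ : (fun _ => _) = snd); first exact: measurable_snd.
  by apply/funext => z; rewrite /rV_cons mxE; case: splitP => // j; rewrite ?mxE.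
have i1n : (i.-1 < n)%N by rewrite prednK ?lt0n// -ltnS.
rewrite (_ : (fun _ => _) = (fun v : 'rV[R]_n => v ord0 (Ordinal i1n)) \o fst).
  by apply: measurableT_comp => //; exact: measurable_coord.
apply/funext => z /=; rewrite /rV_cons mxE; case: splitP => j ij.
  by case/eqP: i0; apply/val_inj; rewrite /= ij ord1.
by congr (z.1 _ _); apply/val_inj; rewrite /= ij.
Qed.

Lemma lebesgue_rV_measure n :
  {m : {measure set 'rV[R]_n -> \bar R} | lebesgue_rV (n := n) = m}.
Proof.
elim: n => [|n [m mE]]; first by exists (@dirac _ 'rV[R]_0 0 R).
rewrite /= mE.
by exists (measure_function_pushforward__canonical__measure_function_Measure
  (m \x lebesgue_measure)%E (@measurable_rV_cons n)).
Qed.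

Let lebesgue_rV0 n : lebesgue_rV (n := n) set0 = 0%E.
Proof. by have [m ->] := lebesgue_rV_measure n; exact: measure0. Qed.

Let lebesgue_rV_ge0 n A : (0 <= lebesgue_rV (n := n) A)%E.
Proof. by have [m ->] := lebesgue_rV_measure n; exact: measure_ge0. Qed.

Let lebesgue_rV_sigma_additive n : semi_sigma_additive (lebesgue_rV (n := n)).
Proof.
by have [m ->] := lebesgue_rV_measure n; exact: measure_semi_sigma_additive.
Qed.

HB.instance Definition _ n := isMeasure.Build _ _ _ (lebesgue_rV (n := n))
  (lebesgue_rV0 n) (@lebesgue_rV_ge0 n) (@lebesgue_rV_sigma_additive n).

End lebesgue_rV.

Section euclidean.
Context {R : realType} {d : nat}.
Implicit Types (A : set 'rV[R]_d) (P : probability 'rV[R]_d R).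

(* The norm [`| x |] of ['rV[R]_d] is the maximum norm, hence the following. *)
Definition enorm (x : 'rV[R]_d) : R := Num.sqrt (\sum_i x ord0 i ^+ 2).

Definition eball (x : 'rV[R]_d) (r : R) : set 'rV[R]_d :=
  [set y | enorm (y - x) < r].

Definition ediam A : R := sup [set enorm (x - y) | x in A & y in A].

Definition msupport P : set 'rV[R]_d :=
  [set x | forall r, 0 < r -> (0 < P (eball x r))%E].

(* For compact nonempty [A] the infimum is attained, since the mass of an open
   ball is a lower semicontinuous function of its centre. *)
Definition min_ball_mass P A (r : R) : R :=
  inf [set fine (P (eball x r)) | x in A].

Definition has_lebesgue_density P (rho : 'rV[R]_d -> R) : Prop :=
  [/\ measurable_fun setT rho, forall x, 0 <= rho x &
      forall A, measurable A ->
        P A = (\int[lebesgue_rV (n := d)]_(x in A) (rho x)%:E)%E].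

(* Lipschitz for the Euclidean norm of R^d x R^d = R^(2 d). *)
Definition cost_lipschitz (Omega Omega' : set 'rV[R]_d) (L : R)
    (c : 'rV[R]_d -> 'rV[R]_d -> R) : Prop :=
  forall x1 x2 y1 y2, Omega x1 -> Omega x2 -> Omega' y1 -> Omega' y2 ->
    `|c x1 y1 - c x2 y2| <=
    L * Num.sqrt (enorm (x1 - x2) ^+ 2 + enorm (y1 - y2) ^+ 2).

End euclidean.

Section regularization.
Context {R : realType}.
Implicit Types phi psi : R -> R.

Definition strictly_convex_on (D : set R) (f : R -> R) : Prop :=
  forall x y s, D x -> D y -> x != y -> 0 < s < 1 ->
    f (s * x + (1 - s) * y) < s * f x + (1 - s) * f y.

(* Only the values of [phi] on [0, +oo[ matter. The supremum is finite when
   [phi] is convex with superlinear growth. *)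
Definition convex_conj phi (y : R) : R :=
  sup [set x * y - phi x | x in `[0, +oo[%classic].

Definition regularization phi (delta t : R) : Prop :=
  let psi := convex_conj phi in
  [/\ strictly_convex_on `[0, +oo[%classic phi,
      phi x / x @[x --> +oo] --> +oo,
      (forall y, derivable psi y 1) /\ continuous (derive1 psi),
      derive1 psi x @[x --> +oo] --> +oo &
      [/\ 0 < t, 0 < delta, derive1 psi t = 1 &
          strictly_convex_on `[t - delta, +oo[%classic psi]].

(* [psi] is C^{1,1}_loc and [psi2] is a monotone representative, locally
   essentially bounded, of its a.e. second derivative. *)
Definition nondecreasing_second_derivative psi (psi2 : R -> R) : Prop :=
  [/\ forall a b, [lipschitz derive1 psi x | x in `[a, b]%classic],
      {ae lebesgue_measure, forall x : R, is_derive x 1 (derive1 psi) (psi2 x)},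
      measurable_fun setT psi2,
      {homo psi2 : x y / x <= y} &
      forall a b, exists M,
        {ae lebesgue_measure, forall x : R, a <= x <= b -> `|psi2 x| <= M}].

End regularization.

Section optimal_transport.
Context {R : realType} {d1 d2} {T1 : measurableType d1} {T2 : measurableType d2}.
Implicit Types (mu : probability T1 R) (nu : probability T2 R)
  (pi : probability (T1 * T2)%type R).

Definition prod_prob mu nu : probability (T1 * T2)%type R := (mu \x nu)%E.

Definition coupling mu nu : set (probability (T1 * T2)%type R) :=
  [set pi | (forall A, measurable A -> pi (A `*` setT) = mu A) /\
            (forall B, measurable B -> pi (setT `*` B) = nu B)].

(* The density of [pi] with respect to [mu \x nu]; meaningful only if [pi] is
   absolutely continuous. *)
Definition coupling_density mu nu pi (z : T1 * T2) : R :=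
  fine (Radon_Nikodym (charge_of_finite_measure pi) (prod_prob mu nu) z).

Definition phi_divergence (phi : R -> R) mu nu pi : \bar R :=
  if `[< pi `<< prod_prob mu nu >] then
    (\int[prod_prob mu nu]_z (phi (coupling_density mu nu pi z))%:E)%E
  else +oo%E.

(* The cost [c] is only meaningful on [D1 `*` D2], which is meant to carry all
   the mass of [pi]. *)
Definition transport_cost (D1 : set T1) (D2 : set T2) (c : T1 -> T2 -> R)
    (phi : R -> R) (eps : R) mu nu pi : \bar R :=
  (\int[pi]_(z in D1 `*` D2) (c z.1 z.2)%:E +
   eps%:E * phi_divergence phi mu nu pi)%E.

Definition OT D1 D2 c phi eps mu nu : \bar R :=
  ereal_inf [set transport_cost D1 D2 c phi eps mu nu pi
            | pi in coupling mu nu].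

Definition OT_optimizer D1 D2 c phi eps mu nu pi : Prop :=
  coupling mu nu pi /\
  transport_cost D1 D2 c phi eps mu nu pi = OT D1 D2 c phi eps mu nu.

Definition potentials (D1 : set T1) (D2 : set T2) (c : T1 -> T2 -> R)
    (psi : R -> R) (eps : R) mu nu (f : T1 -> R) (g : T2 -> R) : Prop :=
  [/\ measurable_fun D1 f /\ [bounded f x | x in D1],
      measurable_fun D2 g /\ [bounded g y | y in D2],
      (forall x, D1 x ->
        \int[nu]_(y in D2) (derive1 psi ((f x + g y - c x y) / eps))%:E = 1)%E,
      (forall y, D2 y ->
        \int[mu]_(x in D1) (derive1 psi ((f x + g y - c x y) / eps))%:E = 1)%E &
      (\int[mu]_(x in D1) (f x)%:E = 0)%E].

End optimal_transport.

Section sampling.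
Context {R : realType}.

Definition mutually_independent {dS dT} {S : measurableType dS}
    {T : measurableType dT} (Pr : probability S R) (I : eqType)
    (Z : I -> S -> T) : Prop :=
  forall (s : seq I) (A : I -> set T), uniq s -> (forall i, measurable (A i)) ->
    Pr (\bigcap_(i in [set` s]) (Z i @^-1` A i)) =
    (\prod_(i <- s) Pr (Z i @^-1` A i))%E.

(* For [0 < n] this is (1/n) \sum_(i < n) \d_(x_i); the last argument of
   [mnormalize] is used only for [n = 0]. *)
Definition empirical {dT} {T : measurableType dT} n (xs : n.-tuple T) :
    probability T R :=
  mnormalize (msum (fun i => @dirac _ T (nth point xs i) R) n) (dirac point).

Definition sample {S T : Type} (X : nat -> S -> T) n (w : S) : n.-tuple T :=
  [tuple X i w | i < n].

(* A choice of the potentials for every sample of points of [D1] and [D2], the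
   potentials at any given point being measurable functions of the sample. *)
Definition empirical_potentials {d1 d2} {T1 : measurableType d1}
    {T2 : measurableType d2} (D1 : set T1) (D2 : set T2) (c : T1 -> T2 -> R)
    (psi : R -> R) (eps : R) n (f : n.-tuple T1 -> n.-tuple T2 -> T1 -> R)
    (g : n.-tuple T1 -> n.-tuple T2 -> T2 -> R) : Prop :=
  let samples := [set s : n.-tuple T1 * n.-tuple T2 |
    (forall i, D1 (tnth s.1 i)) /\ (forall j, D2 (tnth s.2 j))] in
  [/\ forall xs ys, samples (xs, ys) ->
        potentials D1 D2 c psi eps (empirical xs) (empirical ys)
          (f xs ys) (g xs ys),
      forall x, D1 x -> measurable_fun samples (fun s => f s.1 s.2 x) &
      forall y, D2 y -> measurable_fun samples (fun s => g s.1 s.2 y)].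

End sampling.

Section constants.
Context {R : realType}.

(* Here [k] stands for psi''(t_psi - delta_psi), [mP] and [mQ] for the minimal
   masses of balls, [g] for gamma(n, eps) and [N] for the integer
   ceil(16 L diam(Omega) / (delta_psi eps)). *)
Definition alpha_const (d : nat) (lam Lam k mQ g N : R) : R :=
  lam ^+ 2 * k ^+ 2 * mQ / (8 * Lam ^+ 2 * g * N ^+ (d + 2)).

Definition beta_const (alpha k mP g : R) : R :=
  Num.min (4 * alpha * k * mP / (k * mP + 8 * g)) (k * mP / 2).

End constants.

(* Main.v *)
(* Both OT values equal the value of the concave dual functional at potentials
   satisfying the marginal equations. Potentials (f, g) of (P, Q) are obtained as an
   ultralimit of empirical potentials along samples converging weakly to P and Q.
   Let D be the empirical dual functional. Its expectation at (f, g) is the population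
   value, so the bias is nonnegative and bounded by the expected gap D(fhat, ghat) - D(f, g).
   By concavity the gap is at most the pairing of the gradient of D at (f, g) with
   (a, b) = (fhat - f, ghat - g).

   On the pairs (i, j) whose empirical density is bounded away from the degenerate
   region, D is uniformly concave, so the pairing controls the sum of (a_i + b_j)^2
   over these pairs. If every ball of radius of order eps contains its expected share
   of sample points, a chain of balls along segments of the convex set Omega turns this
   into a Poincare inequality for (a, b), hence the gap is at most (K / beta) |grad|^2,
   and E |grad|^2 = 2 Var(rho_eps) / n.

   On the remaining samples (a, b) is only bounded, which gives
   gap <= tau |grad|^2 + C / tau for every tau > 0. By Chebyshev over a finite net these
   samples have probability of order 1 / n up to powers of the ball masses, and
   optimizing over tau yields the second term of the bound. *)
Require Import Defs.
From HB Require Import structures.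
From mathcomp Require Import all_boot all_order all_algebra.
From mathcomp Require Import all_classical all_reals all_analysis.
From mathcomp Require Import measurable_realfun ring lra.
Set Implicit Arguments.
Unset Strict Implicit.
Unset Printing Implicit Defensive.
Import Order.TTheory GRing.Theory Num.Theory.
Import numFieldNormedType.Exports.

Local Open Scope classical_set_scope.
Local Open Scope ring_scope.

(** * Bounded measurable functions *)

(** Two functionals of the sample have explicit expectations: the dual at fixed population
    potentials, which is unbiased, and its squared gradient there. The empirical transport cost is
    only enclosed, almost surely, between bounded measurable functions of the sample; monotonicity
    of the integral then bounds its expectation.

    The obstacle is that [psi] is strongly convex only to the right of [t - delta]. The marginal
    equations give every point a partner where the argument of [psi'] is at least [t], and the
    Lipschitz constant [2 * L / eps] of this argument spreads the property over balls. Hence the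
    radius [rad = delta * eps / (16 * L)] and the threshold [t - 3 * delta / 4]. A chain has about
    [1 / eps] steps, and its squared length enters the Poincare constant; together with the ball
    masses this produces, up to constants, the reciprocal of [beta].

    There is no conditioning on good samples. A sum of squared deviations that is at least 1 on bad
    samples multiplies the crude bound, so one inequality holds for almost every sample. Its
    parameter [tau] is deterministic and is optimized after taking expectations. *)

Section integral_monotone.
Context {d} {T : measurableType d} {R : realType}.
Variable mu : {measure set T -> \bar R}.
Local Open Scope ereal_scope.

(* The integral of the library is a supremum over simple functions, hence
   monotone even without measurability. *)
Lemma le_integral_gen (f g : T -> \bar R) : (forall x, f x <= g x) ->
  \int[mu]_x f x <= \int[mu]_x g x.
Proof.
move=> fg.
have mono (f1 f2 : T -> \bar R) : (forall x, 0 <= f1 x) ->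
    (forall x, f1 x <= f2 x) -> \int[mu]_x f1 x <= \int[mu]_x f2 x.
  move=> f10 f12; rewrite !ge0_integralTE//; last first.
    by move=> x; exact: le_trans (f12 x).
  apply: le_ereal_sup => _ [h /= hf <-]; exists h => //= x.
  exact: le_trans (f12 x).
rewrite integralE [leRHS]integralE; apply: leeB; apply: mono => // x.
  by rewrite !funeposE ge_max !le_max lexx fg orbT.
by rewrite !funenegE ge_max !le_max lexx orbT andbT leeN2 fg.
Qed.

(** The integrable function is lowered to [-oo] on the exceptional null set: its integral is
    unchanged and the inequality becomes pointwise, so nothing is asked of [g]. Such a [g] will be
    [phi] of a density, or the transport cost of a random sample. *)
Lemma ae_le_integral_measurable_l (f g : T -> \bar R) : mu.-integrable setT f ->
  {ae mu, forall x, f x <= g x} -> \int[mu]_x f x <= \int[mu]_x g x.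
Proof.
move=> intf [N [mN N0 fgN]]; have mf := measurable_int _ intf.
pose f' (x : T) : \bar R := if x \in N then -oo else f x.
have mf' : measurable_fun setT (f' : T -> \bar R).
  apply: measurable_fun_ifT => //.
  by apply: (measurable_fun_bool true); rewrite setTI /preimage/=;
    rewrite (_ : [set _ | _] = N)//; apply/seteqP; split => x /=; [move/set_mem|move/mem_set].
have -> : \int[mu]_x f x = \int[mu]_x f' x.
  apply: ae_eq_integral => //; exists N; split => // x /= /not_implyP[_ ffx].
  by apply: contrapT => Nx; apply: ffx; rewrite /f' memNset.
apply: le_integral_gen => x; rewrite /f'; case: ifPn => [_|]; first exact: leNye.
by rewrite notin_setE => Nx; apply: contrapT => fx; exact/Nx/fgN.
Qed.

(** Mirror image: the integrable upper function is raised to [+oo] on the null set. *)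
Lemma ae_le_integral_measurable_r (f g : T -> \bar R) : mu.-integrable setT g ->
  {ae mu, forall x, f x <= g x} -> \int[mu]_x f x <= \int[mu]_x g x.
Proof.
move=> intg [N [mN N0 fgN]]; have mg := measurable_int _ intg.
pose g' (x : T) : \bar R := if x \in N then +oo else g x.
have mg' : measurable_fun setT (g' : T -> \bar R).
  apply: measurable_fun_ifT => //.
  by apply: (measurable_fun_bool true); rewrite setTI /preimage/=;
    rewrite (_ : [set _ | _] = N)//; apply/seteqP; split => x /=; [move/set_mem|move/mem_set].
have -> : \int[mu]_x g x = \int[mu]_x g' x.
  apply: ae_eq_integral => //; exists N; split => // x /= /not_implyP[_ ffx].
  by apply: contrapT => Nx; apply: ffx; rewrite /g' memNset.
apply: le_integral_gen => x; rewrite /g'; case: ifPn => [_|]; first exact: leey.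
by rewrite notin_setE => Nx; apply: contrapT => fx; exact/Nx/fgN.
Qed.

End integral_monotone.

(** A class stable under algebraic operations, sections and partial integration, and integrable for
    every probability measure; it discharges most integrability side conditions. *)
Definition bounded_measurable {d} {T : measurableType d} {R : realType}
    (F : T -> R) : Prop :=
  measurable_fun setT F /\ exists M, forall x, `|F x| <= M.

Section bounded_measurable.
Context {d} {T : measurableType d} {R : realType}.
Implicit Types (F G : T -> R) (P : probability T R).

Lemma bm_cst (r : R) : bounded_measurable (fun _ : T => r).
Proof. by split => //; exists `|r|. Qed.

Lemma bmN F : bounded_measurable F -> bounded_measurable (fun x => - F x).
Proof.
move=> [mF [M FM]]; split; first exact: measurable_funN.
by exists M => x; rewrite normrN.
Qed.

Lemma bmD F G : bounded_measurable F -> bounded_measurable G ->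
  bounded_measurable (fun x => F x + G x).
Proof.
move=> [mF [M FM]] [mG [N GN]]; split; first exact: measurable_funD.
by exists (M + N) => x; rewrite (le_trans (ler_normD _ _))// lerD.
Qed.

Lemma bmB F G : bounded_measurable F -> bounded_measurable G ->
  bounded_measurable (fun x => F x - G x).
Proof. by move=> bF bG; apply: bmD => //; exact: bmN. Qed.

Lemma bmM F G : bounded_measurable F -> bounded_measurable G ->
  bounded_measurable (fun x => F x * G x).
Proof.
move=> [mF [M FM]] [mG [N GN]]; split; first exact: measurable_funM.
by exists (M * N) => x; rewrite normrM ler_pM.
Qed.

Lemma bmZ (r : R) F : bounded_measurable F ->
  bounded_measurable (fun x => r * F x).
Proof. by move=> bF; apply: bmM => //; exact: bm_cst. Qed.

Lemma bmX F n : bounded_measurable F -> bounded_measurable (fun x => F x ^+ n).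
Proof.
move=> bF; elim: n => [|n ih]; first by under eq_fun do rewrite expr0; exact: bm_cst.
by under eq_fun do rewrite exprS; exact: bmM.
Qed.

Lemma bm_sum (I : Type) (s : seq I) (F : I -> T -> R) :
  (forall i, bounded_measurable (F i)) ->
  bounded_measurable (fun x => \sum_(i <- s) F i x).
Proof.
move=> bF; elim: s => [|i s ih].
  by under eq_fun do rewrite big_nil; exact: bm_cst.
by under eq_fun do rewrite big_cons; exact: bmD.
Qed.

Lemma bm_indic (A : set T) : measurable A -> bounded_measurable (\1_A : T -> R).
Proof.
move=> mA; split => //; exists 1 => x.
by rewrite indicE; case: (_ \in _); rewrite ?normr1 ?normr0.
Qed.

Lemma bm_real_comp (u : R -> R) F : measurable_fun setT u ->
  (forall M, exists N, forall x, `|x| <= M -> `|u x| <= N) ->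
  bounded_measurable F -> bounded_measurable (fun x => u (F x)).
Proof.
move=> mu bu [mF [M FM]]; split; first exact: measurableT_comp.
by have [N uN] := bu M; exists N => x; exact: uN.
Qed.

Lemma bm_restrict (D : set T) F : measurable D -> measurable_fun D F ->
  (exists M, forall x, D x -> `|F x| <= M) -> bounded_measurable (F \_ D).
Proof.
move=> mD mF [M FM]; split.
  by apply/(measurable_restrictT _ mD).1.
exists `|M| => x; rewrite /patch; case: ifPn; last by rewrite normr0.
by rewrite inE => /FM Fx; rewrite (le_trans Fx)// ler_norm.
Qed.

Lemma bm_integrable P F : bounded_measurable F -> P.-integrable setT (EFin \o F).
Proof.
move=> [mF [M FM]]; apply: measurable_bounded_integrable => //.
  by rewrite (le_lt_trans (probability_le1 P _))// ltry.
exists M; split; first exact: num_real.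
by move=> M' MM' x _ /=; rewrite (le_trans (FM x))// ltW.
Qed.
Hint Resolve bm_integrable : core.

Lemma bm_integralE P F : bounded_measurable F ->
  (\int[P]_x (F x)%:E)%E = (\int[P]_x F x)%:E.
Proof.
move=> bF; rewrite /Rintegral fineK//; apply: integrable_fin_num => //.
exact: bm_integrable.
Qed.

Lemma bm_RintegralD P F G : bounded_measurable F -> bounded_measurable G ->
  \int[P]_x (F x + G x) = \int[P]_x F x + \int[P]_x G x.
Proof. by move=> bF bG; apply: RintegralD => //; exact: bm_integrable. Qed.

Lemma bm_RintegralB P F G : bounded_measurable F -> bounded_measurable G ->
  \int[P]_x (F x - G x) = \int[P]_x F x - \int[P]_x G x.
Proof. by move=> bF bG; apply: RintegralB => //; exact: bm_integrable. Qed.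

Lemma bm_RintegralZ P (r : R) F : bounded_measurable F ->
  \int[P]_x (r * F x) = r * \int[P]_x F x.
Proof. by move=> bF; apply: RintegralZl => //; exact: bm_integrable. Qed.

Lemma Rintegral_prob_cst P (r : R) : \int[P]_x r = r.
Proof.
by rewrite Rintegral_cst// (_ : _ setT = 1%E) ?mulr1//; exact: probability_setT.
Qed.

Lemma bm_Rintegral_sum P (I : Type) (s : seq I) (F : I -> T -> R) :
  (forall i, bounded_measurable (F i)) ->
  \int[P]_x (\sum_(i <- s) F i x) = \sum_(i <- s) \int[P]_x F i x.
Proof.
move=> bF; elim: s => [|i s ih].
  by under eq_Rintegral do rewrite big_nil; rewrite Rintegral_prob_cst big_nil.
under eq_Rintegral do rewrite big_cons.
by rewrite bm_RintegralD ?ih ?big_cons//; exact: bm_sum.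
Qed.

Lemma bm_le_Rintegral P F G : bounded_measurable F -> bounded_measurable G ->
  (forall x, F x <= G x) -> \int[P]_x F x <= \int[P]_x G x.
Proof. by move=> bF bG FG; apply: le_Rintegral => //; exact: bm_integrable. Qed.

Lemma bm_normr_Rintegral_le P F M : bounded_measurable F ->
  (forall x, `|F x| <= M) -> `|\int[P]_x F x| <= M.
Proof.
move=> bF FM; have h x : - M <= F x <= M by rewrite -ler_norml.
rewrite ler_norml -{1}(Rintegral_prob_cst P (- M)) -{2}(Rintegral_prob_cst P M).
by apply/andP; split; apply: bm_le_Rintegral => //;
  (try exact: bm_cst) => x; case/andP: (h x).
Qed.

Lemma ae_eq_Rintegral P F G : measurable_fun setT F -> measurable_fun setT G ->
  {ae P, forall x, F x = G x} -> \int[P]_x F x = \int[P]_x G x.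
Proof.
move=> mF mG FG; congr fine; apply: ae_eq_integral => //;
  try exact/measurable_EFinP.
by apply: filterS FG => x + _ => ->.
Qed.

Lemma full_ae P (D : set T) : measurable D -> P D = 1%E -> {ae P, forall x, D x}.
Proof.
move=> mD PD; exists (~` D); split => //; first exact: measurableC.
by rewrite probability_setC// PD subee.
Qed.

(** Trades a function that is meaningful only on a set of full mass, such as the cost, for a bounded
    measurable one defined everywhere. *)
Lemma full_integral P (D : set T) F G : measurable D -> P D = 1%E ->
  bounded_measurable G -> (forall x, D x -> F x = G x) ->
  (\int[P]_(x in D) (F x)%:E)%E = (\int[P]_x G x)%:E.
Proof.
move=> mD PD bG FG; rewrite -bm_integralE//.
rewrite (eq_integral (EFin \o G)); last by move=> x /[!inE] /FG /= ->.
rewrite [RHS](@negligible_integral _ _ _ _ _ (~` D))//.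
- by rewrite setTD setCK.
- exact: measurableC.
- exact: bm_integrable.
- have : P (~` D) = 0%E by rewrite probability_setC// PD subee.
  exact.
Qed.

End bounded_measurable.

Section bounded_measurable_product.
Context {d1 d2} {T1 : measurableType d1} {T2 : measurableType d2} {R : realType}.
Implicit Types (mu : probability T1 R) (nu : probability T2 R).

Lemma bm_comp (F : T2 -> R) (X : T1 -> T2) : measurable_fun setT X ->
  bounded_measurable F -> bounded_measurable (fun x => F (X x)).
Proof.
by move=> mX [mF [M FM]]; split; [exact: measurableT_comp|exists M => x].
Qed.

Lemma bm_pair1 (F : T1 * T2 -> R) x : bounded_measurable F ->
  bounded_measurable (fun y => F (x, y)).
Proof.
move=> [mF [M FM]]; split; last by exists M => y.
by apply: (measurableT_comp mF); exact: measurable_pair1.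
Qed.

Lemma bm_pair2 (F : T1 * T2 -> R) y : bounded_measurable F ->
  bounded_measurable (fun x => F (x, y)).
Proof.
move=> [mF [M FM]]; split; last by exists M => x.
by apply: (measurableT_comp mF); exact: measurable_pair2.
Qed.

Lemma bm_Fubini1 mu nu (F : T1 * T2 -> R) : bounded_measurable F ->
  bounded_measurable (fun x => \int[nu]_y F (x, y)) /\
  \int[prod_prob mu nu]_z F z = \int[mu]_x (\int[nu]_y F (x, y)).
Proof.
move=> bF; have iF : (mu \x nu)%E.-integrable setT (EFin \o F).
  exact: (bm_integrable (prod_prob mu nu)).
have E x : (\int[nu]_y (EFin \o F) (x, y))%E = (\int[nu]_y F (x, y))%:E.
  by rewrite -bm_integralE//; exact: bm_pair1.
have bI : bounded_measurable (fun x => \int[nu]_y F (x, y)).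
  split; last first.
    have [M FM] := bF.2; exists M => x.
    by apply: bm_normr_Rintegral_le => //; exact: bm_pair1.
  apply/measurable_EFinP; rewrite (_ : _ \o _ = fubini_F nu (EFin \o F)).
    exact: (@measurable_fubini_F _ _ _ _ _ mu nu _ iF).
  by apply/funext => x /=; rewrite /fubini_F E.
split => //; rewrite /Rintegral.
rewrite -(integral12_prod_meas1 iF); congr fine.
by apply: eq_integral => x _; rewrite /fubini_F E.
Qed.

Lemma bm_Fubini2 mu nu (F : T1 * T2 -> R) : bounded_measurable F ->
  bounded_measurable (fun y => \int[mu]_x F (x, y)) /\
  \int[prod_prob mu nu]_z F z = \int[nu]_y (\int[mu]_x F (x, y)).
Proof.
move=> bF; have iF : (mu \x nu)%E.-integrable setT (EFin \o F).
  exact: (bm_integrable (prod_prob mu nu)).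
have E x : (\int[mu]_y (EFin \o F) (y, x))%E = (\int[mu]_y F (y, x))%:E.
  by rewrite -bm_integralE//; exact: bm_pair2.
have bI : bounded_measurable (fun x => \int[mu]_y F (y, x)).
  split; last first.
    have [M FM] := bF.2; exists M => x.
    by apply: bm_normr_Rintegral_le => //; exact: bm_pair2.
  apply/measurable_EFinP; rewrite (_ : _ \o _ = fubini_G mu (EFin \o F)).
    exact: (@measurable_fubini_G _ _ _ _ _ mu nu _ iF).
  by apply/funext => x /=; rewrite /fubini_G E.
split => //; rewrite /Rintegral.
rewrite -(integral21_prod_meas1 iF); congr fine.
by apply: eq_integral => x _; rewrite /fubini_G E.
Qed.

Lemma prod_prob_rect mu nu A B : measurable A -> measurable B ->
  prod_prob mu nu (A `*` B) = (mu A * nu B)%E.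
Proof. by move=> mA mB; rewrite -product_measure1E. Qed.

Lemma prod_prob_full mu nu A B : measurable A -> measurable B ->
  mu A = 1%E -> nu B = 1%E -> prod_prob mu nu (A `*` B) = 1%E.
Proof. by move=> mA mB A1 B1; rewrite prod_prob_rect// A1 B1 mule1. Qed.

Lemma bm_Rintegral_law mu nu (X : T1 -> T2) (F : T2 -> R) :
  measurable_fun setT X ->
  (forall A, measurable A -> mu (X @^-1` A) = nu A) ->
  bounded_measurable F -> \int[mu]_x F (X x) = \int[nu]_y F y.
Proof.
move=> mX law bF; rewrite /Rintegral; congr fine.
transitivity (\int[pushforward mu X]_y (F y)%:E)%E; last first.
  apply: (@eq_measure_integral _ _ _ setT nu
    (measure_function_pushforward__canonical__measure_function_Measure mu mX)).
  by move=> A mA _; exact: law.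
rewrite (@integral_pushforward _ _ _ _ _ X mX mu setT (EFin \o F))//.
- by have [mF _] := bF; exact/measurable_EFinP.
- rewrite preimage_setT; apply: (@bm_integrable _ _ _ mu (fun x => F (X x))).
  exact: bm_comp.
Qed.

End bounded_measurable_product.

(** * Slopes of Lipschitz functions from almost everywhere derivatives *)

Section real_functions.
Context {R : realType}.
Implicit Types (f G : R -> R).

Lemma is_derive_dist f (x l : R) : is_derive x 1 f l -> forall eta, 0 < eta ->
  exists2 r, 0 < r & forall h, h != 0 -> `|h| < r ->
    `|(f (x + h) - f x) / h - l| <= eta.
Proof.
move=> [dfx fl] eta eta0.
have /cvgrPdist_le/(_ eta eta0) : (fun h : R => h^-1 *: (f (h *: (1 : R) + x) - f x))
    @ 0^' --> l by rewrite -fl; exact: dfx.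
move=> [r /= r0 rP]; exists r => // h h0 hr; rewrite distrC.
have := rP h; rewrite /= sub0r normrN => /(_ hr h0).
by rewrite scaler1 [h + x]addrC /GRing.scale/= mulrC.
Qed.

Lemma derivable_is_derive1 f (x : R) : derivable f x 1 -> is_derive x 1 f (derive1 f x).
Proof. by move=> dfx; split => //; rewrite derive1E. Qed.

(** The derivative is known to exist, so arbitrarily small steps of either sign with a good
    difference quotient decide the inequality. *)
Lemma is_derive_ge f (x l m : R) : is_derive x 1 f l ->
  (forall eta, 0 < eta -> exists2 h, 0 < `|h| < eta & m <= (f (x + h) - f x) / h) ->
  m <= l.
Proof.
move=> dfx fm; apply/ler_addgt0Pr => eta eta0.
have [r r0 rP] := is_derive_dist dfx eta0.
have [h /andP[h0 hr] mh] := fm _ r0.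
have := rP h; rewrite -normr_gt0 => /(_ h0 hr); rewrite ler_norml; lra.
Qed.

Lemma is_derive_le f (x l m : R) : is_derive x 1 f l ->
  (forall eta, 0 < eta -> exists2 h, 0 < `|h| < eta & (f (x + h) - f x) / h <= m) ->
  l <= m.
Proof.
move=> dfx fm; apply/ler_addgt0Pr => eta eta0.
have [r r0 rP] := is_derive_dist dfx eta0.
have [h /andP[h0 hr] mh] := fm _ r0.
have := rP h; rewrite -normr_gt0 => /(_ h0 hr); rewrite ler_norml; lra.
Qed.

(* The exceptional null set is covered by an open set [U] of small measure; then
   [G x - (k - eta) x + A * mu (U `&` [u, x])] increases to the right of every point. *)
Lemma ae_derive_ge_slope G (A k u v : R) : u < v -> 0 <= A ->
  (forall x y, u <= x <= v -> u <= y <= v -> `|G x - G y| <= A * `|x - y|) ->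
  {ae @lebesgue_measure R, forall x, u <= x <= v ->
    exists2 l, is_derive x 1 G l & k <= l} ->
  k * (v - u) <= G v - G u.
Proof.
move=> uv A0 GA [N [mN N0 GN]].
pose mu : {measure set (measurableTypeR R) -> \bar R} := @lebesgue_measure R.
have {}N0 : mu N = 0%E by exact: N0.
have muNoo : (mu N < +oo)%E by rewrite N0 ltry.
(* Inside the open cover [U] the function [G x - k * x] loses at most [A + |k|] per unit length,
   while the measure of [U] to the left of [x] grows at rate one: the weight [B] compensates the
   loss. *)
pose B := A + `|k|.
have B0 : 0 <= B by rewrite addr_ge0.
suff key eta : 0 < eta -> k * (v - u) <= G v - G u + eta * (v - u + B).
  apply/ler_addgt0Pr => e e0; have vuA : 0 < v - u + B by lra.
  have := key (e / (v - u + B)); rewrite divr_gt0// => /(_ isT).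
  by rewrite -mulrA mulVf ?mulr1// gt_eqF.
move=> eta0; have [U [oU NU]] := lebesgue_regularity_outer mN muNoo eta0.
have mU : measurable U by exact: open_measurable.
move=> UNeta0; have UNeta : (mu (U `\` N) < eta%:E)%E by exact: UNeta0.
have muU : (mu U < eta%:E)%E.
  have -> : mu U = (mu N + mu (U `\` N))%E.
    by rewrite -measureU//; [rewrite setDUK|exact: measurableD|rewrite setDIK].
  by rewrite N0 add0e.
have lemu (V W : set R) : measurable V -> measurable W -> V `<=` W -> (mu V <= mu W)%E.
  move=> mV mW VW; exact: (@le_measure _ _ _ mu V W (mem_set mV) (mem_set mW) VW).
pose m x := fine (mu (U `&` `[u, x]%classic)).
have mI x : measurable (U `&` `[u, x]%classic) by exact: measurableI.
have mlt x : (mu (U `&` `[u, x]) < eta%:E)%E.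
  by apply: le_lt_trans muU; apply: lemu => //; exact: subIsetl.
have mfin x : mu (U `&` `[u, x]) \is a fin_num.
  by rewrite ge0_fin_numE// (lt_le_trans (mlt x))// leey.
have mE x : mu (U `&` `[u, x]) = (m x)%:E by rewrite fineK.
have mu0 : m u = 0.
  apply: le_anti; rewrite -!lee_fin -!mE measure_ge0 andbT.
  have : (mu (U `&` `[u, u]) <= mu [set u])%E.
    apply: lemu => // x [_ /=]; rewrite in_itv/= => /le_anti.
    by move=> ->.
  by rewrite /mu/= lebesgue_measure_set1.
have meta : m v <= eta by rewrite -lee_fin -mE ltW.
have m_homo x y : x <= y -> m x <= m y.
  move=> xy; rewrite -lee_fin -!mE; apply: lemu => //.
  apply: setIS => z /=; rewrite !in_itv/= => /andP[-> zx]; exact: le_trans xy.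
pose H x := G x - k * x + eta * x + B * m x.
pose C := A + `|k| + eta.
(* This one-sided Lipschitz bound limits how fast [H] can drop; it carries [H u <= H x] to the
   supremum of [S] without using continuity of [m]. *)
have HC x y : u <= x -> x <= y -> y <= v -> H x - H y <= C * (y - x).
  move=> ux xy yv.
  have G2 : G x - G y <= A * (y - x).
    have := GA x y; rewrite ux yv (le_trans ux xy) (le_trans xy yv) => /(_ isT isT).
    by rewrite [`|x - y|]distrC [`|y - x|]ger0_norm ?subr_ge0// => /(le_trans (ler_norm _)).
  have k1 : - `|k| <= k by rewrite lerNl -normrN ler_norm.
  have k2 : k <= `|k| by exact: ler_norm.
  have mm := m_homo _ _ xy.
  have Bm : B * m x <= B * m y by exact: ler_wpM2l.
  have ky : k * (y - x) <= `|k| * (y - x) by rewrite ler_wpM2r// subr_ge0.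
  have ey : 0 <= eta * (y - x) by apply: mulr_ge0; [exact: ltW|rewrite subr_ge0].
  rewrite /H /C; lra.
have Hr x : u <= x -> x < v ->
    exists2 t, 0 < t & forall y, x < y < x + t -> y <= v -> H x <= H y.
  move=> ux xv; have [Ux|Ux] := pselect (U x).
    have [t /= t0 tU] : nbhs x U by exact: open_nbhs_nbhs.
    exists t => // y /andP[xy yt] yv.
    have my : y - x <= m y - m x.
      suff : (mu (U `&` `[u, x]) + mu `]x, y[%classic
          <= mu (U `&` `[u, y]))%E.
        by rewrite !mE /mu/= lebesgue_measure_itv/= lte_fin xy -EFinB -EFinD lee_fin; lra.
      have <- : mu ((U `&` `[u, x]) `|` `]x, y[) =
          (mu (U `&` `[u, x]) + mu `]x, y[%classic)%E.
        apply: measureU; [exact: mI|exact: measurable_itv|].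
        apply/seteqP; split => z //= [[_]]; rewrite !in_itv/= => /andP[_ zx] /andP[xz _].
        by move: (lt_le_trans xz zx); rewrite ltxx.
      apply: lemu => //; first by apply: measurableU => //; exact: mI.
      move=> z [[Uz]|]/=; rewrite !in_itv/=.
        by move=> /andP[-> zx]; split => //; rewrite (le_trans zx)// ltW.
      move=> /andP[xz zy]; split; last by rewrite (le_trans ux (ltW xz)) ltW.
      by apply: tU => /=; rewrite /ball/= distrC gtr0_norm ?subr_gt0//; lra.
    have := GA x y; rewrite ux yv (le_trans ux (ltW xy)) (ltW (lt_le_trans xy yv)).
    move=> /(_ isT isT); rewrite [`|x - y|]distrC [`|y - x|]gtr0_norm ?subr_gt0//.
    move=> /(le_trans (ler_norm _)) Gxy.
    have kxy : k * (y - x) <= `|k| * (y - x) by rewrite ler_wpM2r ?ler_norm// subr_ge0 ltW.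
    have exy : 0 <= eta * (y - x) by apply: mulr_ge0; apply: ltW; rewrite ?subr_gt0.
    have := ler_wpM2l B0 my; rewrite /H {1}/B; lra.
  have xN : ~ N x by move=> /NU.
  have [l dl kl] : exists2 l, is_derive x 1 G l & k <= l.
    apply: contrapT => nl; apply: xN; apply: GN => /= xP; apply: nl; apply: xP.
    by rewrite ux ltW.
  have [r r0 rP] := is_derive_dist dl eta0.
  exists r => // y /andP[xy yr] yv.
  have yx0 : 0 < y - x by rewrite subr_gt0.
  have := rP (y - x); rewrite gt_eqF// gtr0_norm// => /(_ isT).
  rewrite ltrBlDl => /(_ yr); rewrite [x + _]addrC subrK ler_norml => /andP[+ _].
  rewrite lerBrDr ler_pdivlMr// => Gy.
  have mm := m_homo _ _ (ltW xy).
  have Bm : B * m x <= B * m y by exact: ler_wpM2l.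
  have lk : (k - eta) * (y - x) <= (- eta + l) * (y - x) by rewrite ler_wpM2r; lra.
  rewrite /H; lra.
(* Induction along the interval: the supremum of [S] belongs to [S] by [HC], and if it were smaller
   than [v], [Hr] would extend [S] beyond it. *)
pose S := [set x | u <= x <= v /\ H u <= H x].
have Su : S u by split => //; rewrite lexx ltW.
have hS : has_sup S by split; [exists u|exists v => x [/andP[]]].
pose s := sup S.
have us : u <= s by exact: (ub_le_sup hS.2 Su).
have sv : s <= v by apply: ge_sup; [exists u|move=> x [/andP[]]].
have Hs : H u <= H s.
  apply/ler_addgt0Pr => e e0; have C0 : 0 < C by rewrite /C; have := normr_ge0 k; lra.
  have [x Sx xs] := sup_adherent (divr_gt0 e0 C0) hS.
  have [/andP[ux xv] Hx] := Sx; have xs' : x <= s by exact: (ub_le_sup hS.2 Sx).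
  have := HC x s ux xs' sv; have : C * (s - x) <= e; last by lra.
  rewrite -ler_pdivlMl// mulrC -/s in xs *; lra.
suff vs : v = s.
  have := ler_wpM2l B0 meta; move: Hs; rewrite /H -vs mu0; lra.
apply: le_anti; rewrite sv andbT leNgt; apply/negP => slt.
have [t t0 tP] := Hr s us slt.
pose y := Num.min v (s + t / 2).
have sy : s < y by rewrite lt_min slt/=; lra.
have yv : y <= v by rewrite ge_min lexx.
have Sy : S y.
  split; first by rewrite yv (le_trans us (ltW sy)).
  apply: (le_trans Hs); apply: tP => //; rewrite sy/= gt_min; apply/orP; right; lra.
by move: (ub_le_sup hS.2 Sy); rewrite -/s leNgt sy.
Qed.

End real_functions.

(** * The conjugate of a convex function *)

Section conjugate.
Context {R : realType}.
Variable phi : R -> R.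
Hypothesis phi_conv : strictly_convex_on `[0, +oo[%classic phi.
Hypothesis phi_growth : phi x / x @[x --> +oo] --> +oo.
Local Notation psi := (convex_conj phi).

Lemma phi_convex x y s : 0 <= x -> 0 <= y -> 0 <= s <= 1 ->
  phi (s * x + (1 - s) * y) <= s * phi x + (1 - s) * phi y.
Proof.
move=> x0 y0 /andP[s0 s1].
have [->|xy] := eqVneq x y; first by rewrite -mulrDl -[s * phi y + _]mulrDl subrKC !mul1r.
have [->|sN0] := eqVneq s 0; first by rewrite !mul0r subr0 !mul1r !add0r.
have [->|sN1] := eqVneq s 1; first by rewrite subrr !mul0r !mul1r !addr0.
apply: ltW; apply: phi_conv => //; rewrite /= ?in_itv/= ?andbT//.
by rewrite !lt_neqAle eq_sym sN0 s0 sN1 s1.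
Qed.

(** Convexity at the point 1 bounds [phi x] from below: 1 is a convex combination of [x] and 2 if
    [x <= 1], and of [x] and 0 otherwise. *)
Lemma phi_lower_bound X : exists m, forall x, 0 <= x <= X -> m <= phi x.
Proof.
pose m0 := `|phi 0| + `|phi 1| + `|phi 2|.
exists (- (2 * m0 * (`|X| + 2))) => x /andP[x0 xX].
have a0 := ler_norm (phi 0); have a1 := ler_norm (phi 1).
have a1' := ler_norm (- phi 1); have a2 := ler_norm (phi 2).
have n0 := normr_ge0 (phi 0); have n1 := normr_ge0 (phi 1).
have n2 := normr_ge0 (phi 2); rewrite normrN in a1'.
have X2 : x <= `|X| by rewrite (le_trans xX)// ler_norm.
have m00 : 0 <= m0 by rewrite !addr_ge0.
have mX : 0 <= m0 * `|X| by rewrite mulr_ge0.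
have [x1|x1] := leP x 1.
- have q : 0 < 2 - x by lra.
  have := @phi_convex x 2 (2 - x)^-1 x0; rewrite ler0n invr_ge0 ltW// invf_le1//.
  move=> /(_ isT); have -> : 1 <= 2 - x by lra.
  move=> /(_ isT); have -> : (2 - x)^-1 * x + (1 - (2 - x)^-1) * 2 = 1.
    by field; rewrite gt_eqF.
  have -> : (2 - x)^-1 * phi x + (1 - (2 - x)^-1) * phi 2 =
    (phi x + (1 - x) * phi 2) / (2 - x) by field; rewrite gt_eqF.
  rewrite ler_pdivlMr// => H.
  have : (1 - x) * phi 2 <= (1 - x) * `|phi 2| by rewrite ler_wpM2l//; lra.
  have : 0 <= x * `|phi 2| by rewrite mulr_ge0.
  have : - (phi 1 * (2 - x)) <= `|phi 1| * (2 - x) by rewrite -mulNr ler_wpM2r//; lra.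
  have : 0 <= x * `|phi 1| by rewrite mulr_ge0.
  rewrite /m0 in mX *; lra.
- have q : 0 < x by lra.
  have := @phi_convex x 0 x^-1 x0; rewrite lexx invr_ge0 x0 invf_le1// (ltW x1).
  move=> /(_ isT isT); have -> : x^-1 * x + (1 - x^-1) * 0 = 1.
    by field; rewrite gt_eqF.
  have -> : x^-1 * phi x + (1 - x^-1) * phi 0 =
    (phi x + (x - 1) * phi 0) / x by field; rewrite gt_eqF.
  rewrite ler_pdivlMr// => H.
  have : (x - 1) * phi 0 <= (x - 1) * `|phi 0| by rewrite ler_wpM2l//; lra.
  have : x * `|phi 0| <= `|X| * `|phi 0| by rewrite ler_wpM2r.
  have : - phi 1 * x <= `|phi 1| * `|X|.
    by apply: (le_trans (ler_wpM2r x0 a1')); rewrite ler_wpM2l.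
  have := mulr_ge0 (normr_ge0 X) n2; have := mulr_ge0 (normr_ge0 X) n1.
  have := mulr_ge0 (normr_ge0 X) n0.
  rewrite /m0 in mX *; lra.
Qed.

Lemma conj_has_sup y : has_sup [set x * y - phi x | x in `[0, +oo[%classic].
Proof.
split; first by exists (0 * y - phi 0), 0 => //=; rewrite in_itv/= lexx.
have /cvgryPge/(_ (`|y| + 1))[X [_ XP]] := phi_growth.
have [m mP] := phi_lower_bound (`|X| + 1).
exists ((`|X| + 1) * `|y| - m + `|m|) => _ [x /= + <-].
rewrite in_itv/= andbT => x0.
have ny := ler_norm y; have y0 := normr_ge0 y; have X0 := normr_ge0 X.
have nm := ler_norm m.
have [xX|Xx] := leP x (`|X| + 1).
  have /= := mP x; rewrite x0 xX => /(_ isT).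
  have : x * y <= (`|X| + 1) * `|y|.
    by apply: (@le_trans _ _ (x * `|y|)); [rewrite ler_wpM2l|rewrite ler_wpM2r].
  have := normr_ge0 m; lra.
have X_x : X < x by have := ler_norm X; lra.
have x_gt0 : 0 < x by lra.
have := XP x X_x; rewrite /= ler_pdivlMr// => H.
have : x * y <= `|y| * x by rewrite [leRHS]mulrC ler_wpM2l.
have := mulr_ge0 (addr_ge0 X0 ler01) y0; lra.
Qed.

Lemma conj_young x y : 0 <= x -> x * y - phi x <= psi y.
Proof.
move=> x0; apply: (ub_le_sup (conj_has_sup y).2).
by exists x => //=; rewrite in_itv/= x0.
Qed.

Lemma conj_le y m : (forall x, 0 <= x -> x * y - phi x <= m) -> psi y <= m.
Proof.
move=> ym; apply: ge_sup; first exact: (conj_has_sup y).1.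
by move=> _ [x /= + <-]; rewrite in_itv/= andbT; exact: ym.
Qed.

Lemma conj_homo y z : y <= z -> psi y <= psi z.
Proof.
move=> yz; apply: conj_le => x x0; apply: (le_trans _ (conj_young z x0)).
by rewrite lerB// ler_wpM2l.
Qed.

Lemma conj_convex y z s : 0 <= s <= 1 ->
  psi (s * y + (1 - s) * z) <= s * psi y + (1 - s) * psi z.
Proof.
move=> /andP[s0 s1]; have s1' : 0 <= 1 - s by lra.
apply: conj_le => x x0.
have := ler_wpM2l s0 (conj_young y x0); have := ler_wpM2l s1' (conj_young z x0).
lra.
Qed.

Lemma conj_approx_max y eta : 0 < eta ->
  exists2 x, 0 <= x & psi y - eta < x * y - phi x.
Proof.
move=> eta0; have [_ [x /= + <-]] := sup_adherent eta0 (conj_has_sup y).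
by rewrite in_itv/= andbT => x0; exists x.
Qed.

Hypothesis psi_der : forall y : R, derivable psi y 1.
Local Notation psi1 := (derive1 psi).

Lemma conj_is_derive (y : R) : is_derive y 1 psi (psi1 y).
Proof. exact: derivable_is_derive1. Qed.

Lemma conj_tangent y z : psi y + psi1 y * (z - y) <= psi z.
Proof.
have [->|yz] := eqVneq z y; first by rewrite subrr mulr0 addr0.
have slope h : 0 < h <= 1 -> (psi (y + h * (z - y)) - psi y) / h <= psi z - psi y.
  move=> /andP[h0 h1]; rewrite ler_pdivrMr//.
  have := @conj_convex z y h; rewrite (ltW h0) h1 => /(_ isT).
  have -> : h * z + (1 - h) * y = y + h * (z - y) by ring.
  lra.
have dist : 0 < `|z - y| by rewrite normr_gt0 subr_eq0.
have small eta : 0 < eta -> exists2 h, 0 < h <= 1 & 0 < `|h * (z - y)| < eta.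
  move=> eta0; exists (Num.min 1 (eta / (2 * `|z - y|))).
    by rewrite lt_min ltr01 divr_gt0//= ?mulr_gt0// ge_min lexx.
  set h := Num.min _ _; have h0 : 0 < h by rewrite lt_min ltr01 divr_gt0 ?mulr_gt0.
  rewrite normrM gtr0_norm// mulr_gt0//=.
  have : h <= eta / (2 * `|z - y|) by rewrite ge_min lexx orbT.
  rewrite ler_pdivlMr ?mulr_gt0//; lra.
rewrite -lerBrDl; move: yz; rewrite neq_lt => /orP[zy|yz].
- rewrite -ler_ndivrMr; last by rewrite subr_lt0.
  apply: (is_derive_ge (conj_is_derive y)) => eta /small[h h01 hz].
  exists (h * (z - y)) => //; have /andP[h0 _] := h01.
  rewrite invfM mulrA ler_ndivrMr ?subr_lt0// mulfVK ?lt_eqF ?subr_lt0//.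
  exact: slope.
- rewrite -ler_pdivlMr ?subr_gt0//.
  apply: (is_derive_le (conj_is_derive y)) => eta /small[h h01 hz].
  exists (h * (z - y)) => //; have /andP[h0 _] := h01.
  by rewrite invfM mulrA ler_pM2r ?invr_gt0 ?subr_gt0//; exact: slope.
Qed.

Lemma conj_derive_homo y z : y <= z -> psi1 y <= psi1 z.
Proof.
rewrite le_eqVlt => /predU1P[->//|yz].
have := conj_tangent y z; have := conj_tangent z y => h1 h2.
have : (psi1 y - psi1 z) * (z - y) <= 0 by lra.
by rewrite pmulr_lle0 ?subr_gt0// subr_le0.
Qed.

Lemma conj_derive_ge0 y : 0 <= psi1 y.
Proof.
have := conj_tangent y (y - 1); have := @conj_homo (y - 1) y; rewrite gerBl ler01.
by move=> /(_ isT); lra.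
Qed.

(** Equality in Young's inequality makes the line of slope [r] support [psi] at [y]; a
    differentiable function has only one supporting slope. *)
Lemma conj_eq_derive r y : 0 <= r -> phi r <= r * y - psi y -> r = psi1 y.
Proof.
move=> r0 ry.
have tg h : psi y + r * h <= psi (y + h).
  have := conj_young (y + h) r0; lra.
apply: le_anti; apply/andP; split.
- apply: (is_derive_ge (conj_is_derive y)) => eta eta0.
  exists (eta / 2); first by rewrite gtr0_norm; lra.
  by rewrite ler_pdivlMr; [have := tg (eta / 2); lra|lra].
- apply: (is_derive_le (conj_is_derive y)) => eta eta0.
  exists (- (eta / 2)); first by rewrite normrN gtr0_norm; lra.
  by rewrite ler_ndivrMr; [have := tg (- (eta / 2)); lra|lra].
Qed.

(* [phi] may jump upwards at [0], where the supremum defining [psi y] need not be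
   attained; convex combinations with a point of the interior avoid this. *)
Lemma phi_mix y s : 0 < s < 1 ->
  phi ((1 - s) * psi1 y + s) <=
  (1 - s) * (psi1 y * y - psi y) + s * Num.max (phi (1 / 2)) (phi (3 / 2)).
Proof.
move=> /andP[s0 s1]; set kap := Num.max _ _.
apply/ler_addgt0Pr => tau tau0.
pose c := tau / (2 * (`|y| + 1)).
have c0 : 0 < c by rewrite divr_gt0// mulr_gt0// ltr_wpDl.
have cy : c * `|y| <= tau / 2.
  rewrite /c; have q : 0 < 2 * (`|y| + 1) by rewrite mulr_gt0// ltr_wpDl.
  rewrite mulrAC ler_pdivrMr//; have := normr_ge0 y; have := tau0; nra.
(* The bound [c] keeps [eta * |y|] below [tau / 2]; the other bound keeps the auxiliary point [w]
   within [1 / 2] of 1. *)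
pose eta := Num.min c (s / (2 * (1 - s))).
have eta0 : 0 < eta by rewrite lt_min c0 divr_gt0// mulr_gt0// subr_gt0.
have [r r0 rP] := is_derive_dist (conj_is_derive y) (divr_gt0 eta0 (ltr0n _ 2)).
pose h := Num.min (r / 2) (eta / 2).
have h0 : 0 < h by rewrite lt_min !divr_gt0.
have hr : h < r by rewrite gt_min; apply/orP; left; lra.
have he : h <= eta / 2 by rewrite ge_min lexx orbT.
pose e := Num.min (h ^+ 2) (tau / 2).
have e0 : 0 < e by rewrite lt_min exprn_gt0// divr_gt0.
have eh : e <= h * h by rewrite -expr2 ge_min lexx.
have et : e <= tau / 2 by rewrite ge_min lexx orbT.
have [x x0 xP] := conj_approx_max y e0.
(* Young's inequality for the near maximizer [x] at [y + h] and [y - h] traps [x] between difference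
   quotients of [psi]. The defect [e <= h * h] costs at most [h <= eta / 2] after division by
   [h]. *)
have xy : `|x - psi1 y| <= eta.
  have := rP h; rewrite gt_eqF// gtr0_norm// => /(_ isT hr).
  rewrite ler_norml => /andP[_]; rewrite lerBlDr ler_pdivrMr// => P1.
  have := rP (- h); rewrite oppr_eq0 gt_eqF// normrN gtr0_norm// => /(_ isT hr).
  rewrite ler_norml => /andP[+ _]; rewrite lerBrDr invrN mulrN -mulNr ler_pdivlMr// => P2.
  have Y1 := conj_young (y + h) x0; have Y2 := conj_young (y - h) x0.
  have : (x - psi1 y) * h <= eta * h by have := ler_wpM2r (ltW h0) he; lra.
  have : (psi1 y - x) * h <= eta * h by have := ler_wpM2r (ltW h0) he; lra.
  by rewrite !ler_pM2r// ler_norml; lra.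
(* Solves [(1 - s) * psi1 y + s = (1 - s) * x + s * w]: the difference between [x] and [psi1 y] is
   moved to a point near 1, where [kap] bounds [phi]. *)
pose w := 1 + (1 - s) * (psi1 y - x) / s.
have ws : `|w - 1| <= 1 / 2.
  rewrite /w addrC addKr normrM normrM [`|psi1 y - x|]distrC [`|s^-1|]gtr0_norm ?invr_gt0//.
  rewrite [`|1 - s|]gtr0_norm ?subr_gt0// ler_pdivrMr//.
  have : `|x - psi1 y| <= s / (2 * (1 - s)).
    by rewrite (le_trans xy)// ge_min lexx orbT.
  rewrite ler_pdivlMr; last by rewrite mulr_gt0// subr_gt0.
  lra.
move: ws; rewrite ler_norml => /andP[w1 w2].
have kw : phi w <= kap.
  have := @phi_convex (1 / 2) (3 / 2) (3 / 2 - w).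
  have -> : (3 / 2 - w) * (1 / 2) + (1 - (3 / 2 - w)) * (3 / 2) = w by field.
  have -> : 0 <= 1 / 2 :> R by lra.
  have -> : 0 <= 3 / 2 :> R by lra.
  have -> : 0 <= 3 / 2 - w <= 1 by apply/andP; split; lra.
  move=> /(_ isT isT isT) /le_trans; apply.
  have k1 : phi (1 / 2) <= kap by rewrite le_max lexx.
  have k2 : phi (3 / 2) <= kap by rewrite le_max lexx orbT.
  have : (3 / 2 - w) * phi (1 / 2) <= (3 / 2 - w) * kap by rewrite ler_wpM2l//; lra.
  have : (1 - (3 / 2 - w)) * phi (3 / 2) <= (1 - (3 / 2 - w)) * kap.
    by rewrite ler_wpM2l//; lra.
  lra.
have -> : (1 - s) * psi1 y + s = (1 - s) * x + (1 - (1 - s)) * w.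
  by rewrite /w; field; rewrite gt_eqF.
have w0 : 0 <= w by lra.
apply: (le_trans (@phi_convex x w (1 - s) x0 w0 _)); first by apply/andP; split; lra.
have -> : 1 - (1 - s) = s by ring.
have xyy : (x - psi1 y) * y <= tau / 2.
  apply: le_trans cy; apply: (le_trans (ler_norm _)); rewrite normrM ler_wpM2r//.
  by rewrite (le_trans xy)// ge_min lexx.
have fx : phi x <= psi1 y * y - psi y + tau by lra.
have s1' : 0 <= 1 - s by lra.
have := ler_wpM2l s1' fx; have := ler_wpM2l (ltW s0) kw.
have := mulr_gt0 s0 tau0; lra.
Qed.

(** By convexity the sublevel sets of [phi] in the half-line are intervals, which also covers a jump
    at [0]. *)
Lemma measurable_phi : measurable_fun (`[0, +oo[%classic : set R) phi.
Proof.
apply: (measurability _ (RGenCInfty.measurableE R)).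
move=> _ [_ [a ->] <-]; rewrite -[X in measurable X]setCK; apply: measurableC.
have -> : ~` (`[0, +oo[%classic `&` phi @^-1` `[a, +oo[%classic) =
    `]-oo, 0[%classic `|` [set x | 0 <= x /\ phi x < a].
  apply/seteqP; split => x /=; rewrite !in_itv/= !andbT.
    move=> xa; have [x0|x0] := ltP x 0; [by left|right; split => //].
    by rewrite ltNge; apply/negP => ax; apply: xa.
  move=> [x0|[x0 ax]] [x0' ax']; first by rewrite leNgt x0 in x0'.
  by rewrite leNgt ax in ax'.
apply: measurableU => //; apply: is_interval_measurable => x y [x0 xa] [y0 ya] z.
move=> /andP[xz zy]; split; first exact: le_trans xz.
have [yx|xy] := leP y x.
  by have -> : z = x by apply: le_anti; rewrite xz (le_trans zy).
have q : 0 < y - x by rewrite subr_gt0.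
have := @phi_convex x y ((y - z) / (y - x)) x0 y0.
rewrite divr_ge0 ?subr_ge0 ?(ltW xy)// ler_pdivrMr// mul1r lerB//.
move=> /(_ isT); have -> : (y - z) / (y - x) * x + (1 - (y - z) / (y - x)) * y = z.
  by field; rewrite gt_eqF.
move=> /le_lt_trans; apply; set s := (y - z) / (y - x).
have s0 : 0 <= s by rewrite divr_ge0// subr_ge0// ltW.
have s1 : s <= 1 by rewrite ler_pdivrMr// mul1r lerB.
have [->|sN0] := eqVneq s 0; first by lra.
have sp : 0 < s by rewrite lt_neqAle eq_sym sN0.
have : s * phi x < s * a by rewrite ltr_pM2l.
have : (1 - s) * phi y <= (1 - s) * a by rewrite ler_wpM2l ?subr_ge0// ltW.
lra.
Qed.

End conjugate.

(** * Monotonicity of the derivative of [psi] under the standing assumption *)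

Section regularization_theory.
Context {R : realType}.
Variables (phi psi2 : R -> R) (delta t : R).
Hypothesis phi_reg : regularization phi delta t.
Hypothesis psi2P : nondecreasing_second_derivative (convex_conj phi) psi2.
Local Notation psi := (convex_conj phi).
Local Notation psi1 := (derive1 psi).

Lemma reg_convex : strictly_convex_on `[0, +oo[%classic phi.
Proof. by case: phi_reg. Qed.

Lemma reg_growth : phi x / x @[x --> +oo] --> +oo.
Proof. by case: phi_reg. Qed.

Lemma reg_derivable (y : R) : derivable psi y 1.
Proof. by case: phi_reg => _ _ [+ _] _ _; exact. Qed.

Let cvx := reg_convex.
Let grw := reg_growth.
Let der := reg_derivable.

Lemma psi1_homo y z : y <= z -> psi1 y <= psi1 z.
Proof. exact: (conj_derive_homo cvx grw der). Qed.

Lemma psi1_ge0 y : 0 <= psi1 y.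
Proof. exact: (conj_derive_ge0 cvx grw der). Qed.

Lemma psi1_t : psi1 t = 1.
Proof. by case: phi_reg => _ _ _ _ []. Qed.

Lemma reg_delta_gt0 : 0 < delta.
Proof. by case: phi_reg => _ _ _ _ []. Qed.

Lemma measurable_psi1 : measurable_fun [set: R] psi1.
Proof.
by apply: continuous_measurable_fun; case: phi_reg => _ _ [].
Qed.

Lemma measurable_psi : measurable_fun [set: R] psi.
Proof.
apply: continuous_measurable_fun => x; apply: differentiable_continuous.
by apply/derivable1_diffP; exact: der.
Qed.

Lemma psi1_bounded M : exists N, forall x, `|x| <= M -> `|psi1 x| <= N.
Proof.
exists (psi1 M) => x; rewrite ler_norml => /andP[_ xM].
by rewrite ger0_norm ?psi1_ge0// psi1_homo.
Qed.

Lemma psi_bounded M : exists N, forall x, `|x| <= M -> `|psi x| <= N.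
Proof.
exists (`|psi (- M)| + `|psi M|) => x; rewrite ler_norml => /andP[Mx xM].
have h1 := conj_homo cvx grw Mx; have h2 := conj_homo cvx grw xM.
rewrite ler_norml; apply/andP; split.
  have := ler_norm (- psi (- M)); rewrite normrN; have := normr_ge0 (psi M); lra.
by have := ler_norm (psi M); have := normr_ge0 (psi (- M)); lra.
Qed.

Lemma psi1_lipschitz M : exists2 A, 0 <= A &
  forall x y, `|x| <= M -> `|y| <= M -> `|psi1 x - psi1 y| <= A * `|x - y|.
Proof.
case: psi2P => /(_ (- M) M) [A0 [A0r AP]] _ _ _ _.
pose A := `|A0| + 1; have A1 : A0 < A by rewrite /A; have := ler_norm A0; lra.
exists A; first by rewrite addr_ge0.
move=> x y xM yM; have := AP A A1 (x, y); apply; split => /=;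
  by rewrite in_itv/= -ler_norml.
Qed.

(** Strong convexity of [psi] to the right of [t - delta]: there [psi2] is at least
    [psi2 (t - delta)] by monotonicity. Since [psi2] is a derivative only almost everywhere, the
    slope estimate for Lipschitz functions is required. *)
Lemma psi1_slope u v : t - delta <= u -> u <= v ->
  psi2 (t - delta) * (v - u) <= psi1 v - psi1 u.
Proof.
move=> tu; rewrite le_eqVlt => /predU1P[->|uv]; first by rewrite !subrr mulr0.
have [A A0 AP] := psi1_lipschitz (`|u| + `|v|).
have uvM x : u <= x <= v -> `|x| <= `|u| + `|v|.
  move=> /andP[ux xv]; rewrite ler_norml; apply/andP; split.
    by have := ler_norm (- u); rewrite normrN; have := normr_ge0 v; lra.
  by have := ler_norm v; have := normr_ge0 u; lra.
apply: (ae_derive_ge_slope uv A0) => [x y /uvM xM /uvM yM|]; first exact: AP.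
case: psi2P => _ [N [mN N0 NP]] _ psi2_homo _; exists N; split => // x /= nx.
apply: NP => /= dx; apply: nx => /andP[ux _].
by exists (psi2 x) => //; apply: psi2_homo; exact: le_trans ux.
Qed.

(** A negative value at [x] would by monotonicity persist on [[x - 1, x]]. No point of this interval
    could be a differentiability point with derivative [psi2], as [psi1] is nondecreasing; but the
    exceptional set is null. *)
Lemma psi2_ge0 x : 0 <= psi2 x.
Proof.
case: psi2P => _ + _ psi2_homo _; rewrite leNgt => -[N [mN N0 NP]].
apply/negP => x0.
have sub : `[x - 1, x]%classic `<=` N.
  move=> z /=; rewrite in_itv/= => /andP[_ zx]; apply: NP => /= dz.
  have := psi2_homo _ _ zx; apply/negP; rewrite -ltNge (lt_le_trans x0)//.
  apply: (is_derive_ge dz) => eta eta0; exists (eta / 2).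
    by rewrite gtr0_norm ?divr_gt0//= gtr_pMr// invf_lt1// ltr1n.
  apply: divr_ge0; last by rewrite divr_ge0// ltW.
  by rewrite subr_ge0 psi1_homo// lerDl divr_ge0// ltW.
have m1 : measurable (`[x - 1, x]%classic : set R) by exact: measurable_itv.
pose mu : {measure set (measurableTypeR R) -> \bar R} := @lebesgue_measure R.
have N0' : mu N = 0%E by exact: N0.
have : (mu `[(x - 1)%R, x]%classic <= 0)%E.
  by rewrite -N0'; exact: (@le_measure _ _ _ mu _ _ (mem_set m1) (mem_set mN) sub).
rewrite /mu/= lebesgue_measure_itv/= lte_fin.
rewrite ltrBlDr ltrDl ltr01.
by rewrite -EFinB lee_fin subKr ler10.
Qed.

Hypothesis psi2_gt0 : 0 < psi2 (t - delta).
Local Notation k := (psi2 (t - delta)).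

Lemma psi1_lt v w : t - delta <= v -> v < w -> psi1 v < psi1 w.
Proof.
move=> tv vw; have := psi1_slope tv (ltW vw).
have : 0 < k * (w - v) by rewrite mulr_gt0// subr_gt0.
lra.
Qed.

Lemma psi1_ge1 w : 1 <= psi1 w -> t <= w.
Proof.
have d0 := reg_delta_gt0.
move=> w1; rewrite leNgt; apply/negP => wt.
have : psi1 (Num.max w (t - delta)) < psi1 t.
  apply: psi1_lt; first by rewrite le_max lexx orbT.
  by rewrite gt_max wt/=; lra.
rewrite psi1_t ltNge => /negP; apply; apply: (le_trans w1).
by apply: psi1_homo; rewrite le_max lexx.
Qed.

Lemma psi1_le1 w : psi1 w <= 1 -> w <= t.
Proof.
have d0 := reg_delta_gt0.
move=> w1; rewrite leNgt; apply/negP => wt.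
have tt : t - delta <= t by lra.
by have := psi1_lt tt wt; rewrite psi1_t ltNge w1.
Qed.

(** Only [a] is assumed to lie in the strongly convex region. If [b < a], strong convexity is used
    on the fraction [c] of the way from [a] to [b], which has length at most [delta / 4] and so
    stays above [t - delta]; monotonicity handles the rest. This costs the factor [c]. *)
Lemma psi1_monotone_quadratic c a b : 0 < c <= 1 -> t - 3 * delta / 4 <= a ->
  c * `|a - b| <= delta / 4 ->
  k * c * (a - b) ^+ 2 <= (psi1 a - psi1 b) * (a - b).
Proof.
move=> /andP[c0 c1] ta cab; have d0 := reg_delta_gt0.
have [ab|ba] := leP a b.
- have := psi1_slope (_ : t - delta <= a) ab => /(_ ltac:(lra)) sl.
  have kc : k * c * (b - a) <= k * (b - a).
    rewrite -mulrA ler_pM2l//; have : 0 <= (1 - c) * (b - a) by rewrite mulr_ge0 ?subr_ge0.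
    by lra.
  have := ler_wpM2r (_ : 0 <= b - a) (le_trans kc sl); rewrite subr_ge0 => /(_ ab).
  by rewrite expr2; lra.
- move: cab; rewrite gtr0_norm ?subr_gt0// => cab.
  have cz : 0 <= c * (a - b) by rewrite mulr_ge0 ?ltW// subr_gt0.
  have ba' : b <= a - c * (a - b) by have : c * (a - b) <= 1 * (a - b); [rewrite ler_wpM2r//
    ltW// subr_gt0|lra].
  have := @psi1_slope (a - c * (a - b)) a; have -> : t - delta <= a - c * (a - b) by lra.
  have -> : a - c * (a - b) <= a by lra.
  move=> /(_ isT isT) sl; have := psi1_homo ba' => hb.
  have h : k * (c * (a - b)) <= psi1 a - psi1 b by lra.
  have := ler_wpM2r (_ : 0 <= a - b) h; rewrite subr_ge0 => /(_ (ltW ba)).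
  by rewrite expr2; lra.
Qed.

End regularization_theory.

(** * Duality *)

Section density.
Context {d} {T : measurableType d} {R : realType}.
Variables (m : probability T R) (r : T -> R).
Hypotheses (r_ge0 : forall x, 0 <= r x) (r_bm : bounded_measurable r)
  (r_int : \int[m]_x r x = 1).

(** The anonymous arguments carry the proofs that the measure and probability instances declared
    below rely on. *)
Definition with_density of (forall x, 0 <= r x) & bounded_measurable r &
  \int[m]_x r x = 1 : set T -> \bar R := fun A => (\int[m]_(x in A) (r x)%:E)%E.

Local Notation nu := (with_density r_ge0 r_bm r_int).

Let nu0 : nu set0 = 0%E. Proof. by rewrite /with_density integral_set0. Qed.

Let nu_ge0 A : (0 <= nu A)%E.
Proof. by apply: integral_ge0 => x _; rewrite lee_fin. Qed.

Let nu_sigma_additive : semi_sigma_additive nu.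
Proof.
apply: semi_sigma_additive_nng_induced => [|x]; last by rewrite lee_fin.
by apply/measurable_EFinP; case: r_bm.
Qed.

HB.instance Definition _ := isMeasure.Build _ _ _ nu nu0 nu_ge0 nu_sigma_additive.

Let nuT : nu setT = 1%:E.
Proof. by rewrite /with_density bm_integralE// r_int. Qed.

HB.instance Definition _ := @Measure_isProbability.Build _ _ R nu nuT.

Lemma with_density_ex : exists pi : probability T R,
  forall A, pi A = (\int[m]_(x in A) (r x)%:E)%E.
Proof. by exists nu. Qed.

End density.

Section Radon_Nikodym_prob.
Context {d} {T : measurableType d} {R : realType}.
Variables (m pi : probability T R).

Definition rn_density (z : T) : R :=
  fine (Radon_Nikodym (charge_of_finite_measure pi) m z).

Hypothesis pim : pi `<< m.
Local Notation r := rn_density.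

Let RNE z : Radon_Nikodym (charge_of_finite_measure pi) m z = (r z)%:E.
Proof. by rewrite /r fineK//; exact: Radon_Nikodym_fin_num. Qed.

Let RN_int :
  m.-integrable setT (Radon_Nikodym (charge_of_finite_measure pi) m).
Proof. exact: Radon_Nikodym_integrable. Qed.

Lemma rn_integrable : m.-integrable setT (EFin \o r).
Proof.
by rewrite (_ : _ \o _ = Radon_Nikodym (charge_of_finite_measure pi) m)//;
  apply/funext => z; rewrite RNE.
Qed.

Lemma measurable_rn : measurable_fun setT r.
Proof. by apply/measurable_EFinP; exact: measurable_int rn_integrable. Qed.

Lemma rn_ge0 : {ae m, forall z, 0 <= r z}.
Proof.
have := ae_eq_Radon_Nikodym_SigmaFinite pim measurableT.
apply: filterS => z /(_ I) rz; rewrite -lee_fin -RNE -rz.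
exact: Radon_Nikodym_SigmaFinite.f_ge0.
Qed.

Lemma rn_mul_integrable F : bounded_measurable F ->
  m.-integrable setT (EFin \o (fun z => F z * r z)).
Proof.
move=> [mF [M FM]].
rewrite (_ : _ \o _ = (EFin \o F) \* (EFin \o r))%E//.
apply: integrableMr rn_integrable => //; exists M; split; first exact: num_real.
by move=> M' MM' z _ /=; rewrite (le_trans (FM z))// ltW.
Qed.

Lemma rn_integral F : bounded_measurable F ->
  \int[m]_z (F z * r z) = \int[pi]_z F z.
Proof.
move=> bF; rewrite /Rintegral; congr fine.
rewrite -(Radon_Nikodym_change_of_variables pim measurableT (f := EFin \o F)).
  by apply: eq_integral => z _; rewrite RNE EFinM.
exact: bm_integrable.
Qed.

Lemma rn_unique F : bounded_measurable F ->
  (forall A, measurable A -> pi A = (\int[m]_(z in A) (F z)%:E)%E) ->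
  {ae m, forall z, r z = F z}.
Proof.
move=> bF piF.
have : ae_eq m setT (EFin \o r) (EFin \o F).
  apply: integral_ae_eq => //; first exact: rn_integrable.
    by apply/measurable_EFinP; case: bF.
  move=> A _ mA; rewrite -piF//.
  rewrite (_ : pi A = charge_of_finite_measure pi A)//.
  rewrite (Radon_Nikodym_integral (nu := charge_of_finite_measure pi) pim mA).
  by apply: eq_integral => z _ /=; rewrite RNE.
by apply: filterS => z /(_ I) [].
Qed.

End Radon_Nikodym_prob.

Section duality.
Context {R : realType} {d1 d2} {T1 : measurableType d1} {T2 : measurableType d2}.
Variables (phi : R -> R) (delta t : R).
Hypothesis phi_reg : regularization phi delta t.
Variables (mu : probability T1 R) (nu : probability T2 R).
Variables (D1 : set T1) (D2 : set T2).
Hypotheses (mD1 : measurable D1) (mD2 : measurable D2).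
Hypotheses (muD1 : mu D1 = 1%E) (nuD2 : nu D2 = 1%E).
Variables (c : T1 -> T2 -> R) (c0 : T1 * T2 -> R).
Hypotheses (c0_bm : bounded_measurable c0)
  (c0E : forall x y, D1 x -> D2 y -> c x y = c0 (x, y)).
Variables (eps : R) (f : T1 -> R) (g : T2 -> R).
Hypotheses (eps_gt0 : 0 < eps) (f_bm : bounded_measurable f)
  (g_bm : bounded_measurable g).
Local Notation psi := (convex_conj phi).
Local Notation psi1 := (derive1 psi).
Local Notation m := (prod_prob mu nu).
Local Notation cost := (transport_cost D1 D2 c phi eps mu nu).

Implicit Types pi : probability (T1 * T2)%type R.

Let h z := (f z.1 + g z.2 - c0 z) / eps.

Definition dual_value : R :=
  \int[mu]_x f x + \int[nu]_y g y -
  eps * \int[m]_z psi ((f z.1 + g z.2 - c0 z) / eps).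

Let f1_bm : bounded_measurable (fun z : T1 * T2 => f z.1).
Proof. exact: bm_comp. Qed.

Let g2_bm : bounded_measurable (fun z : T1 * T2 => g z.2).
Proof. exact: bm_comp. Qed.

Let h_bm : bounded_measurable h.
Proof.
by apply: bmM; [apply: bmB => //; exact: bmD|exact: bm_cst].
Qed.

Let psih_bm : bounded_measurable (fun z => psi (h z)).
Proof.
apply: bm_real_comp h_bm; [exact: measurable_psi phi_reg|exact: psi_bounded phi_reg].
Qed.

Let psi1h_bm : bounded_measurable (fun z => psi1 (h z)).
Proof.
apply: bm_real_comp h_bm; [exact: measurable_psi1 phi_reg|].
exact: psi1_bounded phi_reg.
Qed.

Let mD : measurable (D1 `*` D2). Proof. exact: measurableX. Qed.

Let mDfull : m (D1 `*` D2) = 1%E.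
Proof. exact: prod_prob_full. Qed.

Lemma coupling_full pi : coupling mu nu pi -> pi (D1 `*` D2) = 1%E.
Proof.
move=> [pi1 pi2].
have e : D1 `*` D2 = ~` ((~` D1) `*` setT `|` setT `*` (~` D2)).
  apply/seteqP; split => -[x y] /=; first by move=> [xD yD] [[]|[]].
  by move=> nD; split; apply: contrapT => ?; apply: nD; [left|right].
have mC1 : measurable ((~` D1) `*` [set: T2]) by apply: measurableX => //; exact: measurableC.
have mC2 : measurable ([set: T1] `*` (~` D2)) by apply: measurableX => //; exact: measurableC.
have mC := measurableU _ _ mC1 mC2.
rewrite e; apply/eqP; rewrite eq_le; apply/andP; split.
  by apply: probability_le1; exact: measurableC.
rewrite -(sube0 1%E) (probability_setC pi mC) leeB//.
have C1 : pi ((~` D1) `*` setT) = 0%E.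
  by rewrite pi1; [rewrite probability_setC// muD1 subee|exact: measurableC].
have C2 : pi (setT `*` (~` D2)) = 0%E.
  by rewrite pi2; [rewrite probability_setC// nuD2 subee|exact: measurableC].
have -> : 0%E = (pi ((~` D1) `*` setT) + pi (setT `*` (~` D2)))%E.
  by rewrite C1 C2 adde0.
exact: measureU2.
Qed.

Lemma coupling_int1 pi (F : T1 -> R) : coupling mu nu pi -> bounded_measurable F ->
  \int[pi]_z F z.1 = \int[mu]_x F x.
Proof.
move=> [pi1 _] bF; apply: (bm_Rintegral_law (X := fst)) => // A mA.
by rewrite -pi1//; congr (pi _); apply/seteqP; split => -[x y] //= [].
Qed.

Lemma coupling_int2 pi (F : T2 -> R) : coupling mu nu pi -> bounded_measurable F ->
  \int[pi]_z F z.2 = \int[nu]_x F x.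
Proof.
move=> [_ pi2] bF; apply: (bm_Rintegral_law (X := snd)) => // A mA.
by rewrite -pi2//; congr (pi _); apply/seteqP; split => -[x y] //= [].
Qed.

Lemma coupling_cost pi : coupling mu nu pi ->
  (\int[pi]_(z in D1 `*` D2) (c z.1 z.2)%:E)%E = (\int[pi]_z c0 z)%:E.
Proof.
move=> cpi; apply: full_integral => //; first exact: coupling_full.
by move=> [x y] /= [xD yD]; exact: c0E.
Qed.

Let int_h pi : coupling mu nu pi ->
  \int[pi]_z c0 z + eps * \int[pi]_z h z = \int[mu]_x f x + \int[nu]_y g y.
Proof.
move=> cpi; rewrite -(coupling_int1 cpi f_bm) -(coupling_int2 cpi g_bm).
rewrite -bm_RintegralZ// -!bm_RintegralD//; last exact: bmZ.
apply: eq_Rintegral => z _; rewrite /h; field; exact: lt0r_neq0.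
Qed.

Let cvx := reg_convex phi_reg.
Let grw := reg_growth phi_reg.
Let der := reg_derivable phi_reg.

Let phi_lower pi : pi `<< m ->
  {ae m, forall z, ((h z * rn_density m pi z - psi (h z))%:E <=
                    (phi (coupling_density mu nu pi z))%:E)%E}.
Proof.
move=> pim; have := rn_ge0 pim; apply: filterS => z r0; rewrite lee_fin.
have := conj_young cvx grw (h z) r0; rewrite /coupling_density -/(rn_density m pi z).
lra.
Qed.

Let q_int pi : pi `<< m ->
  m.-integrable setT (EFin \o (fun z => h z * rn_density m pi z - psi (h z))).
Proof.
move=> pim; rewrite (_ : _ \o _ =
  ((EFin \o (fun z => (h z * rn_density m pi z)%R)) \- (EFin \o (fun z => psi (h z))))%E)//.
by apply: integrableB => //; [exact: rn_mul_integrable|exact: bm_integrable].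
Qed.

Let q_int_val pi : pi `<< m ->
  (\int[m]_z ((h z * rn_density m pi z - psi (h z))%:E))%E =
  (\int[pi]_z h z - \int[m]_z psi (h z))%:E.
Proof.
move=> pim; rewrite -(rn_integral pim h_bm) -RintegralB//; last 2 first.
- exact: rn_mul_integrable.
- exact: bm_integrable.
by rewrite /Rintegral fineK//; apply: integrable_fin_num => //; exact: q_int.
Qed.

(** Young's inequality [h * r - psi h <= phi r] is integrated against the product measure, [r] being
    the density of [pi]. No marginal equation enters, so the bound is available at any bounded [f]
    and [g], in particular for an empirical pair of measures at the population potentials. *)
Lemma weak_duality pi : coupling mu nu pi -> (dual_value%:E <= cost pi)%E.
Proof.
move=> cpi; rewrite /transport_cost coupling_cost// /phi_divergence.
case: asboolP => [pim|_]; last by rewrite gt0_muley ?lte_fin// addey// leey.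
apply: (@le_trans _ _ ((\int[pi]_z c0 z)%:E +
    eps%:E * (\int[pi]_z h z - \int[m]_z psi (h z))%:E)%E).
  rewrite -EFinM -EFinD lee_fin /dual_value -(int_h cpi) /h; lra.
rewrite leeD2l// lee_wpmul2l//; first by rewrite lee_fin ltW.
rewrite -(q_int_val pim).
by apply: ae_le_integral_measurable_l; [exact: q_int|exact: phi_lower].
Qed.

Hypothesis marg1 : forall x, D1 x -> \int[nu]_y psi1 ((f x + g y - c0 (x, y)) / eps) = 1.
Hypothesis marg2 : forall y, D2 y -> \int[mu]_x psi1 ((f x + g y - c0 (x, y)) / eps) = 1.

Let marg_int1 (F : T1 -> R) : bounded_measurable F ->
  \int[m]_z (F z.1 * psi1 (h z)) = \int[mu]_x F x.
Proof.
move=> bF; have bF1 : bounded_measurable (fun z : T1 * T2 => F z.1) by exact: bm_comp.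
have [bI ->] := bm_Fubini1 mu nu (bmM bF1 psi1h_bm).
apply: ae_eq_Rintegral; [by case: bI|by case: bF|].
apply: filterS (full_ae mD1 muD1) => x xD /=.
rewrite bm_RintegralZ; first by rewrite marg1// mulr1.
exact: (bm_pair1 x psi1h_bm).
Qed.

Let marg_int2 (F : T2 -> R) : bounded_measurable F ->
  \int[m]_z (F z.2 * psi1 (h z)) = \int[nu]_y F y.
Proof.
move=> bF; have bF1 : bounded_measurable (fun z : T1 * T2 => F z.2) by exact: bm_comp.
have [bI ->] := bm_Fubini2 mu nu (bmM bF1 psi1h_bm).
apply: ae_eq_Rintegral; [by case: bI|by case: bF|].
apply: filterS (full_ae mD2 nuD2) => x xD /=.
rewrite bm_RintegralZ; first by rewrite marg2// mulr1.
exact: (bm_pair2 x psi1h_bm).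
Qed.

Lemma psi1h_int : \int[m]_z psi1 (h z) = 1.
Proof.
have := marg_int1 (bm_cst 1); rewrite Rintegral_prob_cst => <-.
by apply: eq_Rintegral => z _; rewrite mul1r.
Qed.

Let m_coupling : coupling mu nu m.
Proof.
split => A mA.
- have := @prod_prob_rect _ _ _ _ _ mu nu A setT mA measurableT.
  by rewrite probability_setT mule1.
- have := @prod_prob_rect _ _ _ _ _ mu nu setT A measurableT mA.
  by rewrite probability_setT mul1e.
Qed.

(** The natural competitor has density [psi1 (h z)]. Mixing it with the product measure in
    proportion [s] keeps the marginals and makes [phi_mix] applicable; then [s] tends to 0. *)
Lemma strong_duality_le : (OT D1 D2 c phi eps mu nu <= dual_value%:E)%E.
Proof.
set kap := Num.max (phi (1 / 2)) (phi (3 / 2)).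
pose K := \int[m]_z c0 z + eps * kap.
suff key s : 0 < s < 1 ->
    (OT D1 D2 c phi eps mu nu <= ((1 - s) * dual_value + s * K)%:E)%E.
  apply/lee_addgt0Pr => e e0; rewrite -EFinD.
  pose s := Num.min (1 / 2) (e / (`|K - dual_value| + 1)).
  have q : 0 < `|K - dual_value| + 1 by rewrite ltr_wpDl.
  have s0 : 0 < s by rewrite lt_min divr_gt0//= divr_gt0.
  have s1 : s < 1 by rewrite gt_min; apply/orP; left; lra.
  apply: (le_trans (key s _)); first by rewrite s0.
  rewrite lee_fin; have : s * (`|K - dual_value| + 1) <= e.
    by rewrite -ler_pdivlMr// ge_min lexx orbT.
  have : s * (K - dual_value) <= s * `|K - dual_value|.
    by rewrite ler_wpM2l ?ler_norm// ltW.
  lra.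
move=> /andP[s0 s1]; have s01 : 0 <= 1 - s by lra.
pose r z := (1 - s) * psi1 (h z) + s.
have r0 z : 0 <= r z by rewrite addr_ge0 ?(ltW s0)// mulr_ge0// (psi1_ge0 phi_reg).
have br : bounded_measurable r by apply: bmD; [exact: bmZ|exact: bm_cst].
have r_int F : bounded_measurable F ->
    \int[m]_z (F z * r z) = (1 - s) * \int[m]_z (F z * psi1 (h z)) + s * \int[m]_z F z.
  move=> bF; rewrite -!bm_RintegralZ//; last exact: bmM.
  rewrite -bm_RintegralD; [|by apply: bmZ; exact: bmM|exact: bmZ].
  by apply: eq_Rintegral => z _; rewrite /r; ring.
have r1 : \int[m]_z r z = 1.
  transitivity (\int[m]_z (1 * r z)); first by apply: eq_Rintegral => z _; rewrite mul1r.
  rewrite (r_int _ (bm_cst 1)) Rintegral_prob_cst.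
  rewrite (_ : \int[m]_z (1 * psi1 (h z)) = 1); first by ring.
  by rewrite -[RHS]psi1h_int; apply: eq_Rintegral => z _; rewrite mul1r.
have [pi piE] := with_density_ex r0 br r1.
have pim : pi `<< m.
  apply/null_content_dominatesP => A mA mA0; rewrite piE.
  apply: null_set_integral => //; apply/measurable_EFinP/measurable_funTS.
  by case: br.
have pi_rect A B : measurable A -> measurable B ->
    pi (A `*` B) = (\int[m]_z ((\1_A z.1 : R) * \1_B z.2 * r z))%:E.
  move=> mA mB; rewrite piE integral_mkcond -bm_integralE; last first.
    by apply: bmM => //; apply: bmM; apply: (bm_comp (F := \1__)) => //; exact: bm_indic.
  apply: eq_integral => -[x y] _ /=; rewrite /patch !indicE in_setX/=.
  by case: (x \in A); case: (y \in B); rewrite ?mulr1 ?mul0r ?mulr0 ?mul0r ?mul1r.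
have cpi : coupling mu nu pi.
  split => A mA; rewrite pi_rect//.
  - rewrite (_ : \int[m]_z _ = \int[m]_z ((\1_A z.1 : R) * r z)); last first.
      by apply: eq_Rintegral => z _; rewrite [\1_setT _]indicE in_setT mulr1.
    have bA : bounded_measurable (\1_A : T1 -> R) by exact: bm_indic.
    rewrite r_int; last exact: bm_comp.
    rewrite (marg_int1 bA) (coupling_int1 m_coupling bA).
    rewrite -mulrDl subrK mul1r -bm_integralE// integral_indic ?setIT//.
  - rewrite (_ : \int[m]_z _ = \int[m]_z ((\1_A z.2 : R) * r z)); last first.
      by apply: eq_Rintegral => z _; rewrite [\1_setT _]indicE in_setT mul1r.
    have bA : bounded_measurable (\1_A : T2 -> R) by exact: bm_indic.
    rewrite r_int; last exact: bm_comp.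
    rewrite (marg_int2 bA) (coupling_int2 m_coupling bA).
    rewrite -mulrDl subrK mul1r -bm_integralE// integral_indic ?setIT//.
apply: (@le_trans _ _ (cost pi)); first by apply: ereal_inf_lbound; exists pi.
rewrite /transport_cost coupling_cost// /phi_divergence asboolT//.
pose V z := (1 - s) * (h z * psi1 (h z) - psi (h z)) + s * kap.
have bV : bounded_measurable V.
  by apply: bmD; [apply: bmZ; apply: bmB => //; exact: bmM|exact: bm_cst].
apply: (@le_trans _ _ ((\int[pi]_z c0 z)%:E + eps%:E * (\int[m]_z V z)%:E)%E).
  rewrite leeD2l// lee_wpmul2l//; first by rewrite lee_fin ltW.
  rewrite -bm_integralE//.
  apply: ae_le_integral_measurable_r; first exact: bm_integrable.
  have := rn_unique pim br (fun A _ => piE A).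
  apply: filterS => z rz; rewrite lee_fin /coupling_density.
  rewrite -/(rn_density m pi z) rz /V [h z * _]mulrC.
  by apply: (phi_mix cvx grw der); rewrite s0.
rewrite -EFinM -EFinD lee_fin -(rn_integral pim c0_bm).
rewrite (ae_eq_Rintegral (G := fun z => c0 z * r z)); last 3 first.
- by apply: measurable_funM; [case: c0_bm|exact: measurable_rn].
- by case: (bmM c0_bm br).
- by have := rn_unique pim br (fun A _ => piE A); apply: filterS => z ->.
rewrite r_int//.
have -> : \int[m]_z V z =
    (1 - s) * (\int[m]_z (h z * psi1 (h z)) - \int[m]_z psi (h z)) + s * kap.
  rewrite -bm_RintegralB; [|exact: bmM|exact: psih_bm].
  rewrite -bm_RintegralZ; last by apply: bmB => //; exact: bmM.
  rewrite -[s * kap](Rintegral_prob_cst m) -bm_RintegralD//; last exact: bm_cst.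
  by apply: bmZ; apply: bmB => //; exact: bmM.
have key : \int[m]_z (c0 z * psi1 (h z)) + eps * \int[m]_z (h z * psi1 (h z)) =
    \int[mu]_x f x + \int[nu]_y g y.
  rewrite -(marg_int1 f_bm) -(marg_int2 g_bm) -bm_RintegralZ; last exact: bmM.
  rewrite -!bm_RintegralD; try exact: bmM; last by apply: bmZ; exact: bmM.
  by apply: eq_Rintegral => z _; rewrite /h; field; exact: lt0r_neq0.
rewrite /dual_value -key /K /h; lra.
Qed.

Lemma OT_dual : OT D1 D2 c phi eps mu nu = dual_value%:E.
Proof.
apply/eqP; rewrite eq_le strong_duality_le/=.
by apply: le_ereal_inf_tmp => _ [pi cpi <-]; exact: weak_duality.
Qed.

(** For an optimizer the integrated Young inequality is an equality, so the pointwise one is an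
    equality almost everywhere, and [conj_eq_derive] identifies the density. *)
Lemma optimizer_density pi : OT_optimizer D1 D2 c phi eps mu nu pi ->
  measurable_fun setT (coupling_density mu nu pi) /\
  {ae m, forall z, coupling_density mu nu pi z = psi1 (h z)}.
Proof.
move=> [cpi]; rewrite OT_dual /transport_cost coupling_cost// /phi_divergence.
case: asboolP => [pim|_]; last by rewrite gt0_muley ?lte_fin// addey.
set J := (\int[m]_z _)%E => JE; split; first exact: measurable_rn.
set r := rn_density m pi.
have mr : measurable_fun setT r by exact: measurable_rn.
have JE' : J = (\int[pi]_z h z - \int[m]_z psi (h z))%:E.
  have eq1 := int_h cpi; move: JE; rewrite /dual_value -eq1.
  case: J => [i| |] //=; last 2 first.
  - by rewrite gt0_muley ?lte_fin// addey.
  - by rewrite gt0_muleNy ?lte_fin// addeNy.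
  rewrite -EFinM -EFinD => -[] H; congr EFin.
  by apply: (mulfI (lt0r_neq0 eps_gt0)); rewrite mulrBr; move: H; rewrite /h; lra.
(* Measurability of [phi] is known on [[0, +oo[] only; the density takes its values there almost
   everywhere. *)
pose phi0 := phi \_ `[0, +oo[%classic.
have mphi0 : measurable_fun setT phi0.
  apply/(measurable_restrictT _ _).1; first exact: measurable_itv.
  exact: measurable_phi.
pose gap z := phi0 (r z) - (h z * r z - psi (h z)).
have mgap : measurable_fun setT gap.
  apply: measurable_funB; first exact: measurableT_comp.
  apply: measurable_funB; last by case: psih_bm.
  by apply: measurable_funM => //; case: h_bm.
(* Truncating the Young gap to [[0, 1]] makes it bounded measurable, and it vanishes exactly where
   the gap is not positive. *)
pose g1 z := Num.min (Num.max (gap z) 0) 1.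
have g1_ge0 z : 0 <= g1 z by rewrite le_min le_max lexx orbT ler01.
have bg1 : bounded_measurable g1.
  split; first by apply: measurable_minr => //; exact: measurable_maxr.
  by exists 1 => z; rewrite ger0_norm// ge_min lexx orbT.
have : (\int[m]_z ((h z * r z - psi (h z))%:E + (g1 z)%:E) <= J)%E.
  apply: ae_le_integral_measurable_l.
    by apply: integrableD => //; [exact: q_int|exact: bm_integrable].
  have := rn_ge0 pim; apply: filterS => z r0; rewrite -EFinD lee_fin.
  rewrite /coupling_density -/(rn_density m pi z) -/r -/(r z).
  have phi0E : phi0 (r z) = phi (r z).
    by rewrite /phi0 patchE mem_set//= in_itv/= andbT.
  have gap0 : 0 <= gap z.
    by have := conj_young cvx grw (h z) r0; rewrite /gap phi0E /r; lra.
  have : g1 z <= gap z by rewrite /g1 (max_l gap0) ge_min lexx.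
  rewrite /gap phi0E; lra.
rewrite integralD//; [|exact: q_int|exact: bm_integrable].
rewrite (q_int_val pim) JE' bm_integralE// -EFinD lee_fin gerDl => g1_le0.
have g1_0 : ae_eq m setT (EFin \o g1) (cst 0%E).
  apply/ae_eq_integral_abs => //; first by apply/measurable_EFinP; case: bg1.
  rewrite (eq_integral (EFin \o g1)) => [|z _]; last by rewrite /= ger0_norm.
  rewrite bm_integralE//; congr EFin; apply/eqP.
  by rewrite eq_le g1_le0 Rintegral_ge0.
apply: filterS2 (rn_ge0 pim) g1_0 => z r0 /(_ I) /= [g10].
rewrite /coupling_density -/(rn_density m pi z) -/r -/(r z).
apply: (conj_eq_derive cvx grw der) => //.
have phi0E : phi0 (r z) = phi (r z).
  by rewrite /phi0 patchE mem_set//= in_itv/= andbT.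
have : gap z <= 0.
  rewrite leNgt; apply/negP => gp; move/eqP: g10; rewrite gt_eqF//.
  by rewrite lt_min ltr01 lt_max gp.
rewrite /gap phi0E; lra.
Qed.

Lemma optimizer_variance pi : OT_optimizer D1 D2 c phi eps mu nu pi ->
  fine 'V_(m)[coupling_density mu nu pi] = \int[m]_z (psi1 (h z) - 1) ^+ 2.
Proof.
move=> /optimizer_density[mr rE].
have m1 : fine 'E_(m)[coupling_density mu nu pi] = 1.
  rewrite -[RHS]psi1h_int expectation.unlock; apply: ae_eq_Rintegral => //.
  by case: psi1h_bm.
rewrite /variance covariance.unlock m1 expectation.unlock.
apply: ae_eq_Rintegral.
- by apply: measurable_funM; apply: measurable_funB.
- by case: (bmX 2 (bmB psi1h_bm (bm_cst 1))).
- apply: filterS rE => z E.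
  rewrite -[LHS]/((coupling_density mu nu pi z - 1) * (coupling_density mu nu pi z - 1)).
  by rewrite E expr2.
Qed.

End duality.

(** * Euclidean balls and cells *)

Lemma cauchy_schwarz_sum {R : realFieldType} (I : Type) (s : seq I) (a b : I -> R) :
  (\sum_(i <- s) a i * b i) ^+ 2 <=
  (\sum_(i <- s) a i ^+ 2) * (\sum_(i <- s) b i ^+ 2).
Proof.
set A := \sum_(i <- s) a i ^+ 2; set B := \sum_(i <- s) b i ^+ 2.
set C := \sum_(i <- s) a i * b i.
have A0 : 0 <= A by apply: sumr_ge0 => i _; exact: sqr_ge0.
have quad x : 0 <= A * x ^+ 2 - 2 * C * x + B.
  have -> : A * x ^+ 2 - 2 * C * x + B = \sum_(i <- s) (a i * x - b i) ^+ 2.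
    rewrite -mulrA (mulrC C) mulrA !mulr_suml !mulr_sumr -sumrB -big_split/=.
    by apply: eq_bigr => i _; ring.
  by apply: sumr_ge0 => i _; exact: sqr_ge0.
have [A_0|A_neq0] := eqVneq A 0.
  have C0 : C = 0.
    apply/eqP; apply: contraT => C_neq0.
    have := quad ((B + 1) / (2 * C)); rewrite A_0 mul0r add0r.
    have -> : - (2 * C * ((B + 1) / (2 * C))) = - (B + 1) by field.
    by rewrite addrC opprD addNKr; lra.
  by rewrite C0 expr0n/= mulr_ge0//; apply: sumr_ge0 => i _; exact: sqr_ge0.
have Ap : 0 < A by rewrite lt_neqAle eq_sym A_neq0.
have := quad (C / A); have -> : A * (C / A) ^+ 2 - 2 * C * (C / A) + B = (A * B - C ^+ 2) / A.
  by field.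
by rewrite pmulr_lge0 ?invr_gt0// subr_ge0.
Qed.

Section euclidean_norm.
Context {R : realType} {d : nat}.
Implicit Types x y z : 'rV[R]_d.

Lemma enorm_ge0 x : 0 <= enorm x.
Proof. exact: sqrtr_ge0. Qed.

Lemma enorm_sqr x : enorm x ^+ 2 = \sum_i x ord0 i ^+ 2.
Proof. by rewrite sqr_sqrtr// sumr_ge0// => i _; exact: sqr_ge0. Qed.

Lemma enormZ (a : R) x : enorm (a *: x) = `|a| * enorm x.
Proof.
rewrite /enorm -sqrtr_sqr -sqrtrM ?sqr_ge0//; congr Num.sqrt.
by rewrite mulr_sumr; apply: eq_bigr => i _; rewrite mxE exprMn.
Qed.

Lemma enormN x : enorm (- x) = enorm x.
Proof. by rewrite -scaleN1r enormZ normrN1 mul1r. Qed.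

Lemma enorm0 : enorm (0 : 'rV[R]_d) = 0.
Proof. by rewrite -(scale0r (0 : 'rV[R]_d)) enormZ normr0 mul0r. Qed.

Lemma enormD x y : enorm (x + y) <= enorm x + enorm y.
Proof.
rewrite -(ler_pXn2r (_ : 0 < 2)%N) ?nnegrE ?addr_ge0 ?enorm_ge0//.
rewrite sqrrD !enorm_sqr.
have -> : \sum_i (x + y) ord0 i ^+ 2 = \sum_i x ord0 i ^+ 2 +
    (\sum_i x ord0 i * y ord0 i) *+ 2 + \sum_i y ord0 i ^+ 2.
  rewrite -mulr_natr mulr_suml -!big_split/=; apply: eq_bigr => i _; rewrite !mxE; ring.
rewrite lerD2r lerD2l lerMn2r/=.
apply: (le_trans (ler_norm _)).
rewrite -(ler_pXn2r (_ : 0 < 2)%N) ?nnegrE ?mulr_ge0 ?enorm_ge0//.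
by rewrite real_normK ?num_real// exprMn !enorm_sqr cauchy_schwarz_sum.
Qed.

Lemma enorm_distC x y : enorm (x - y) = enorm (y - x).
Proof. by rewrite -enormN opprB. Qed.

Lemma enorm_dist_triangle z x y : enorm (x - y) <= enorm (x - z) + enorm (z - y).
Proof. by have -> : x - y = (x - z) + (z - y); [rewrite subrKA|exact: enormD]. Qed.

Lemma coord_le_enorm x i : `|x ord0 i| <= enorm x.
Proof.
rewrite -sqrtr_sqr ler_wsqrtr// (bigD1 i)//= lerDl.
by apply: sumr_ge0 => j _; exact: sqr_ge0.
Qed.

Lemma enorm_le_coord x (m : R) : (forall i, `|x ord0 i| <= m) -> enorm x <= d%:R * m.
Proof.
move=> xm; have [d0|d0] := posnP d.
  have -> : x = 0.
    apply/rowP => i; have h := leq_ltn_trans (leq0n i) (ltn_ord i).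
    by exfalso; rewrite d0 in h.
  by rewrite enorm0 {1}d0 mul0r.
have m0 : 0 <= m by exact: le_trans (xm (Ordinal d0)).
rewrite -(ler_pXn2r (_ : 0 < 2)%N) ?nnegrE ?mulr_ge0 ?enorm_ge0//.
rewrite enorm_sqr (@le_trans _ _ (\sum_(i < d) m ^+ 2))//.
  apply: ler_sum => i _; rewrite -[leLHS]real_normK ?num_real//.
  by rewrite ler_pXn2r ?nnegrE.
rewrite sumr_const card_ord -[leLHS]mulr_natl exprMn ler_wpM2r ?sqr_ge0//.
by rewrite -natrX ler_nat -mulnn leq_pmulr.
Qed.

Lemma sub_eball x y r s : enorm (x - y) + r <= s -> eball x r `<=` eball y s.
Proof.
rewrite /eball => xy z /= zx; have := enorm_dist_triangle x z y; lra.
Qed.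

Lemma compact_coord_bounded (D : set 'rV[R]_d) : compact D ->
  exists2 M, 0 <= M & forall x i, D x -> `|x ord0 i| <= M.
Proof.
move=> /compact_bounded[M0 [_ DM]].
exists (`|M0| + 1); first by rewrite addr_ge0.
move=> x i Dx; have M1 : M0 < `|M0| + 1 by rewrite ltr_pwDr// ler_norm.
have := DM _ M1 x Dx => /=; apply: le_trans; rewrite [leRHS]mx_normrE.
exact: (le_bigmax _ (fun ij => `|x ij.1 ij.2|) (ord0, i)).
Qed.

End euclidean_norm.

Section cells.
Context {R : realType} {d : nat}.
Implicit Types (x y z : 'rV[R]_d) (s : R).

(** Index of the cube of side [1 / s] containing [x]. The grid gives a countable measurable
    partition with cells of Euclidean diameter at most [d / s]; it serves both for measurability and
    for finite nets. *)
Definition cell s x : 'rV[int]_d := \row_i Num.floor (s * x ord0 i).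

Lemma cell_dist s x y : 0 < s -> cell s x = cell s y ->
  enorm (x - y) <= d%:R / s.
Proof.
move=> s0 /rowP xy; apply: enorm_le_coord => i; rewrite !mxE.
have := xy i; rewrite !mxE => e.
have /andP[x1 x2] := floor_itv (s * x ord0 i).
have /andP[y1 y2] := floor_itv (s * y ord0 i).
rewrite -e !intrD in y1 y2; rewrite !intrD in x2.
rewrite -[s^-1]mul1r ler_pdivlMr// -[X in _ * X](gtr0_norm s0) -normrM mulrC ler_norml; lra.
Qed.

Lemma measurable_cell s (m : 'rV[int]_d) : measurable (cell s @^-1` [set m]).
Proof.
have -> : cell s @^-1` [set m] = \bigcap_(i in [set: 'I_d])
    ((fun x : 'rV[R]_d => x ord0 i) @^-1`
      ((fun r : R => Num.floor (s * r)) @^-1` [set m ord0 i])).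
  apply/seteqP; split => x.
    by move=> /= <- i _ /=; rewrite mxE.
  by move=> xm; apply/rowP => i; rewrite mxE; exact: (xm i I).
apply: fin_bigcap_measurable => [|i _]; first exact: finite_finset.
rewrite -[X in measurable X]setTI; apply: measurable_coord => //.
have -> : (fun r : R => Num.floor (s * r)) @^-1` [set m ord0 i] =
    (fun r : R => s * r) @^-1` `[(m ord0 i)%:~R, (m ord0 i + 1)%:~R[%classic.
  apply/seteqP; split => r /=; rewrite in_itv/=.
    by move=> <-; exact: floor_itv.
  by move=> ?; exact: floor_def.
rewrite -[X in measurable X]setTI.
by apply: (measurable_funM (measurable_cst s) (@measurable_id _ _ setT)).
Qed.

End cells.

Section cell_measurability.
Context {d} {T : measurableType d} {R : realType} {C : countType}.
Variables (q : nat -> T -> C) (D : set T).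
Hypotheses (mq : forall k c, measurable (q k @^-1` [set c])) (mD : measurable D).

(** The map [q k] has countably many values and measurable fibres, so a preimage is a countable
    union of fibres, enumerated through [unpickle]. *)
Lemma measurable_count_comp {d'} {U : measurableType d'} k (G : C -> U) :
  measurable_fun setT (G \o q k).
Proof.
move=> _ B mB; rewrite setTI.
have -> : (G \o q k) @^-1` B =
    \bigcup_(n in [set n | exists2 c, unpickle n = Some c & B (G c)])
      [set x | Some (q k x) = unpickle n].
  apply/seteqP; split => x /=.
    move=> Bx; exists (pickle (q k x)); last by rewrite /= pickleK.
    by exists (q k x) => //; rewrite pickleK.
  by move=> [n /= [c -> Bc]] [->].
apply: bigcup_measurable => n /= [c nc _]; rewrite nc.
rewrite (_ : [set _ | _] = q k @^-1` [set c]); first exact: mq.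
by apply/seteqP; split => x /=; [case|move=> ->].
Qed.

(* [F] restricted to [D] is the pointwise limit of its values at representatives
   of the cells. *)
Lemma measurable_cell_limit (F : T -> R) :
  (forall x eta, D x -> 0 < eta -> exists K, forall k y, (K <= k)%N -> D y ->
     q k y = q k x -> `|F y - F x| <= eta) ->
  measurable_fun D F.
Proof.
move=> FP.
pose G k c := if pselect (exists y, D y /\ q k y = c) is left h then
  F (sval (cid h)) else 0.
apply: (@measurable_fun_cvg _ _ _ _ (fun k => G k \o q k)).
  by move=> k; apply: measurable_funTS; exact: measurable_count_comp.
move=> x Dx; apply/cvgrPdist_le => eta eta0.
have [K KP] := FP x eta Dx eta0; exists K => // k /= Kk.
rewrite distrC /G; case: pselect => [h|nh]; last by exfalso; apply: nh; exists x.
by case: (cid h) => y /= [Dy yx]; apply: (KP k y).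
Qed.

(** Such a set is a countable union of cells. This is how sets that are open for the Euclidean norm
    are seen to belong to the sigma-algebra generated by the coordinates. *)
Lemma measurable_cell_open (A : set T) :
  (forall x, A x -> exists k, q k @^-1` [set q k x] `<=` A) -> measurable A.
Proof.
move=> AP; have -> : A = \bigcup_k (q k @^-1` [set c | q k @^-1` [set c] `<=` A]).
  apply/seteqP; split => [x /AP[k kA]|x [k _ /=]]; first by exists k.
  exact.
apply: bigcupT_measurable => k.
have := @measurable_count_comp _ bool k (fun c => `[< q k @^-1` [set c] `<=` A >]).
move=> /(_ measurableT [set true]) => /(_ _); rewrite setTI => H.
rewrite (_ : _ @^-1` _ = ((fun c => `[< q k @^-1` [set c] `<=` A >]) \o q k) @^-1` [set true]).
  exact: H.
by apply/seteqP; split => x /= /asboolP.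
Qed.

End cell_measurability.

Section euclidean_measurability.
Context {R : realType} {d : nat}.
Implicit Types (A : set 'rV[R]_d) (P : probability 'rV[R]_d R).

Lemma scale_ex (r : R) : 0 < r -> exists K : nat, forall k, (K <= k)%N -> d%:R / k.+1%:R < r.
Proof.
move=> r0; exists (Num.trunc (d%:R / r)) => k Kk.
rewrite ltr_pdivrMr// mulrC -ltr_pdivrMr//.
apply: (lt_le_trans (truncnS_gt _)); rewrite ler_nat ltnS//.
Qed.

Definition ncell (k : nat) (x : 'rV[R]_d) := cell k.+1%:R x.

Lemma measurable_open_eball A :
  (forall x, A x -> exists2 r, 0 < r & eball x r `<=` A) -> measurable A.
Proof.
move=> AP; apply: (@measurable_cell_open _ _ _ ncell) => [k c|x /AP[r r0 rA]].
  exact: measurable_cell.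
have [K KP] := scale_ex r0; exists K => y /= yx; apply: rA.
by apply: le_lt_trans (KP K (leqnn K)); apply: cell_dist.
Qed.

Lemma measurable_eball x (r : R) : measurable (eball x r : set 'rV[R]_d).
Proof.
apply: measurable_open_eball => y /= yr; exists (r - enorm (y - x)).
  by rewrite subr_gt0.
by apply: sub_eball; lra.
Qed.

Lemma msupport_closed P x : ~ msupport P x ->
  exists2 r, 0 < r & eball x r `<=` ~` msupport P.
Proof.
move=> /existsNP[r /not_implyP[r0 /negP]]; rewrite -leNgt => Pr.
exists (r / 2); first by lra.
rewrite /eball => y /= yx /(_ (r / 2)) => /(_ ltac:(lra)); apply/negP; rewrite -leNgt.
apply: le_trans Pr; apply: le_measure; rewrite ?inE; [exact: measurable_eball..|].
apply: sub_eball; lra.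
Qed.

Lemma measurable_msupport P : measurable (msupport P).
Proof.
rewrite -[X in measurable X]setCK; apply: measurableC.
by apply: measurable_open_eball => x; exact: msupport_closed.
Qed.

(** A point outside the support has a null ball around it, hence lies in a null cell of a fine
    enough grid; over all grids there are only countably many null cells. *)
Lemma msupport_full P : P (msupport P) = 1%E.
Proof.
have mS := measurable_msupport P.
pose N := \bigcup_k \bigcup_(n in [set n | exists2 c, unpickle n = Some c &
   P (ncell k @^-1` [set c]) = 0%E]) [set x | Some (ncell k x) = unpickle n].
have cellE k n c : unpickle n = Some c ->
    [set x | Some (ncell k x) = unpickle n] = ncell k @^-1` [set c].
  by move=> ->; apply/seteqP; split => x /=; [case|move=> ->].
have N0 : P.-negligible N.
  apply: negligible_bigcup => k; rewrite bigcup_mkcond; apply: negligible_bigcup => n.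
  case: ifPn => [|_]; last exact: negligible_set0.
  rewrite inE => -[c nc Pc]; rewrite (cellE _ _ _ nc).
  by exists (ncell k @^-1` [set c]); split => //; exact: measurable_cell.
have sub : ~` msupport P `<=` N.
  move=> x /existsNP[r /not_implyP[r0 /negP]]; rewrite -leNgt => Pr.
  have [K KP] := scale_ex r0; exists K => //; exists (pickle (ncell K x)); last first.
    by rewrite /= pickleK.
  exists (ncell K x); first by rewrite pickleK.
  apply/eqP; rewrite eq_le measure_ge0 andbT; apply: le_trans Pr.
  apply: le_measure; rewrite ?inE; [exact: measurable_cell|exact: measurable_eball|].
  by move=> y /= yx; apply: le_lt_trans (KP K (leqnn K)); apply: cell_dist.
have [N' [mN' N'0 NN']] := negligibleS sub N0.
have : P (~` msupport P) = 0%E.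
  apply/eqP; rewrite eq_le measure_ge0 andbT -N'0.
  by apply: le_measure; rewrite ?inE//; exact: measurableC.
rewrite probability_setC//; have := fin_num_measure P _ mS.
by case: (P _) => //= r _ [] /eqP; rewrite subr_eq0 => /eqP <-.
Qed.

Lemma measurable_lipschitz1 (D : set 'rV[R]_d) (F : 'rV[R]_d -> R) (L : R) :
  measurable D -> 0 <= L ->
  (forall x y, D x -> D y -> `|F x - F y| <= L * enorm (x - y)) ->
  measurable_fun D F.
Proof.
move=> mD L0 FL; apply: (@measurable_cell_limit _ _ _ _ ncell) => //.
  by move=> k c; exact: measurable_cell.
move=> x eta Dx eta0; have L1 : 0 < L + 1 by lra.
have [K KP] := scale_ex (divr_gt0 eta0 L1); exists K => k y Kk Dy yx.
apply: (le_trans (FL _ _ Dy Dx)).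
have := le_lt_trans (cell_dist (ltr0Sn _ k) yx) (KP k Kk).
rewrite ltr_pdivlMr//; have := enorm_ge0 (y - x); nra.
Qed.

Lemma measurable_lipschitz2 (D D' : set 'rV[R]_d) (F : 'rV[R]_d -> 'rV[R]_d -> R) (L : R) :
  measurable D -> measurable D' -> 0 <= L ->
  (forall x1 x2 y1 y2, D x1 -> D x2 -> D' y1 -> D' y2 ->
    `|F x1 y1 - F x2 y2| <= L * (enorm (x1 - x2) + enorm (y1 - y2))) ->
  measurable_fun (D `*` D') (fun z => F z.1 z.2).
Proof.
move=> mD mD' L0 FL.
apply: (@measurable_cell_limit _ _ _ _ (fun k z => (ncell k z.1, ncell k z.2))).
  move=> k [c c']; rewrite (_ : _ @^-1` _ =
    (ncell k @^-1` [set c]) `*` (ncell k @^-1` [set c'])).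
    by apply: measurableX; exact: measurable_cell.
  by apply/seteqP; split => -[x y] /= [-> ->].
move=> [x x'] eta [Dx Dx'] eta0; have L1 : 0 < 2 * (L + 1) by lra.
have [K KP] := scale_ex (divr_gt0 eta0 L1); exists K => k [y y'] Kk [Dy Dy'] /= [yx yx'].
apply: (le_trans (FL _ _ _ _ Dy Dx Dy' Dx')).
have := le_lt_trans (cell_dist (ltr0Sn _ k) yx) (KP k Kk).
have := le_lt_trans (cell_dist (ltr0Sn _ k) yx') (KP k Kk).
rewrite !ltr_pdivlMr//; have := enorm_ge0 (y - x); have := enorm_ge0 (y' - x'); nra.
Qed.

End euclidean_measurability.

(** * Lebesgue measure of boxes and of dilated sets *)

Section lebesgue_affine.
Context {R : realType}.
Local Open Scope ereal_scope.

Lemma measurable_affine (a th : R) :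
  measurable_fun setT (fun s : R => (a + th * s)%R).
Proof. by apply: measurable_funD => //; exact: measurable_funM. Qed.

Lemma lebesgue_measure_affine (a th : R) (A : set R) : (0 < th)%R -> measurable A ->
  lebesgue_measure ((fun s : R => a + th * s)%R @^-1` A) =
  th^-1%:E * lebesgue_measure A.
Proof.
move=> th0 mA.
have mT : measurable_fun (setT : set (measurableTypeR R))
    (fun s => (a + th * s)%R : measurableTypeR R) by exact: measurable_affine.
pose mu' : {measure set (measurableTypeR R) -> \bar R} := mscale (NngNum (ltW th0))
  (measure_function_pushforward__canonical__measure_function_Measure
     (@lebesgue_measure R) mT).
have -> : lebesgue_measure A = mu' A; last first.
  rewrite /mu' /= /mscale/= muleA -EFinM mulVf ?lt0r_neq0// mul1e.
  by rewrite /pushforward.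
apply: lebesgue_measure_unique => // _ [[x y]] _ <-.
rewrite /mu' /= /mscale/= /pushforward.
have -> : (fun s : R => a + th * s)%R @^-1` [set` `]x, y] ] =
    [set` `](x - a) / th, (y - a) / th]%R].
  apply/seteqP; split => s /=; rewrite !in_itv/= ltr_pdivrMr// ler_pdivlMr//.
    by move=> /andP[? ?]; apply/andP; split; lra.
  by move=> /andP[? ?]; apply/andP; split; lra.
rewrite !lebesgue_measure_itv/= !lte_fin ltr_pM2r ?invr_gt0// ltrD2r.
case: ifP => _; last by rewrite mule0.
by rewrite -!EFinD -EFinM; congr EFin; field; exact: lt0r_neq0.
Qed.

Lemma measurable_rV_affine n (z : 'rV[R]_n) (th : R) :
  measurable_fun setT (fun v : 'rV[R]_n => (z + th *: v)%R).
Proof.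
apply: measurable_fun_rV => i.
rewrite (_ : (fun _ => _) = (fun v : 'rV[R]_n => (z ord0 i + th * v ord0 i)%R)).
  by apply: (measurableT_comp (measurable_affine _ _)); exact: measurable_coord.
by apply/funext => v; rewrite !mxE.
Qed.

Lemma rV_cons0 n (v : 'rV[R]_n) (s : R) : rV_cons (v, s) ord0 ord0 = s.
Proof. by rewrite /rV_cons mxE; case: splitP => // j _; rewrite mxE. Qed.

Lemma rV_cons_lift n (v : 'rV[R]_n) (s : R) j :
  rV_cons (v, s) ord0 (lift ord0 j) = v ord0 j.
Proof.
rewrite /rV_cons mxE; case: splitP => i /= ij; first by rewrite ord1 in ij.
by congr (v _ _); apply/val_inj; case: ij.
Qed.

(** Induction on the dimension along [rV_cons]: the last factor is rescaled in dimension one by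
    [lebesgue_measure_affine], and the induction hypothesis identifies the image of the measure in
    dimension [n] with a multiple of it. *)
Lemma lebesgue_rV_affine n (z : 'rV[R]_n) (th : R) (A : set 'rV[R]_n) :
  (0 < th)%R -> measurable A ->
  lebesgue_rV ((fun v => z + th *: v)%R @^-1` A) = (th ^- n)%:E * lebesgue_rV A.
Proof.
move=> th0; elim: n z A => [|n ih] z A mA.
  have -> : (fun v : 'rV[R]_0 => z + th *: v)%R = id.
    by apply/funext => v; apply/rowP => -[].
  by rewrite expr0 invr1 mul1e.
pose B := @rV_cons R n @^-1` A.
have mB : measurable B.
  by rewrite -[B]setTI; exact: measurable_rV_cons.
pose z' := (\row_j z ord0 (lift ord0 j))%R; pose z0 := z ord0 ord0.
pose T' := (fun v : 'rV[R]_n => z' + th *: v)%R.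
have mT' : measurable_fun setT T' by exact: measurable_rV_affine.
have consE v s : (z + th *: rV_cons (v, s))%R = rV_cons (T' v, (z0 + th * s)%R).
  apply/rowP => i.
  transitivity (z ord0 i + th * rV_cons (v, s) ord0 i)%R.
    by rewrite [LHS]mxE; congr +%R; rewrite [LHS]mxE.
  case: (unliftP ord0 i) => [j ->|->]; last by rewrite !rV_cons0.
  by rewrite !rV_cons_lift !mxE.
rewrite /= /pushforward /product_measure1.
pose G v := lebesgue_measure (xsection B v).
have mG : measurable_fun setT G.
  exact: (measurable_fun_xsection (@lebesgue_measure R) mB).
have G0 v : 0 <= G v by exact: measure_ge0.
transitivity (\int[@lebesgue_rV R n]_v (th^-1%:E * G (T' v))).
  apply: eq_integral => v _ /=; rewrite /G.
  rewrite -(lebesgue_measure_affine z0 th0); last exact: measurable_xsection.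
  congr lebesgue_measure; apply/seteqP; split => s; rewrite /xsection/= !inE/=.
    by rewrite consE.
  by rewrite /B/= consE.
rewrite ge0_integralZl//; last by rewrite lee_fin invr_ge0 ltW.
  2: by apply: (measurableT_comp mG).
rewrite -(ge0_integral_pushforward mT' (@lebesgue_rV R n) measurableT mG)//.
have thn : (0 <= th ^- n)%R by rewrite invr_ge0 exprn_ge0// ltW.
rewrite (@eq_measure_integral _ _ _ setT (mscale (NngNum thn) (@lebesgue_rV R n))
  (measure_function_pushforward__canonical__measure_function_Measure
     (@lebesgue_rV R n) mT')); last first.
  by move=> X mX _; exact: ih.
rewrite ge0_integral_mscale// muleA -EFinM; congr (_%:E * _).
by rewrite exprS invfM.
Qed.

Lemma measurable_rV_box n (a b : 'I_n -> R) :
  measurable [set x : 'rV[R]_n | forall i, (a i <= x ord0 i <= b i)%R].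
Proof.
have -> : [set x : 'rV[R]_n | forall i, (a i <= x ord0 i <= b i)%R] =
    \bigcap_(i in [set: 'I_n]) ((fun x : 'rV[R]_n => x ord0 i) @^-1` `[a i, b i]).
  apply/seteqP; split => x /=; first by move=> xab i _ /=; rewrite in_itv/=.
  by move=> xab i; have := xab i I; rewrite /= in_itv.
apply: fin_bigcap_measurable => [|i _]; first exact: finite_finset.
by rewrite -[X in measurable X]setTI; exact: measurable_coord.
Qed.

Lemma lebesgue_rV_box n (a : 'I_n -> R) (l : R) : (0 <= l)%R ->
  lebesgue_rV [set x : 'rV[R]_n | forall i, (a i <= x ord0 i <= a i + l)%R] <=
  (l ^+ n)%:E.
Proof.
move=> l0; elim: n a => [|n ih] a; first by rewrite /= expr0 diracE lee_fin lern1 leq_b1.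
rewrite /= /pushforward.
have -> : @rV_cons R n @^-1` [set x | forall i, (a i <= x ord0 i <= a i + l)%R] =
    [set x : 'rV[R]_n | forall i, (a (lift ord0 i) <= x ord0 i <= a (lift ord0 i) + l)%R]
    `*` `[a ord0, (a ord0 + l)%R]%classic.
  apply/seteqP; split => -[v s] /=; rewrite ?in_itv/=.
    move=> vs; split; last by have := vs ord0; rewrite rV_cons0.
    by move=> j; have := vs (lift ord0 j); rewrite rV_cons_lift.
  move=> -[vs s0] i; case: (unliftP ord0 i) => [j ->|->].
    by rewrite rV_cons_lift.
  by rewrite rV_cons0.
have mbox := measurable_rV_box (fun i => a (lift ord0 i)) (fun i => a (lift ord0 i) + l)%R.
have := @product_measure1E _ _ _ _ _ (@lebesgue_rV R n) (@lebesgue_measure R) _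
  `[a ord0, (a ord0 + l)%R]%classic mbox (measurable_itv _).
move=> ->; rewrite exprSr EFinM; apply: lee_pmul => //; first exact: ih.
have : @lebesgue_measure R `[a ord0, (a ord0 + l)%R]%classic = l%:E; last by move=> E; rewrite
  -[leRHS]E.
rewrite lebesgue_measure_itv/= lte_fin ltrDl; case: ifPn => [_|]; last first.
  by rewrite -leNgt => l0'; congr EFin; apply: le_anti; rewrite l0 l0'.
by rewrite -EFinB addrC addKr.
Qed.

End lebesgue_affine.

Lemma convex_segment {R : realType} {d : nat} (D : set 'rV[R]_d) z w (s : R) :
  convex_set D -> D z -> D w -> 0 <= s <= 1 -> D ((1 - s) *: z + s *: w).
Proof.
move=> cvx Dz Dw /andP[s0 s1].
have i01 : Itv.spec (Itv.num_sem (R := R)) (Itv.Real `[0%Z, 1%Z]) s.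
  by apply/and3P; split => //=; rewrite ?bnd_simp ?num_real.
have := cvx w z (Itv.mk i01) (mem_set Dw) (mem_set Dz).
by rewrite inE /conv/= addrC.
Qed.

Lemma msupport_nonempty {R : realType} {d : nat} (P : probability 'rV[R]_d R) :
  exists x, msupport P x.
Proof.
apply: contrapT => n0; have := msupport_full P.
rewrite (_ : msupport P = set0) ?measure0; first by move=> /eqP; rewrite eq_sym onee_eq0.
by apply/seteqP; split => x // Ox; apply: n0; exists x.
Qed.

Section ball_mass.
Context {R : realType} {d : nat}.
Variables (P : probability 'rV[R]_d R) (rho : 'rV[R]_d -> R) (lam Lam : R).
Hypotheses (lam_gt0 : 0 < lam) (rho_density : has_lebesgue_density P rho)
  (rho_bounds : forall x, msupport P x -> lam <= rho x <= Lam).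
Local Notation Omega := (msupport P).

Let mOmega : measurable Omega. Proof. exact: measurable_msupport. Qed.

Lemma density_upper_gt0 : 0 < Lam.
Proof.
have [x /rho_bounds/andP[a b]] := msupport_nonempty P.
exact: lt_le_trans lam_gt0 (le_trans a b).
Qed.

Lemma prob_le_lebesgue A : measurable A ->
  (P A <= Lam%:E * lebesgue_rV (A `&` Omega))%E.
Proof.
move=> mA; have L0 := density_upper_gt0.
have -> : P A = P (A `&` Omega).
  have e : P (A `\` Omega) = 0%E.
    apply/eqP; rewrite eq_le measure_ge0 andbT.
    have <- : P (~` Omega) = 0%E by rewrite probability_setC// msupport_full subee.
    apply: le_measure; rewrite ?inE; [exact: measurableD|exact: measurableC|].
    by move=> x [].
  have -> : P A = (P (A `\` Omega) + P (A `&` Omega))%E.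
    exact: measureDI.
  by rewrite e add0e.
have mAO := measurableI _ _ mA mOmega.
case: rho_density => mrho rho0 ->//.
apply: (@le_trans _ _ (\int[lebesgue_rV (n := d)]_(x in A `&` Omega) Lam%:E)%E).
  apply: ge0_le_integral => //.
  - by move=> x _; rewrite lee_fin.
  - by apply/measurable_EFinP; exact: measurable_funTS.
  - by move=> x [_ /rho_bounds/andP[_]]; rewrite lee_fin.
by rewrite integral_cst.
Qed.

Lemma lebesgue_le_prob A : measurable A -> A `<=` Omega ->
  (lam%:E * lebesgue_rV A <= P A)%E.
Proof.
move=> mA AO; case: rho_density => mrho rho0 ->//.
have <- : (\int[lebesgue_rV (n := d)]_(x in A) lam%:E = lam%:E * lebesgue_rV A)%E.
  by rewrite integral_cst.
apply: ge0_le_integral => //.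
- by move=> x _; rewrite lee_fin ltW.
- by apply/measurable_EFinP; exact: measurable_funTS.
- by move=> x /AO/rho_bounds/andP[+ _]; rewrite lee_fin.
Qed.

Lemma prob_eball_le z (r : R) : 0 <= r -> (P (eball z r) <= (Lam * (2 * r) ^+ d)%:E)%E.
Proof.
move=> r0; have L0 := density_upper_gt0.
apply: (le_trans (prob_le_lebesgue (measurable_eball _ _))).
rewrite EFinM lee_wpmul2l ?lee_fin ?(ltW L0)//.
have r20 : 0 <= 2 * r by lra.
apply: le_trans (lebesgue_rV_box (fun i => z ord0 i - r) r20).
apply: le_measure; rewrite ?inE.
- by apply: measurableI => //; exact: measurable_eball.
- exact: (measurable_rV_box (fun i => z ord0 i - r) (fun i => z ord0 i - r + 2 * r)).
move=> x [/= xz _] i; have := le_lt_trans (coord_le_enorm (x - z) i) xz.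
by rewrite !mxE ltr_norml; lra.
Qed.

(** The contraction of [Omega] towards [z] with ratio [r / D] stays in [Omega] by convexity and lies
    in the ball. Its volume is [(r / D) ^+ d] times that of [Omega], which is at least [1 / Lam]
    since [P] has mass one. *)
Lemma prob_eball_ge z (r D : R) : convex_set Omega -> Omega z -> 0 < r <= D ->
  (forall x, Omega x -> enorm (x - z) < D) ->
  ((lam / Lam * (r / D) ^+ d)%:E <= P (eball z r))%E.
Proof.
move=> cvx Oz /andP[r0 rD] OD; have D0 : 0 < D by lra.
have L0 := density_upper_gt0.
pose th := r / D; have th0 : 0 < th by rewrite divr_gt0.
have th1 : th <= 1 by rewrite ler_pdivrMr// mul1r.
pose A := (fun v : 'rV[R]_d => (z - th^-1 *: z) + th^-1 *: v) @^-1` Omega.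
have mA : measurable A by rewrite -[A]setTI; exact: measurable_rV_affine.
have AE v : A v -> exists2 w, Omega w & v = (1 - th) *: z + th *: w.
  move=> Av; exists (z - th^-1 *: z + th^-1 *: v) => //.
  rewrite scalerDr scalerBr !scalerA divff ?lt0r_neq0// !scale1r.
  by apply/rowP => i; rewrite !mxE; ring.
have AO : A `<=` Omega.
  by move=> _ /AE[w Ow ->]; apply: convex_segment => //; rewrite (ltW th0).
have Ab : A `<=` eball z r.
  move=> _ /AE[w Ow ->]; rewrite /eball/=.
  have -> : (1 - th) *: z + th *: w - z = th *: (w - z).
    by apply/rowP => i; rewrite !mxE; ring.
  rewrite enormZ gtr0_norm// -[ltRHS](@divfK _ D) ?lt0r_neq0//.
  by rewrite -/th ltr_pM2l// OD.
apply: (@le_trans _ _ (P A)); last first.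
  by apply: le_measure; rewrite ?inE//; exact: measurable_eball.
apply: le_trans (lebesgue_le_prob mA AO).
rewrite /A lebesgue_rV_affine ?invr_gt0// -exprVn invrK.
set V := lebesgue_rV Omega; have V0 : (0 <= V)%E by exact: measure_ge0.
have V1 : (1 <= Lam%:E * V)%E.
  by rewrite -(msupport_full P); have := prob_le_lebesgue mOmega; rewrite setIid.
case: V V0 V1 => [v| |] //; last first.
  by move=> _ _; rewrite gt0_muley ?lte_fin ?exprn_gt0// gt0_muley ?lte_fin// leey.
rewrite !lee_fin => v0 v1; rewrite -/th.
rewrite -mulrA ler_pM2l// mulrC ler_pM2l ?exprn_gt0//.
by rewrite -[leLHS]mul1r ler_pdivrMr// mulrC.
Qed.

End ball_mass.

(** * Nets, minimal ball masses and averages *)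

Section nets.
Context {R : realType} {d : nat}.

Lemma finite_cell_net (D : set 'rV[R]_d) (M s : R) : 0 <= M -> 0 < s ->
  (forall x i, D x -> `|x ord0 i| <= M) ->
  exists zs : seq 'rV[R]_d, [/\ (size zs)%:R <= (2 * M * s + 4) ^+ d,
    forall z, z \in zs -> D z &
    forall x, D x -> exists2 z, z \in zs & cell s x = cell s z].
Proof.
(* With this margin every floor of [s * x ord0 i] lies in [[-K, K[], so adding [K] encodes a cell by
   a function into ['I_(K + K)]; one representative is kept for each cell that meets [D]. *)
move=> M0 s0 DM; pose K := (Num.trunc (M * s)).+2.
have MsK : M * s < K%:R - 1.
  by rewrite /K -[in ltRHS]natr1 addrK; exact: truncnS_gt.
have Ms0 : 0 <= M * s by rewrite mulr_ge0// ltW.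
have K2 : (K + K)%:R <= 2 * M * s + 4.
  by rewrite natrD /K -!natr1; have /andP[+ _] := truncn_itv Ms0; lra.
pose W := {ffun 'I_d -> 'I_(K + K)}.
pose inW (w : W) := [set x | D x /\ forall i, Num.floor (s * x ord0 i) = (w i)%:Z - K%:Z].
pose rep (w : W) := if pselect (exists x, inW w x) is left h then Some (sval (cid h))
  else None.
exists (pmap rep (enum W)); split.
- apply: (@le_trans _ _ (size (enum W))%:R).
    by rewrite ler_nat size_pmap count_size.
  by rewrite -cardE card_ffun !card_ord natrX lerXn2r ?nnegrE//; lra.
- move=> z; rewrite mem_pmap => /mapP[w _]; rewrite /rep.
  by case: pselect => // h [->]; case: (cid h) => x [].
move=> x Dx.
have fl i : (0 <= Num.floor (s * x ord0 i) + K%:Z < (K + K)%N%:Z)%R.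
  have := DM x i Dx; rewrite ler_norml => /andP[x1 x2].
  have sx1 : - (M * s) <= s * x ord0 i.
    by have := ler_wpM2l (ltW s0) x1; rewrite mulrN mulrC.
  have sx2 : s * x ord0 i <= M * s by have := ler_wpM2l (ltW s0) x2; rewrite [s * M]mulrC.
  have /andP[f1 f2] := floor_itv (s * x ord0 i).
  rewrite intrD in f2.
  rewrite -(ler_int R) -(ltr_int R) !intrD mulr0z PoszD intrD -!pmulrn; apply/andP; split; lra.
have codeK i : (absz (Num.floor (s * x ord0 i) + K%:Z)%R < K + K)%N.
  by have /andP[f0 f1] := fl i; rewrite -ltz_nat gez0_abs.
pose w : W := [ffun i => Ordinal (codeK i)].
have wx : inW w x.
  split => // i; rewrite /w ffunE /=; have /andP[f0 _] := fl i.
  by rewrite gez0_abs// addrK.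
have : rep w != None.
  by rewrite /rep; case: pselect => // nx; exfalso; apply: nx; exists x.
rewrite /rep; case: pselect => // h _; exists (sval (cid h)).
  rewrite mem_pmap; apply/mapP; exists w; first by rewrite mem_enum.
  by rewrite /rep; case: pselect => // h'; congr (Some (sval (cid _))); exact: Prop_irrelevance.
case: (cid h) => z [Dz zw] /=.
by apply/rowP => i; rewrite !mxE zw; case: wx.
Qed.

Lemma finite_net (D : set 'rV[R]_d) (M s : R) : 0 <= M -> 0 < s ->
  (forall x i, D x -> `|x ord0 i| <= M) ->
  exists zs : seq 'rV[R]_d, [/\ (size zs)%:R <= (2 * M * s + 4) ^+ d,
    forall z, z \in zs -> D z &
    forall x, D x -> exists2 z, z \in zs & enorm (x - z) <= d%:R / s].
Proof.
move=> M0 s0 DM; have [zs [zsn zsD zsc]] := finite_cell_net M0 s0 DM.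
exists zs; split=> // x Dx; have [z zzs xz] := zsc x Dx.
by exists z => //; exact: cell_dist.
Qed.

End nets.

Section min_ball_mass.
Context {R : realType} {d : nat}.
Variable P : probability 'rV[R]_d R.
Implicit Types A : set 'rV[R]_d.

Lemma prob_fineK B : measurable B -> (fine (P B))%:E = P B.
Proof. by move=> mB; rewrite fineK// fin_num_measure. Qed.

Lemma fine_prob_ge0 B : 0 <= fine (P B).
Proof. by rewrite fine_ge0. Qed.

Lemma fine_prob_homo B C : measurable B -> measurable C -> B `<=` C ->
  fine (P B) <= fine (P C).
Proof.
move=> mB mC BC; rewrite -lee_fin !prob_fineK//.
by apply: le_measure; rewrite ?inE.
Qed.

Lemma min_ball_mass_le A r x : A x -> min_ball_mass P A r <= fine (P (eball x r)).
Proof.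
move=> Ax; apply: ge_inf; last by exists x.
by exists 0 => _ [y _ <-]; exact: fine_prob_ge0.
Qed.

Lemma le_min_ball_mass A r m : A !=set0 ->
  (forall x, A x -> m <= fine (P (eball x r))) -> m <= min_ball_mass P A r.
Proof.
move=> [x Ax] mA; apply: lb_le_inf; first by exists (fine (P (eball x r))), x.
by move=> _ [y Ay <-]; exact: mA.
Qed.

(** Every ball of radius [r] centred in the support contains the ball of radius [r / 2] around a
    point of a finite net, so the infimum is bounded below by finitely many positive masses. *)
Lemma min_ball_mass_gt0 M r : (forall x i, msupport P x -> `|x ord0 i| <= M) ->
  0 < r -> 0 < min_ball_mass P (msupport P) r.
Proof.
move=> PM r0; have [x0 Px0] := msupport_nonempty P.
have M0 : 0 <= `|M| by [].
have d1 : 0 < 2 * (d%:R + 1) / r :> R by rewrite divr_gt0// mulr_gt0// ltr_wpDl.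
have PM' x i : msupport P x -> `|x ord0 i| <= `|M|.
  by move=> Px; rewrite (le_trans (PM x i Px))// ler_norm.
have [zs [_ zsP zsD]] := finite_net M0 d1 PM'.
have dr : d%:R / (2 * (d%:R + 1) / r) < r / 2.
  rewrite ltr_pdivrMr//.
  have -> : r / 2 * (2 * (d%:R + 1) / r) = d%:R + 1 :> R by field; exact: lt0r_neq0.
  by rewrite ltrDl.
pose m ws := \big[Num.min/1]_(z <- ws) fine (P (eball z (r / 2))).
have m0 ws : (forall z, z \in ws -> msupport P z) -> 0 < m ws.
  rewrite /m; elim: ws => [|z ws ih] wsP; first by rewrite big_nil.
  rewrite big_cons lt_min ih ?andbT; last first.
    by move=> y yz; apply: wsP; rewrite inE yz orbT.
  have := wsP z (mem_head _ _) (r / 2); rewrite divr_gt0// => /(_ isT).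
  by rewrite -prob_fineK ?lte_fin//; exact: measurable_eball.
apply: (lt_le_trans (m0 zs zsP)); apply: le_min_ball_mass; first by exists x0.
move=> x Px; have [z zzs xz] := zsD x Px.
apply: (@le_trans _ _ (fine (P (eball z (r / 2))))).
  rewrite /m; elim: {zsD zsP} zs zzs => // y ws ih; rewrite inE big_cons ge_min.
  by move=> /predU1P[->|/ih ->]; rewrite ?lexx ?orbT.
apply: fine_prob_homo; [exact: measurable_eball..|].
by apply: sub_eball; rewrite enorm_distC; lra.
Qed.

End min_ball_mass.

(** The integral against an empirical measure. It is locked so that nested averages are rewritten
    only through the lemmas below or an explicit unlocking. *)
HB.lock Definition avg {R : realType} {n : nat} (F : 'I_n -> R) : R :=
  n%:R^-1 * \sum_(i < n) F i.

Section avg.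
Context {R : realType} {n : nat}.
Hypothesis n_gt0 : (0 < n)%N.
Implicit Types F G : 'I_n -> R.

Let nR_gt0 : 0 < n%:R^-1 :> R. Proof. by rewrite invr_gt0 ltr0n. Qed.

Lemma avg_cst (r : R) : avg (fun _ : 'I_n => r) = r.
Proof.
rewrite avg.unlock sumr_const card_ord -[r *+ n]mulr_natl mulrA mulVf ?mul1r//.
by rewrite pnatr_eq0 -lt0n.
Qed.

Lemma avgD F G : avg (fun i => F i + G i) = avg F + avg G.
Proof. by rewrite avg.unlock big_split/= mulrDr. Qed.

Lemma avgB F G : avg (fun i => F i - G i) = avg F - avg G.
Proof. by rewrite avg.unlock sumrB mulrBr. Qed.

Lemma avgZ (r : R) F : avg (fun i => r * F i) = r * avg F.
Proof. by rewrite avg.unlock -mulr_sumr mulrCA. Qed.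

Lemma eq_avg F G : (forall i, F i = G i) -> avg F = avg G.
Proof. by move=> FG; rewrite avg.unlock; congr (_ * _); apply: eq_bigr. Qed.

Lemma le_avg F G : (forall i, F i <= G i) -> avg F <= avg G.
Proof. by move=> FG; rewrite avg.unlock ler_pM2l//; apply: ler_sum. Qed.

Lemma avg_ge0 F : (forall i, 0 <= F i) -> 0 <= avg F.
Proof. by move=> F0; rewrite -(avg_cst 0); exact: le_avg. Qed.

Lemma lt_avg F G i : (forall i, F i <= G i) -> F i < G i -> avg F < avg G.
Proof.
move=> FG FGi; rewrite avg.unlock ltr_pM2l// (bigD1 i)//= [ltRHS](bigD1 i)//=.
by rewrite ltr_leD//; apply: ler_sum.
Qed.

Lemma norm_avg_le F m : (forall i, `|F i| <= m) -> `|avg F| <= m.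
Proof.
move=> Fm; have h i : - m <= F i <= m by rewrite -ler_norml.
rewrite ler_norml -[X in X <= _ <= _]avg_cst -[X in _ <= _ <= X]avg_cst.
by apply/andP; split; apply: le_avg => i; case/andP: (h i).
Qed.

Lemma avg_sqr_le F G :
  avg (fun i => F i * G i) ^+ 2 <= avg (fun i => F i ^+ 2) * avg (fun i => G i ^+ 2).
Proof.
rewrite avg.unlock exprMn [leRHS]mulrACA -[X in _ <= X * _]expr2 ler_wpM2l ?sqr_ge0//.
exact: cauchy_schwarz_sum.
Qed.

End avg.

Lemma exchange_avg {R : realType} {n m : nat} (F : 'I_n -> 'I_m -> R) :
  avg (fun i => avg (fun j => F i j)) = avg (fun j => avg (fun i => F i j)).
Proof.
rewrite avg.unlock -!mulr_sumr mulrCA.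
by rewrite exchange_big.
Qed.

Section empirical_integral.
Context {R : realType} {dT} {T : measurableType dT} {n : nat}.
Variable xs : n.-tuple T.
Hypothesis n_gt0 : (0 < n)%N.

Lemma empiricalE A : (empirical xs : probability T R) A =
  (msum (fun i => @dirac _ T (nth point xs i) R) n A * (n%:R^-1)%:E)%E.
Proof.
pose mm := msum (fun i => @dirac _ T (nth point xs i) R) n.
have mmT : mm setT = n%:R%:E.
  rewrite /mm /msum (eq_bigr (fun=> 1%:E)) => [|i _]; last exact: diracT.
  by rewrite sumEFin sumr_const card_ord.
have -> : (empirical xs : probability T R) A =
  ((if (mm setT == 0) || (mm setT == +oo) then dirac point
    else fun U => mm U * (fine (mm setT))^-1%:E) A)%E by [].
by rewrite mmT eqe pnatr_eq0 gtn_eqF.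
Qed.

Lemma empirical_Rintegral (F : T -> R) : bounded_measurable F ->
  \int[(empirical xs : probability T R)]_x F x = avg (fun i => F (tnth xs i)).
Proof.
move=> bF; have [mF [M FM]] := bF.
(* Adding the bound [M] reduces to nonnegative functions, for which integrals against sums and
   multiples of measures split. *)
suff nng (G : T -> R) : bounded_measurable G -> (forall x, 0 <= G x) ->
    \int[(empirical xs : probability T R)]_x G x = avg (fun i => G (tnth xs i)).
  have M0 x : 0 <= F x + M.
    by have := FM x; rewrite ler_norml => /andP[]; lra.
  have := nng _ (bmD bF (bm_cst M)) M0.
  rewrite bm_RintegralD ?Rintegral_prob_cst//; last exact: bm_cst.
  by rewrite avgD avg_cst// => /addIr.
move=> bG G0; have [mG _] := bG; rewrite /Rintegral.
have mG' : measurable_fun setT (EFin \o G) by exact/measurable_EFinP.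
have nN : 0 <= n%:R^-1 :> R by rewrite invr_ge0.
rewrite (@eq_measure_integral _ _ _ setT
  (mscale (NngNum nN) (msum (fun i => @dirac _ T (nth point xs i) R) n))); last first.
  by move=> A mA _; rewrite [LHS]empiricalE muleC.
rewrite ge0_integral_mscale//; last by move=> x _; rewrite lee_fin.
rewrite ge0_integral_measure_sum//; last by move=> x _; rewrite lee_fin.
rewrite (eq_bigr (fun i : 'I_n => (G (tnth xs i))%:E)); last first.
  by move=> i _; rewrite integral_dirac// diracT mul1e (tnth_nth point).
by rewrite avg.unlock sumEFin -EFinM.
Qed.

Lemma empirical_full (D : set T) : measurable D -> (forall i, D (tnth xs i)) ->
  (empirical xs : probability T R) D = 1%E.
Proof.
move=> mD xsD; have := empirical_Rintegral (bm_indic mD).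
rewrite (eq_avg (G := fun=> 1)) => [|i]; last by rewrite indicE mem_set.
rewrite avg_cst// /Rintegral integral_indic// setIT => H.
by rewrite -[LHS]fineK ?fin_num_measure// H.
Qed.

Lemma empirical_integral_in (D : set T) (F : T -> R) : measurable D ->
  (forall i, D (tnth xs i)) -> measurable_fun D F ->
  (exists M, forall x, D x -> `|F x| <= M) ->
  (\int[(empirical xs : probability T R)]_(x in D) (F x)%:E)%E =
  (avg (fun i => F (tnth xs i)))%:E.
Proof.
move=> mD xsD mF bF; have bFD := bm_restrict mD mF bF.
rewrite (full_integral mD (empirical_full mD xsD) bFD) => [|x Dx]; last first.
  by rewrite patchE mem_set.
rewrite empirical_Rintegral//; congr EFin; apply: eq_avg => i.
by rewrite patchE mem_set.
Qed.

End empirical_integral.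

(** * Empirical potentials *)

Section empirical_potentials_estimates.
Context {R : realType} {d : nat}.
Variables (phi psi2 : R -> R) (delta t : R).
Hypothesis phi_reg : regularization phi delta t.
Hypothesis psi2P : nondecreasing_second_derivative (convex_conj phi) psi2.
Hypothesis psi2_gt0 : 0 < psi2 (t - delta).
Local Notation psi1 := (derive1 (convex_conj phi)).

Section avg_psi1.
Context {n : nat}.
Hypothesis n_gt0 : (0 < n)%N.

Let i0 : 'I_n := Ordinal n_gt0.

Let t_delta : t - delta <= t.
Proof. by have := reg_delta_gt0 phi_reg; lra. Qed.

Lemma avg_psi1_ex_ge (v : 'I_n -> R) : avg (fun j => psi1 (v j)) = 1 ->
  exists j, t <= v j.
Proof.
move=> v1; apply: contrapT => nex.
have vt j : psi1 (v j) < 1.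
  rewrite ltNge; apply/negP => v1'; apply: nex; exists j.
  exact: (psi1_ge1 phi_reg psi2P psi2_gt0).
have := lt_avg n_gt0 (fun j => ltW (vt j)) (vt i0).
by rewrite v1 avg_cst// ltxx.
Qed.

Lemma avg_psi1_ex_le (v : 'I_n -> R) : avg (fun j => psi1 (v j)) = 1 ->
  exists j, v j <= t.
Proof.
move=> v1; apply: contrapT => nex.
have vt j : 1 < psi1 (v j).
  rewrite ltNge; apply/negP => v1'; apply: nex; exists j.
  exact: (psi1_le1 phi_reg psi2P psi2_gt0).
have := lt_avg n_gt0 (fun j => ltW (vt j)) (vt i0).
by rewrite v1 avg_cst// ltxx.
Qed.

(** Comparison principle: some [v j] is at least [t], where [psi1] is strictly increasing, so
    raising all arguments would raise the average strictly. It yields the Lipschitz bounds on the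
    potentials. *)
Lemma avg_psi1_shift (v w : 'I_n -> R) : avg (fun j => psi1 (v j)) = 1 ->
  avg (fun j => psi1 (w j)) = 1 -> ~ (forall j, v j < w j).
Proof.
move=> v1 w1 vw; have [j vj] := avg_psi1_ex_ge v1.
have lt_j : psi1 (v j) < psi1 (w j).
  by apply: (psi1_lt psi2P psi2_gt0) => //; exact: le_trans vj.
have := lt_avg n_gt0 (fun j => psi1_homo phi_reg (ltW (vw j))) lt_j.
by rewrite v1 w1 ltxx.
Qed.

End avg_psi1.

Variables (Omega Omega' : set 'rV[R]_d) (c : 'rV[R]_d -> 'rV[R]_d -> R) (L : R).
Hypotheses (mOmega : measurable Omega) (mOmega' : measurable Omega').
Hypotheses (L_gt0 : 0 < L) (c_lip : cost_lipschitz Omega Omega' L c).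

Lemma cost_lip x1 x2 y1 y2 : Omega x1 -> Omega x2 -> Omega' y1 -> Omega' y2 ->
  `|c x1 y1 - c x2 y2| <= L * (enorm (x1 - x2) + enorm (y1 - y2)).
Proof.
move=> Ox1 Ox2 Oy1 Oy2; apply: (le_trans (c_lip Ox1 Ox2 Oy1 Oy2)).
rewrite ler_pM2l// -[leRHS]ger0_norm ?addr_ge0 ?enorm_ge0// -sqrtr_sqr ler_wsqrtr//.
by rewrite sqrrD lerD2r lerDl mulrn_wge0// mulr_ge0// enorm_ge0.
Qed.

Lemma cost_lip1 x1 x2 y : Omega x1 -> Omega x2 -> Omega' y ->
  `|c x1 y - c x2 y| <= L * enorm (x1 - x2).
Proof.
move=> Ox1 Ox2 Oy; have := cost_lip Ox1 Ox2 Oy Oy.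
by rewrite subrr enorm0 addr0.
Qed.

Lemma cost_lip2 x y1 y2 : Omega x -> Omega' y1 -> Omega' y2 ->
  `|c x y1 - c x y2| <= L * enorm (y1 - y2).
Proof.
move=> Ox Oy1 Oy2; have := cost_lip Ox Ox Oy1 Oy2.
by rewrite subrr enorm0 add0r.
Qed.

Variables (Cc Dx : R).
Hypothesis c_bound : forall x y, Omega x -> Omega' y -> `|c x y| <= Cc.
Hypothesis Omega_diam : forall x x', Omega x -> Omega x' -> enorm (x - x') <= Dx.

Section one_sample.
Variables (n : nat) (xs ys : n.-tuple 'rV[R]_d) (eps : R).
Hypotheses (n_gt0 : (0 < n)%N) (eps_gt0 : 0 < eps).
Hypotheses (xsO : forall i, Omega (tnth xs i)) (ysO : forall j, Omega' (tnth ys j)).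
Variables (f g : 'rV[R]_d -> R).
Hypothesis fgP : potentials Omega Omega' c (convex_conj phi) eps
  (empirical xs) (empirical ys) f g.

Local Notation x_ i := (tnth xs i).
Local Notation y_ j := (tnth ys j).
Local Notation h x y := ((f x + g y - c x y) / eps).

Let bounded_ex (D : set 'rV[R]_d) (u : 'rV[R]_d -> R) : [bounded u x | x in D] ->
  exists M, forall x, D x -> `|u x| <= M.
Proof.
move=> [M [_ MP]]; exists (`|M| + 1) => x xD.
by apply: MP => //; rewrite ltr_pwDr// ler_norm.
Qed.

Let measurable_psi1_h (u : 'rV[R]_d -> R) (D : set 'rV[R]_d) : measurable_fun D u ->
  measurable_fun D (fun y => psi1 (u y)).
Proof. by move=> mu; apply: measurableT_comp mu; exact: measurable_psi1 phi_reg. Qed.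

Let bounded_h x y M N : Omega x -> Omega' y -> `|f x| <= M -> `|g y| <= N ->
  `|h x y| <= (M + N + Cc) / eps.
Proof.
move=> Ox Oy fM gN; rewrite normrM [`|eps^-1|]gtr0_norm ?invr_gt0//.
rewrite ler_pM2r ?invr_gt0// (le_trans (ler_normB _ _))//.
by rewrite lerD ?c_bound// (le_trans (ler_normD _ _))// lerD.
Qed.

Lemma pot_row x : Omega x -> avg (fun j => psi1 (h x (y_ j))) = 1.
Proof.
move=> Ox; case: fgP => [[_ /bounded_ex[Mf fM]]] [mg /bounded_ex[M gM]] /(_ x Ox) + _ _.
have mh : measurable_fun Omega' (fun y => h x y).
  apply: measurable_funM => //; apply: measurable_funB.
    exact: measurable_funD.
  apply: (measurable_lipschitz1 mOmega' (ltW L_gt0)) => y1 y2 Oy1 Oy2.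
  exact: cost_lip2.
have [N NP] := psi1_bounded phi_reg ((Mf + M + Cc) / eps).
rewrite (empirical_integral_in n_gt0 mOmega' ysO).
- by move=> [].
- exact: measurable_psi1_h.
- by exists N => y Oy; apply: NP; apply: bounded_h => //; [exact: fM|exact: gM].
Qed.

Lemma pot_col y : Omega' y -> avg (fun i => psi1 (h (x_ i) y)) = 1.
Proof.
move=> Oy; case: fgP => [[mf /bounded_ex[Mf fM]]] [_ /bounded_ex[M gM]] _ /(_ y Oy) + _.
have mh : measurable_fun Omega (fun x => h x y).
  apply: measurable_funM => //; apply: measurable_funB.
    exact: measurable_funD.
  apply: (measurable_lipschitz1 mOmega (ltW L_gt0)) => y1 y2 Oy1 Oy2.
  exact: cost_lip1.
have [N NP] := psi1_bounded phi_reg ((Mf + M + Cc) / eps).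
rewrite (empirical_integral_in n_gt0 mOmega xsO).
- by move=> [].
- exact: measurable_psi1_h.
- by exists N => x Ox; apply: NP; apply: bounded_h => //; [exact: fM|exact: gM].
Qed.

Lemma pot_mean : avg (fun i => f (x_ i)) = 0.
Proof.
case: fgP => [[mf /bounded_ex[Mf fM]]] _ _ _.
by rewrite (empirical_integral_in n_gt0 mOmega xsO mf) => [[]|]; last by exists Mf.
Qed.

Let lt_h x x' y y' : f x + g y - c x y < f x' + g y' - c x' y' -> h x y < h x' y'.
Proof. by rewrite ltr_pM2r ?invr_gt0. Qed.

(** If [f] grew faster than the cost varies, all arguments [h] at one point would lie strictly below
    those at the other, although both rows average to 1. *)
Lemma pot_lip1 x x' : Omega x -> Omega x' -> `|f x - f x'| <= L * enorm (x - x').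
Proof.
suff key u v : Omega u -> Omega v -> f v <= f u + L * enorm (u - v).
  move=> Ox Ox'; have := key _ _ Ox Ox'; have := key _ _ Ox' Ox.
  by rewrite (enorm_distC x') ler_norml; lra.
move=> Ou Ov; rewrite leNgt; apply/negP => fuv.
apply: (avg_psi1_shift n_gt0 (pot_row Ou) (pot_row Ov)) => j; apply: lt_h.
by have := cost_lip1 Ou Ov (ysO j); rewrite ler_norml; lra.
Qed.

Lemma pot_lip2 y y' : Omega' y -> Omega' y' -> `|g y - g y'| <= L * enorm (y - y').
Proof.
suff key u v : Omega' u -> Omega' v -> g v <= g u + L * enorm (u - v).
  move=> Ox Ox'; have := key _ _ Ox Ox'; have := key _ _ Ox' Ox.
  by rewrite (enorm_distC y') ler_norml; lra.
move=> Ou Ov; rewrite leNgt; apply/negP => fuv.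
apply: (avg_psi1_shift n_gt0 (pot_col Ou) (pot_col Ov)) => i; apply: lt_h.
by have := cost_lip2 (xsO i) Ou Ov; rewrite ler_norml; lra.
Qed.

Lemma pot_bound1 x : Omega x -> `|f x| <= L * Dx.
Proof.
move=> Ox; have fx i : `|f x - f (x_ i)| <= L * Dx.
  by apply: (le_trans (pot_lip1 Ox (xsO i))); rewrite ler_pM2l// Omega_diam.
have := norm_avg_le n_gt0 fx; rewrite (avgB (fun=> f x)) pot_mean subr0.
by rewrite avg_cst.
Qed.

(** The column equation at [y] gives a sample point where the argument is at least [t] and one where
    it is at most [t]. Solving both inequalities for [g y] bounds it through [f] and [c]. *)
Lemma pot_bound2 y : Omega' y -> `|g y| <= eps * `|t| + Cc + L * Dx.
Proof.
move=> Oy; have e := lt0r_neq0 eps_gt0.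
have te : `|t| * eps = eps * `|t| by rewrite mulrC.
have t1 := ler_norm t; have t2 := ler_norm (- t); rewrite normrN in t2.
have et1 : t * eps <= eps * `|t| by rewrite -te ler_pM2r.
have et2 : - (t * eps) <= eps * `|t| by rewrite -te -mulNr ler_pM2r.
have [i] := avg_psi1_ex_ge n_gt0 (pot_col Oy).
have [i'] := avg_psi1_ex_le n_gt0 (pot_col Oy).
rewrite ler_pdivrMr// ler_pdivlMr//.
have := pot_bound1 (xsO i); have := pot_bound1 (xsO i').
have := c_bound (xsO i) Oy; have := c_bound (xsO i') Oy.
by rewrite !ler_norml => /andP[? ?] /andP[? ?] /andP[? ?] /andP[? ?] ? ?; lra.
Qed.

Lemma pot_h_lip x x' y y' : Omega x -> Omega x' -> Omega' y -> Omega' y' ->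
  `|h x y - h x' y'| <= 2 * L / eps * (enorm (x - x') + enorm (y - y')).
Proof.
move=> Ox Ox' Oy Oy'; rewrite -mulrBl normrM [`|eps^-1|]gtr0_norm ?invr_gt0//.
rewrite mulrAC ler_pM2r ?invr_gt0//.
have := pot_lip1 Ox Ox'; have := pot_lip2 Oy Oy'; have := cost_lip Ox Ox' Oy Oy'.
by rewrite !ler_norml => /andP[? ?] /andP[? ?] /andP[? ?]; lra.
Qed.

End one_sample.

End empirical_potentials_estimates.

(** * Poincare inequality along chains of balls *)

Section weighted_average.
Context {R : realType} {n : nat}.
Hypothesis n_gt0 : (0 < n)%N.

(** Cauchy-Schwarz for weights that equal their squares; the actual mass is then replaced by its
    lower bound [p]. *)
Lemma wavg_jensen (w : 'I_n -> bool) (F : 'I_n -> R) p : 0 < p ->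
  p <= avg (fun i => (w i)%:R) ->
  ((avg (fun i => (w i)%:R : R))^-1 * avg (fun i => (w i)%:R * F i)) ^+ 2 <=
  p^-1 * avg (fun i => (w i)%:R * F i ^+ 2).
Proof.
move=> p0 pw; set W := avg _ in pw *; have W0 : 0 < W by exact: lt_le_trans pw.
have := avg_sqr_le (fun i => (w i)%:R : R) (fun i => (w i)%:R * F i).
rewrite (eq_avg (G := fun i => (w i)%:R * F i)) => [|i]; last by case: (w i); rewrite ?mul1r ?mul0r.
rewrite [X in _ <= X * _ -> _](eq_avg (G := fun i => (w i)%:R : R)) => [|i]; last first.
  by case: (w i); rewrite ?expr1n ?expr0n.
rewrite [X in _ <= _ * X -> _](eq_avg (G := fun i => (w i)%:R * F i ^+ 2)) => [|i]; last first.
  by case: (w i); rewrite ?mul1r ?mul0r ?expr0n.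
rewrite -/W; set A := avg _; set B := avg _ => AB.
have B0 : 0 <= B by apply: avg_ge0 => // i; rewrite mulr_ge0// sqr_ge0.
apply: (@le_trans _ _ (W^-1 * B)).
  by rewrite exprMn expr2 -mulrA ler_pM2l ?invr_gt0// mulrC ler_pdivrMr// [B * W]mulrC.
by rewrite ler_wpM2r// lef_pV2.
Qed.

End weighted_average.

Section chain_poincare.
Context {R : realType} {d n : nat}.
Hypothesis n_gt0 : (0 < n)%N.
Variables (Omega : set 'rV[R]_d) (x_ : 'I_n -> 'rV[R]_d).
Variables (a b : 'I_n -> R) (E : 'I_n -> 'I_n -> bool) (C : 'rV[R]_d -> 'I_n -> bool).
Variables (rad p q pbar : R) (N : nat).
Hypotheses (N_gt0 : (0 < N)%N) (rad_gt0 : 0 < rad) (p_gt0 : 0 < p) (q_gt0 : 0 < q).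
Local Notation nbr z r i := (enorm (x_ i - z) < r).
Hypothesis Omega_segment : forall i i' (s : R), 0 <= s <= 1 ->
  Omega ((1 - s) *: x_ i + s *: x_ i').
Hypothesis mass_p : forall z, Omega z -> p <= avg (fun i => (nbr z rad i)%:R : R).
Hypothesis mass_q : forall z, Omega z -> q <= avg (fun j => (C z j)%:R : R).
Hypothesis near_E : forall z i j, Omega z -> nbr z (2 * rad) i -> C z j -> E i j.
Hypothesis mass_pbar : forall w, avg (fun i => (nbr w (4 * rad) i)%:R : R) <= pbar.
Hypothesis x_dist : forall i i', enorm (x_ i - x_ i') < N%:R * rad.

Local Notation D := (avg (fun i => avg (fun j => (E i j)%:R * (a i + b j) ^+ 2))).

(** [al z] is the mean of [a] near [z], and [be z] is minus the mean of [b] over the cluster [C z]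
    of partners of [z]. On related pairs a small [a i + b j] means that [a i] is close to [- b j],
    so both estimate the same number. [T z] is the local energy that controls their distance,
    normalized by the lower bounds [p] and [q]. *)
Let al z := (avg (fun i => (nbr z rad i)%:R : R))^-1 *
  avg (fun i => (nbr z rad i)%:R * a i).
Let be z := - ((avg (fun j => (C z j)%:R : R))^-1 * avg (fun j => (C z j)%:R * b j)).
Let T z := (p * q)^-1 * avg (fun u => avg (fun v =>
  (nbr z (2 * rad) u && C z v)%:R * (a u + b v) ^+ 2)).
Let S i := q^-1 * avg (fun j => (E i j)%:R * (a i + b j) ^+ 2).
Let kap := pbar / (p * q).

Let nat_of_bool_ge0 (B : bool) : 0 <= B%:R :> R. Proof. by []. Qed.

Let dist_be z i : Omega z ->
  (a i - be z) ^+ 2 <= q^-1 * avg (fun j => (C z j)%:R * (a i + b j) ^+ 2).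
Proof.
move=> Oz; have W0 := lt_le_trans q_gt0 (mass_q Oz).
have -> : a i - be z = (avg (fun j => (C z j)%:R : R))^-1 *
    avg (fun j => (C z j)%:R * (a i + b j)).
  rewrite /be opprK (eq_avg (F := fun j => (C z j)%:R * (a i + b j)) (G := fun j => a i * (C z
    j)%:R + (C z j)%:R * b j)); last first.
    by move=> j; ring.
  by rewrite avgD avgZ mulrDr [_ * (a i * _)]mulrCA mulVf ?mulr1// lt0r_neq0.
by apply: wavg_jensen => //; exact: mass_q.
Qed.

(** The ball of radius [rad] around [z'] lies in the ball of radius [2 * rad] around [z], so the
    means at two neighbouring points are compared with the same [be z]. This links consecutive balls
    of the chain. *)
Let dist_al_be z z' : Omega z -> Omega z' -> enorm (z' - z) < rad ->
  (al z' - be z) ^+ 2 <= T z.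
Proof.
move=> Oz Oz' zz'; have W0 := lt_le_trans p_gt0 (mass_p Oz').
have -> : al z' - be z = (avg (fun i => (nbr z' rad i)%:R : R))^-1 *
    avg (fun i => (nbr z' rad i)%:R * (a i - be z)).
  rewrite /al (eq_avg (F := fun i => _ * (a i - be z))
    (G := fun i => (nbr z' rad i)%:R * a i - be z * (nbr z' rad i)%:R)); last first.
    by move=> i; ring.
  by rewrite avgB avgZ mulrBr [_ * (be z * _)]mulrCA mulVf ?mulr1// lt0r_neq0.
apply: (le_trans (wavg_jensen n_gt0 _ p_gt0 (mass_p Oz'))).
rewrite /T invfM -mulrA ler_pM2l ?invr_gt0// -avgZ; apply: le_avg => // i.
have [iz'|] := boolP (nbr z' rad i); last first.
  rewrite mul0r => _; apply: mulr_ge0; first by rewrite invr_ge0 ltW.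
  by apply: avg_ge0 => // j; rewrite mulr_ge0// sqr_ge0.
rewrite mul1r (le_trans (dist_be i Oz))// ler_pM2l ?invr_gt0//.
apply: le_avg => // j; have -> : nbr z (2 * rad) i.
  by have := enorm_dist_triangle z' (x_ i) z; lra.
by [].
Qed.

Let T_ge0 z : 0 <= T z.
Proof.
apply: mulr_ge0; first by rewrite invr_ge0 mulr_ge0 ?ltW.
by apply: avg_ge0 => // i; apply: avg_ge0 => // j; rewrite mulr_ge0// sqr_ge0.
Qed.

Let x_Omega i : Omega (x_ i).
Proof.
have := @Omega_segment i i 0; rewrite lexx ler01 subr0 scale1r scale0r addr0.
exact.
Qed.

Let S_ge0 i : 0 <= S i.
Proof.
apply: mulr_ge0; first by rewrite invr_ge0 ltW.
by apply: avg_ge0 => // j; rewrite mulr_ge0// sqr_ge0.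
Qed.

Let dist_end i : (a i - al (x_ i)) ^+ 2 <= 2 * S i + 2 * T (x_ i).
Proof.
have Ox := x_Omega i.
have h1 : (a i - be (x_ i)) ^+ 2 <= S i.
  apply: (le_trans (dist_be i Ox)); rewrite ler_pM2l ?invr_gt0//.
  apply: le_avg => // j; rewrite ler_wpM2r ?sqr_ge0// ler_nat.
  have [Cj|//] := boolP (C (x_ i) j); rewrite (@near_E (x_ i))//.
  by rewrite subrr enorm0 mulr_gt0.
have h2 : (al (x_ i) - be (x_ i)) ^+ 2 <= T (x_ i).
  by apply: dist_al_be => //; rewrite subrr enorm0.
have := sqr_ge0 ((a i - be (x_ i)) + (al (x_ i) - be (x_ i))).
have := h1; have := h2; rewrite !expr2; nra.
Qed.

Let dist_step z z' : Omega z -> Omega z' -> enorm (z' - z) < rad ->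
  (al z' - al z) ^+ 2 <= 4 * T z.
Proof.
move=> Oz Oz' zz'; have h1 := dist_al_be Oz Oz' zz'.
have h2 : (al z - be z) ^+ 2 <= T z by apply: dist_al_be => //; rewrite subrr enorm0.
have := sqr_ge0 ((al z' - be z) + (al z - be z)).
by move: h1 h2; rewrite !expr2; nra.
Qed.

Let zk i i' (k : nat) := (1 - k%:R / N%:R) *: x_ i + (k%:R / N%:R) *: x_ i'.

Let zk01 k : (k <= N)%N -> 0 <= (k%:R / N%:R : R) <= 1.
Proof. by move=> kN; rewrite divr_ge0//= ler_pdivrMr ?ltr0n// mul1r ler_nat. Qed.

Let chain i i' : (al (x_ i') - al (x_ i)) ^+ 2 <=
  N%:R * \sum_(k < N) 4 * T (zk i i' k).
Proof.
have N0 : N%:R != 0 :> R by rewrite pnatr_eq0 -lt0n.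
have z0 : zk i i' 0 = x_ i by rewrite /zk mul0r subr0 scale1r scale0r addr0.
have zN : zk i i' N = x_ i' by rewrite /zk divff// subrr scale0r scale1r add0r.
have -> : al (x_ i') - al (x_ i) =
    \sum_(k < N) 1 * (al (zk i i' k.+1) - al (zk i i' k)).
  under eq_bigr do rewrite mul1r.
  by rewrite -(big_mkord xpredT (fun k => al (zk i i' k.+1) - al (zk i i' k))) telescope_sumr//
    z0 zN.
apply: (le_trans (cauchy_schwarz_sum _ _ _)).
rewrite sumr_const card_ord expr1n -[1 *+ N]/(N%:R) ler_wpM2l//.
apply: ler_sum => k _; apply: dist_step.
- by apply: Omega_segment; apply: zk01; exact: ltnW.
- by apply: Omega_segment; exact: zk01.
have -> : zk i i' k.+1 - zk i i' k = N%:R^-1 *: (x_ i' - x_ i).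
  by apply/rowP => j; rewrite !mxE -natr1; field.
rewrite enormZ gtr0_norm ?invr_gt0 ?ltr0n// mulrC ltr_pdivrMr ?ltr0n//.
by rewrite mulrC x_dist.
Qed.

(** One endpoint of the segment has weight at least [1 / 2]. With the other one frozen, passing
    within [2 * rad] of [x_ u] forces it into a ball of radius [4 * rad], whose mass is at most
    [pbar]. *)
Let mass_congestion u (s : R) : 0 <= s <= 1 ->
  avg (fun i => avg (fun i' => (nbr ((1 - s) *: x_ i + s *: x_ i') (2 * rad) u)%:R : R))
  <= pbar.
Proof.
have one (r : R) (w : 'rV[R]_d) : 1 / 2 <= r ->
    avg (fun i => ((enorm (w - r *: x_ i) < 2 * rad)%R)%:R : R) <= pbar.
  move=> r2; have r0 : 0 < r by lra.
  apply: le_trans (mass_pbar (r^-1 *: w)); apply: le_avg => // i.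
  rewrite ler_nat; have [wx|//] := boolP (enorm (w - r *: x_ i) < 2 * rad).
  have -> // : nbr (r^-1 *: w) (4 * rad) i.
  have -> : x_ i - r^-1 *: w = - (r^-1 *: (w - r *: x_ i)).
    by rewrite scalerBr scalerA mulVf ?lt0r_neq0// scale1r opprB.
  rewrite enormN enormZ gtr0_norm ?invr_gt0// mulrC ltr_pdivrMr//.
  apply: (lt_le_trans wx).
  have := ler_wpM2r (ltW rad_gt0) r2; lra.
move=> /andP[s0 s1]; have [s2|s2] := leP s (1 / 2).
- rewrite exchange_avg -[leRHS](avg_cst n_gt0); apply: le_avg => // i'.
  have := one (1 - s) (x_ u - s *: x_ i'); have -> : 1 / 2 <= 1 - s by lra.
  move=> /(_ isT); congr (_ <= _); apply: eq_avg => i.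
  by congr (_ (_ < _))%:R; congr enorm; apply/rowP => j; rewrite !mxE; ring.
- rewrite -[leRHS](avg_cst n_gt0); apply: le_avg => // i.
  have := one s (x_ u - (1 - s) *: x_ i); have -> : 1 / 2 <= s by lra.
  move=> /(_ isT); congr (_ <= _); apply: eq_avg => i'.
  by congr (_ (_ < _))%:R; congr enorm; apply/rowP => j; rewrite !mxE; ring.
Qed.

(** The averages are exchanged so that the pair [(u, v)] comes first: each pair contributes its
    energy times the proportion of segments passing near [x_ u]. *)
Let avg_T s : 0 <= s <= 1 ->
  avg (fun i => avg (fun i' => T ((1 - s) *: x_ i + s *: x_ i'))) <= kap * D.
Proof.
move=> s01; rewrite /T; under eq_avg do rewrite avgZ; rewrite avgZ.
rewrite /kap [_ / (p * q)]mulrC -mulrA ler_pM2l ?invr_gt0 ?mulr_gt0//.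
rewrite (eq_avg (G := fun i => avg (fun u => avg (fun v => avg (fun i' =>
  (nbr ((1 - s) *: x_ i + s *: x_ i') (2 * rad) u &&
   C ((1 - s) *: x_ i + s *: x_ i') v)%:R * (a u + b v) ^+ 2))))); last first.
  by move=> i; rewrite exchange_avg; apply: eq_avg => u; rewrite exchange_avg.
rewrite exchange_avg -avgZ; apply: le_avg => // u.
rewrite exchange_avg -avgZ; apply: le_avg => // v.
have [Euv|nEuv] := boolP (E u v); last first.
  rewrite mul0r mulr0 -[leRHS](avg_cst n_gt0); apply: le_avg => // i.
  rewrite -[leRHS](avg_cst n_gt0); apply: le_avg => // i'.
  case: (boolP (_ && _)) => [/andP[nu Cv]|]; last by rewrite mul0r.
  by rewrite (near_E (Omega_segment i i' s01) nu Cv) in nEuv.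
rewrite mul1r [leRHS]mulrC.
apply: (@le_trans _ _ ((a u + b v) ^+ 2 * avg (fun i => avg (fun i' =>
  (nbr ((1 - s) *: x_ i + s *: x_ i') (2 * rad) u)%:R : R)))); last first.
  by rewrite ler_wpM2l ?sqr_ge0// mass_congestion.
rewrite -avgZ; apply: le_avg => // i; rewrite -avgZ; apply: le_avg => // i'.
rewrite mulrC ler_wpM2l ?sqr_ge0// ler_nat.
by case: (enorm _ < _) => //=; case: (C _ _).
Qed.

Let avg_S : avg S = q^-1 * D.
Proof. by rewrite /S avgZ. Qed.

Let D_ge0 : 0 <= D.
Proof. by apply: avg_ge0 => // i; apply: avg_ge0 => // j; rewrite mulr_ge0// sqr_ge0. Qed.

Let p_le_pbar : p <= pbar.
Proof.
pose i0 := Ordinal n_gt0; apply: (le_trans (mass_p (x_Omega i0))).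
apply: le_trans (mass_pbar (x_ i0)); apply: le_avg => // i; rewrite ler_nat.
have [xi|//] := boolP (nbr (x_ i0) rad i).
have -> // : nbr (x_ i0) (4 * rad) i.
by apply: (lt_trans xi); rewrite ltr_pMl// ltr1n.
Qed.

(* [a i] is compared with [a i'] along the segment from [x_ i] to [x_ i'], by
   averaging over the balls around its points. A fixed ball meets only a fraction
   [pbar] of all segments, whence the factor [pbar / p] instead of [1 / p]. *)
Lemma chain_poincare :
  avg (fun i => avg (fun i' => (a i - a i') ^+ 2)) <= 36 * N%:R ^+ 2 * kap * D.
Proof.
(* Two end corrections and one chain, whence the factors 3. The end terms are written as points of
   the segment at parameters 0 and 1 so that [avg_T] applies to them as well. The total is
   [24 + 12 * N ^ 2 <= 36 * N ^ 2]. *)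
have bnd i i' : (a i - a i') ^+ 2 <=
    3 * (2 * S i + 2 * T ((1 - 0) *: x_ i + 0 *: x_ i')) +
    3 * (N%:R * \sum_(k < N) 4 * T (zk i i' k)) +
    3 * (2 * S i' + 2 * T ((1 - 1) *: x_ i + 1 *: x_ i')).
  rewrite subr0 subrr !scale1r !scale0r addr0 add0r.
  have h1 := dist_end i; have h2 := dist_end i'; have h3 := chain i i'.
  have := sqr_ge0 ((a i - al (x_ i)) + (al (x_ i') - al (x_ i))).
  have := sqr_ge0 ((a i - al (x_ i)) + (a i' - al (x_ i'))).
  have := sqr_ge0 ((a i' - al (x_ i')) - (al (x_ i') - al (x_ i))).
  have -> : a i - a i' = (a i - al (x_ i)) - (al (x_ i') - al (x_ i)) - (a i' - al (x_ i')).
    by ring.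
  move: h1 h2 h3; set u := a i - _; set v := al _ - _; set w := a i' - _.
  rewrite !expr2; nra.
have kap_q : q^-1 <= kap.
  by rewrite /kap invfM mulrA ler_peMl ?invr_ge0 ?(ltW q_gt0)// ler_pdivlMr// mul1r.
have N1 : 1 <= N%:R :> R by rewrite ler1n.
apply: (@le_trans _ _ (avg (fun i => avg (fun i' =>
    3 * (2 * S i + 2 * T ((1 - 0) *: x_ i + 0 *: x_ i')) +
    3 * (N%:R * \sum_(k < N) 4 * T (zk i i' k)) +
    3 * (2 * S i' + 2 * T ((1 - 1) *: x_ i + 1 *: x_ i')))))).
  by apply: le_avg => // i; exact: le_avg.
have T0 := @avg_T 0; have T1 := @avg_T 1; rewrite !lexx !ler01 in T0 T1.
have {}T0 := T0 isT; have {}T1 := T1 isT.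
have TN : avg (fun i => avg (fun i' => \sum_(k < N) 4 * T (zk i i' k))) <=
    N%:R * (4 * (kap * D)).
  have -> : avg (fun i => avg (fun i' => \sum_(k < N) 4 * T (zk i i' k))) =
      \sum_(k < N) 4 * avg (fun i => avg (fun i' => T (zk i i' k))).
    transitivity (avg (fun i => \sum_(k < N) 4 * avg (fun i' => T (zk i i' k)))).
      apply: eq_avg => i; rewrite avg.unlock exchange_big/= mulr_sumr; apply: eq_bigr => k _.
      by rewrite -mulr_sumr mulrCA.
    rewrite avg.unlock exchange_big/= mulr_sumr; apply: eq_bigr => k _.
    by rewrite -mulr_sumr mulrCA.
  apply: (@le_trans _ _ (\sum_(k < N) 4 * (kap * D))).
    apply: ler_sum => k _; rewrite ler_pM2l//; apply: avg_T; apply: zk01; exact: ltnW.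
  by rewrite sumr_const card_ord -[X in X <= _]mulr_natl.
have lin (S' : 'I_n -> R) (U V W : 'I_n -> 'I_n -> R) : avg (fun i => avg (fun i' =>
    3 * (2 * S' i + 2 * U i i') + 3 * (N%:R * V i i') + 3 * (2 * S' i' + 2 * W i i'))) =
  3 * (2 * avg S' + 2 * avg (fun i => avg (U i))) +
  3 * (N%:R * avg (fun i => avg (V i))) + 3 * (2 * avg S' + 2 * avg (fun i => avg (W i))).
  under eq_avg do rewrite !avgD !avgZ !avgD !avgZ avg_cst//.
  by rewrite !avgD !avgZ !avgD !avgZ avg_cst.
rewrite (lin S (fun i i' => T ((1 - 0) *: x_ i + 0 *: x_ i'))
  (fun i i' => \sum_(k < N) 4 * T (zk i i' k))
  (fun i i' => T ((1 - 1) *: x_ i + 1 *: x_ i'))).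
rewrite avg_S; have qD : q^-1 * D <= kap * D by rewrite ler_wpM2r.
have kD : 0 <= kap * D by rewrite mulr_ge0// (le_trans _ kap_q)// invr_ge0 ltW.
have NT : N%:R * avg (fun i => avg (fun i' => \sum_(k < N) 4 * T (zk i i' k))) <=
    4 * N%:R ^+ 2 * (kap * D).
  by rewrite (le_trans (ler_wpM2l _ TN))// expr2; lra.
have N2 : kap * D <= N%:R ^+ 2 * (kap * D).
  by rewrite ler_peMl// expr_ge1.
lra.
Qed.

End chain_poincare.

Lemma sum_cauchy_schwarz {R : realFieldType} (u v w w' s s' : R) :
  0 <= w -> 0 <= w' -> 0 <= s -> 0 <= s' -> u ^+ 2 <= w * s -> v ^+ 2 <= w' * s' ->
  (u + v) ^+ 2 <= (w + w') * (s + s').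
Proof.
move=> w0 w'0 s0 s'0 us vs.
suff : 2 * (u * v) <= w * s' + w' * s by rewrite !expr2 in us vs *; lra.
have m0 : 0 <= w * s' + w' * s by rewrite addr_ge0// mulr_ge0.
have [uv0|uv0] := leP (2 * (u * v)) 0; first exact: le_trans m0.
rewrite -(@ler_pXn2r _ 2)// ?nnegrE ?(ltW uv0)//.
have := ler_pM (sqr_ge0 u) (sqr_ge0 v) us vs.
have := sqr_ge0 (w * s' - w' * s); rewrite !expr2; lra.
Qed.

(** * From quadratic growth to a gradient bound *)

Section gradient_domination.
Context {R : realType} {n : nat}.
Hypothesis n_gt0 : (0 < n)%N.
Variables (a b gx gy : 'I_n -> R) (E : 'I_n -> 'I_n -> bool) (p k gam kc : R).

Local Notation D := (avg (fun i => avg (fun j => (E i j)%:R * (a i + b j) ^+ 2))).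

(** An inequality of Polyak-Lojasiewicz type. The pairing [G'] dominates [kc * D], the energy [D]
    dominates the squared norm of [(a, b)], and by Cauchy-Schwarz [G' ^ 2] is at most that norm
    times the squared gradient; one factor [G'] is then cancelled. *)
Lemma gradient_domination (Kp : R) : 0 < p -> 0 < k -> 0 < kc -> 0 <= Kp -> 0 <= gam ->
  avg a = 0 ->
  avg (fun i => avg (fun i' => (a i - a i') ^+ 2)) <= Kp * D ->
  (forall j, p <= avg (fun i => (E i j)%:R)) ->
  (forall i, k * avg (fun j => (E i j)%:R) <= gam) ->
  kc * D <= avg (fun i => gx i * a i) + avg (fun j => gy j * b j) ->
  avg (fun i => gx i * a i) + avg (fun j => gy j * b j) <=
  (Kp * (1 + 2 * gam / (k * p)) + 2 / p) / kc *
  (avg (fun i => gx i ^+ 2) + avg (fun j => gy j ^+ 2)).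
Proof.
move=> p0 k0 kc0 Kp0 gam0 a0 var_a mass_E deg_E; set G' := _ + _ => kcD.
set W := avg _ + avg _.
have D0 : 0 <= D.
  by apply: avg_ge0 => // i; apply: avg_ge0 => // j; rewrite mulr_ge0// sqr_ge0.
have A0 : 0 <= avg (fun i => a i ^+ 2) by apply: avg_ge0 => // i; exact: sqr_ge0.
have B0 : 0 <= avg (fun i => b i ^+ 2) by apply: avg_ge0 => // i; exact: sqr_ge0.
have W0 : 0 <= W.
  by apply: addr_ge0; apply: avg_ge0 => // i; exact: sqr_ge0.
have aD : avg (fun i => a i ^+ 2) <= Kp * D.
  apply: le_trans var_a; apply: le_avg => // i.
  rewrite (eq_avg (G := fun i' => a i ^+ 2 - 2 * a i * a i' + a i' ^+ 2)); last first.
    by move=> i'; ring.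
  by rewrite avgD avgB avgZ a0 mulr0 subr0 avg_cst// lerDl.
(* Every [j] has a fraction at least [p] of partners [i], where [b j] is compared with [- a i]. The
   degree bound [gam / k] limits how often a given [a i] is charged. *)
have bD : p * avg (fun j => b j ^+ 2) <= 2 * D + 2 * (gam / k) * avg (fun i => a i ^+ 2).
  rewrite -!avgZ; apply: (@le_trans _ _ (avg (fun j => avg (fun i =>
      (E i j)%:R * (2 * (a i + b j) ^+ 2 + 2 * a i ^+ 2))))).
    apply: le_avg => // j; apply: (@le_trans _ _ (avg (fun i => b j ^+ 2 * (E i j)%:R))).
      by rewrite avgZ mulrC ler_wpM2l ?sqr_ge0.
    apply: le_avg => // i; rewrite mulrC ler_wpM2l//.
    by have := sqr_ge0 ((a i + b j) + a i); rewrite !expr2; nra.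
  rewrite -exchange_avg -avgD; apply: le_avg => // i.
  rewrite (eq_avg (G := fun j => 2 * ((E i j)%:R * (a i + b j) ^+ 2) +
    2 * a i ^+ 2 * (E i j)%:R)); last by move=> j; ring.
  rewrite avgD !avgZ lerD2l.
  have -> : 2 * (gam / k) * a i ^+ 2 = 2 * a i ^+ 2 * (gam / k) by ring.
  by apply: ler_wpM2l; [rewrite mulr_ge0 ?sqr_ge0|rewrite ler_pdivlMr// mulrC; exact: deg_E].
pose Th := Kp * (1 + 2 * gam / (k * p)) + 2 / p.
have M_le : avg (fun i => a i ^+ 2) + avg (fun j => b j ^+ 2) <= Th * D.
  have : avg (fun j => b j ^+ 2) <= (2 * D + 2 * (gam / k) * (Kp * D)) / p.
    rewrite ler_pdivlMr// mulrC (le_trans bD)// lerD2l ler_wpM2l//.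
    by rewrite mulr_ge0// divr_ge0// ltW.
  have -> : Th * D = Kp * D + (2 * D + 2 * (gam / k) * (Kp * D)) / p.
    by rewrite /Th; field; rewrite !lt0r_neq0.
  lra.
have Th0 : 0 <= Th.
  have kp0 : 0 < k * p by rewrite mulr_gt0.
  apply: addr_ge0; last by rewrite divr_ge0// ltW.
  by rewrite mulr_ge0// addr_ge0// divr_ge0 ?mulr_ge0// ltW.
have G2 : G' ^+ 2 <= W * (avg (fun i => a i ^+ 2) + avg (fun j => b j ^+ 2)).
  have := avg_sqr_le gx a; have := avg_sqr_le gy b.
  rewrite /G' /W; set w' := avg (fun i => gy i ^+ 2); set w := avg (fun i => gx i ^+ 2).
  move=> h2 h1; apply: sum_cauchy_schwarz h1 h2 => //;
    by apply: avg_ge0 => // i; exact: sqr_ge0.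
have [G0|G0] := leP G' 0.
  by rewrite (le_trans G0)// mulr_ge0// divr_ge0// ltW.
rewrite -/Th mulrAC ler_pdivlMr//.
have DG : D <= G' / kc by rewrite ler_pdivlMr// mulrC.
have h : G' ^+ 2 <= W * (Th * (G' / kc)).
  apply: (le_trans G2); rewrite ler_wpM2l// (le_trans M_le)// ler_wpM2l//.
rewrite expr2 in h; rewrite -(ler_pM2l G0).
have -> : G' * (Th * W) = W * (Th * (G' / kc)) * kc by field; rewrite lt0r_neq0.
by rewrite [G' * (G' * kc)]mulrA ler_pM2r.
Qed.

End gradient_domination.

(** * Independent samples *)

Section independence.
Context {dS d1 d2 d3} {S : measurableType dS} {T1 : measurableType d1}
  {T2 : measurableType d2} {T3 : measurableType d3} {R : realType}.
Variables (Z1 : S -> T1) (Z2 : S -> T2) (Z3 : S -> T3).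
Hypotheses (mZ1 : measurable_fun setT Z1) (mZ2 : measurable_fun setT Z2)
  (mZ3 : measurable_fun setT Z3).
Variables (mu : probability T1 R) (nu : probability T2 R) (ka : probability T3 R).
Local Open Scope ereal_scope.

Let mZ12 : measurable_fun setT (fun w => (Z1 w, Z2 w)).
Proof. exact: measurable_fun_pair. Qed.

Lemma indep_pair_law (Pr : probability S R) :
  (forall A B, measurable A -> measurable B ->
     Pr (Z1 @^-1` A `&` Z2 @^-1` B) = mu A * nu B) ->
  forall C, measurable C -> Pr ((fun w => (Z1 w, Z2 w)) @^-1` C) = prod_prob mu nu C.
Proof.
move=> AB C mC; apply: esym; apply: (@product_measure_unique _ _ _ _ _ mu nu
  (measure_function_pushforward__canonical__measure_function_Measure Pr mZ12)) => //.
Qed.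

(** Under [Pr] restricted to the event on [Z3], the pair has the law of a product whose first factor
    is scaled by [ka C]; this reduces the claim to uniqueness of product measures. *)
Lemma indep_triple_law (Pr : probability S R) :
  (forall A B C, measurable A -> measurable B -> measurable C ->
     Pr (Z1 @^-1` A `&` Z2 @^-1` B `&` Z3 @^-1` C) = mu A * nu B * ka C) ->
  forall E C, measurable E -> measurable C ->
    Pr ((fun w => (Z1 w, Z2 w)) @^-1` E `&` Z3 @^-1` C) = prod_prob mu nu E * ka C.
Proof.
move=> ABC E C mE mC.
have mZC : measurable (Z3 @^-1` C) by rewrite -[X in measurable X]setTI; exact: mZ3.
have k0 : (0 <= fine (ka C))%R by exact: fine_ge0.
have kE : (fine (ka C))%:E = ka C by rewrite fineK// fin_num_measure.
pose k := NngNum k0; pose muk := mscale k mu : {finite_measure set T1 -> \bar R}.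
have <- : (muk \x nu)%E E = prod_prob mu nu E * ka C.
  rewrite -kE muleC /product_measure1 ge0_integral_mscale//.
  exact: measurable_fun_xsection.
apply: esym; apply: (@product_measure_unique _ _ _ _ _ muk nu
  (measure_function_pushforward__canonical__measure_function_Measure (mrestr Pr mZC) mZ12)) => //.
move=> A B mA mB; transitivity (ka C * mu A * nu B); last by rewrite -{1}kE.
by rewrite -muleA muleC -ABC.
Qed.

End independence.

Section uncorrelated_average.
Context {dS} {S : measurableType dS} {R : realType}.
Variable Pr : probability S R.

Lemma bm_avg {n} (F : 'I_n -> S -> R) : (forall i, bounded_measurable (F i)) ->
  bounded_measurable (fun w => avg (fun i => F i w)).
Proof. by move=> bF; rewrite avg.unlock; apply: bmZ; exact: bm_sum. Qed.

Lemma Rintegral_avg {n} (F : 'I_n -> S -> R) : (forall i, bounded_measurable (F i)) ->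
  \int[Pr]_w (avg (fun i => F i w)) = avg (fun i => \int[Pr]_w F i w).
Proof.
move=> bF; rewrite avg.unlock bm_RintegralZ; last exact: bm_sum.
by rewrite bm_Rintegral_sum.
Qed.

Lemma avg_sqr_uncorrelated {n} (U : 'I_n -> S -> R) (v : R) : (0 < n)%N ->
  (forall i, bounded_measurable (U i)) -> (forall i, \int[Pr]_w (U i w ^+ 2) = v) ->
  (forall i j, i != j -> \int[Pr]_w (U i w * U j w) = 0) ->
  \int[Pr]_w (avg (fun i => U i w) ^+ 2) = v / n%:R.
Proof.
move=> n0 bU Uv U0.
transitivity (\int[Pr]_w avg (fun i => avg (fun j => U i w * U j w))).
  apply: eq_Rintegral => w _; rewrite expr2 -avgZ; apply: eq_avg => i.
  by rewrite mulrC -avgZ.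
rewrite Rintegral_avg; last by move=> i; apply: bm_avg => j; exact: bmM.
rewrite -[RHS](avg_cst n0); apply: eq_avg => i.
rewrite Rintegral_avg; last by move=> j; exact: bmM.
rewrite avg.unlock (bigD1 i)//= big1 ?addr0 => [|j ji]; last by rewrite U0// eq_sym.
by under eq_Rintegral do rewrite -expr2; rewrite Uv mulrC.
Qed.

End uncorrelated_average.

Section independent_family.
Context {dS dT} {S : measurableType dS} {T : measurableType dT} {R : realType}.
Variables (Pr : probability S R) (I : eqType) (Z : I -> S -> T).
Variable law : I -> probability T R.
Hypotheses (mZ : forall k, measurable_fun setT (Z k))
  (Z_law : forall k A, measurable A -> Pr (Z k @^-1` A) = law k A)
  (Z_indep : mutually_independent Pr Z).

Lemma family_law1 k (F : T -> R) : bounded_measurable F ->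
  \int[Pr]_w F (Z k w) = \int[law k]_x F x.
Proof. by move=> bF; apply: bm_Rintegral_law => // A mA; exact: Z_law. Qed.

Let pair_law k l : k != l -> forall A B, measurable A -> measurable B ->
  Pr (Z k @^-1` A `&` Z l @^-1` B) = (law k A * law l B)%E.
Proof.
move=> kl A B mA mB.
have lk : (l == k) = false by rewrite eq_sym; exact: negbTE.
have := @Z_indep [:: k; l] (fun m => if m == k then A else B).
rewrite !big_cons big_nil mule1 eqxx lk !Z_law//= inE kl => <-//; last by move=> m; case: ifP.
congr (Pr _); apply/seteqP; split => w /=.
  by move=> [Ak Bl] m /=; rewrite !inE => /orP[]/eqP -> /=; rewrite ?eqxx ?lk.
move=> H; split.
  by have := H k; rewrite /= !inE !eqxx; exact.
by have := H l; rewrite /= !inE !eqxx orbT lk; exact.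
Qed.

Let triple_law k l m : k != l -> k != m -> l != m ->
  forall A B C, measurable A -> measurable B -> measurable C ->
  Pr (Z k @^-1` A `&` Z l @^-1` B `&` Z m @^-1` C) = (law k A * law l B * law m C)%E.
Proof.
move=> kl km lm A B C mA mB mC.
have lk : (l == k) = false by rewrite eq_sym; exact: negbTE.
have mk : (m == k) = false by rewrite eq_sym; exact: negbTE.
have ml : (m == l) = false by rewrite eq_sym; exact: negbTE.
have := @Z_indep [:: k; l; m] (fun i => if i == k then A else if i == l then B else C).
rewrite !big_cons big_nil mule1 !eqxx lk mk ml !Z_law// muleA.
rewrite /= !inE negb_or kl km lm => <-//; last first.
  by move=> i; case: ifP => // _; case: ifP.
congr (Pr _); apply/seteqP; split => w /=.
  by move=> [[Ak Bl] Cm] i /=; rewrite !inE => /or3P[]/eqP -> /=; rewrite ?eqxx ?lk ?mk ?ml.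
move=> H; split; [split|].
- by have := H k; rewrite /= !inE !eqxx; exact.
- by have := H l; rewrite /= !inE !eqxx orbT lk; exact.
- by have := H m; rewrite /= !inE !eqxx !orbT mk ml; exact.
Qed.

Lemma family_law2 k l (F : T * T -> R) : k != l -> bounded_measurable F ->
  \int[Pr]_w F (Z k w, Z l w) = \int[prod_prob (law k) (law l)]_z F z.
Proof.
move=> kl bF; apply: (bm_Rintegral_law (X := fun w => (Z k w, Z l w))) => //.
  exact: measurable_fun_pair.
by apply: indep_pair_law => //; exact: pair_law.
Qed.

Lemma family_law3 k l m (F : T * T * T -> R) : k != l -> k != m -> l != m ->
  bounded_measurable F ->
  \int[Pr]_w F (Z k w, Z l w, Z m w) =
  \int[prod_prob (prod_prob (law k) (law l)) (law m)]_z F z.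
Proof.
move=> kl km lm bF; apply: (bm_Rintegral_law (X := fun w => (Z k w, Z l w, Z m w))) => //.
  by apply: measurable_fun_pair => //; exact: measurable_fun_pair.
apply: indep_pair_law => //; first exact: measurable_fun_pair.
by apply: indep_triple_law => //; exact: triple_law.
Qed.

Lemma family_variance {n} (ks : 'I_n -> I) (mu : probability T R) (F : T -> R) :
  (0 < n)%N -> injective ks -> (forall i, law (ks i) = mu) -> bounded_measurable F ->
  \int[Pr]_w ((avg (fun i => F (Z (ks i) w)) - \int[mu]_x F x) ^+ 2) <=
  (\int[mu]_x (F x ^+ 2)) / n%:R.
Proof.
move=> n0 kinj lawE bF; set m := \int[mu]_x F x.
have bU : bounded_measurable (fun x => F x - m) by apply: bmB => //; exact: bm_cst.
have mU : \int[mu]_x (F x - m) = 0.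
  by rewrite bm_RintegralB ?Rintegral_prob_cst ?subrr//; exact: bm_cst.
have bUZ i : bounded_measurable (fun w => F (Z (ks i) w) - m).
  exact: (bm_comp (mZ (ks i)) bU).
have -> : \int[Pr]_w ((avg (fun i => F (Z (ks i) w)) - m) ^+ 2) =
    \int[Pr]_w (avg (fun i => F (Z (ks i) w) - m) ^+ 2).
  by apply: eq_Rintegral => w _; rewrite avgB avg_cst.
rewrite (avg_sqr_uncorrelated (v := \int[mu]_x ((F x - m) ^+ 2)) n0)//.
- rewrite ler_pM2r ?invr_gt0 ?ltr0n//.
  have -> : \int[mu]_x ((F x - m) ^+ 2) = \int[mu]_x (F x ^+ 2) - m ^+ 2.
    transitivity (\int[mu]_x (F x ^+ 2 - m * (F x + (F x - m)))).
      by apply: eq_Rintegral => x _; ring.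
    rewrite (bm_RintegralB mu (bmX 2 bF) (bmZ m (bmD bF bU))).
    by rewrite (bm_RintegralZ mu m (bmD bF bU)) (bm_RintegralD mu bF bU) mU addr0 -expr2.
  by rewrite gerBl sqr_ge0.
- by move=> i; rewrite (family_law1 _ (bmX 2 bU)) lawE.
move=> i j ij; have kij : ks i != ks j by apply: contra_neq ij => /kinj.
have bUU : bounded_measurable (fun z : T * T => (F z.1 - m) * (F z.2 - m)).
  by apply: bmM; [exact: (bm_comp _ bU)|exact: (bm_comp _ bU)].
rewrite (family_law2 kij bUU) !lawE; have [_ ->] := bm_Fubini1 mu mu bUU.
rewrite -[RHS](Rintegral_prob_cst mu 0); apply: eq_Rintegral => x _.
by rewrite (bm_RintegralZ mu (F x - m) bU) mU mulr0.
Qed.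

(** Cross terms vanish because the inner integral over one of the two [ls] coordinates is zero for
    every value of [Z k] in [D]. The summands share [Z k] and are uncorrelated but not
    independent. *)
Lemma family_row_variance {n} k (ls : 'I_n -> I) (nu : probability T R) (D : set T)
    (u : T * T -> R) :
  (0 < n)%N -> injective ls -> (forall j, k != ls j) -> (forall j, law (ls j) = nu) ->
  bounded_measurable u -> measurable D -> law k D = 1%E ->
  (forall x, D x -> \int[nu]_y u (x, y) = 0) ->
  \int[Pr]_w (avg (fun j => u (Z k w, Z (ls j) w)) ^+ 2) =
  (\int[prod_prob (law k) nu]_z (u z ^+ 2)) / n%:R.
Proof.
move=> n0 linj kl lawE bu mD D1 u0.
have bU j : bounded_measurable (fun w => u (Z k w, Z (ls j) w)).
  by apply: (bm_comp _ bu); exact: measurable_fun_pair.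
apply: avg_sqr_uncorrelated => // [j|i j ij].
  by rewrite (family_law2 (kl j) (bmX 2 bu)) lawE.
have lij : ls i != ls j by apply: contra_neq ij => /linj.
have bUU : bounded_measurable (fun z : T * T * T => u (z.1.1, z.1.2) * u (z.1.1, z.2)).
  apply: bmM; apply: (bm_comp _ bu); apply: measurable_fun_pair => //.
  - exact: measurableT_comp.
  - exact: measurableT_comp.
  - exact: measurableT_comp.
rewrite (family_law3 (kl i) (kl j) lij bUU) !lawE.
have [bI ->] := bm_Fubini1 (prod_prob (law k) nu) nu bUU.
rewrite -[RHS](Rintegral_prob_cst (prod_prob (law k) nu) 0).
apply: ae_eq_Rintegral; [by case: bI|exact: measurable_cst|].
have mDT : measurable (D `*` [set: T]) by exact: measurableX.
have DT1 : prod_prob (law k) nu (D `*` [set: T]) = 1%E.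
  by apply: prod_prob_full => //; exact: probability_setT.
apply: filterS (full_ae mDT DT1) => -[x y] [/= Dx _].
by rewrite (bm_RintegralZ nu (u (x, y)) (bm_pair1 x bu)) u0// mulr0.
Qed.

End independent_family.

(** The limit is the supremum of the levels that [u] attains or exceeds on a set of [U]; since an
    ultrafilter contains every set or its complement, the upper estimate follows too. *)
Lemma ultra_lim {R : realType} (U : set_system nat) (u : nat -> R) (M : R) :
  UltraFilter U -> (forall m, `|u m| <= M) ->
  exists l, forall e, 0 < e -> U [set m | `|u m - l| < e].
Proof.
move=> UU uM; pose E := [set r | U [set m | r <= u m]].
have uM' m : - M <= u m <= M by rewrite -ler_norml.
have EM : E (- M).
  by rewrite /E/= (_ : [set _ | _] = setT); [exact: filterT|apply/seteqP; split => m //= _;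
    case/andP: (uM' m)].
have Eub r : E r -> r <= M.
  move=> Er; have [m /= rm] := filter_ex Er.
  by rewrite (le_trans rm)//; case/andP: (uM' m).
have hE : has_sup E by split; [exists (- M)|exists M].
exists (sup E) => e e0.
have low : U [set m | sup E - e < u m].
  have [r Er lr] := sup_adherent e0 hE.
  by apply: filterS Er => m /=; exact: lt_le_trans.
have up : U [set m | u m < sup E + e].
  have [U1|] := in_ultra_setVsetC [set m | sup E + e <= u m] UU; last first.
    by apply: filterS => m /= /negP; rewrite -ltNge.
  by have := ub_le_sup hE.2 U1; rewrite gerDl leNgt e0.
by apply: filterS (filterI low up) => m [/= h1 h2]; rewrite ltr_distl; lra.
Qed.

(** * Samples whose empirical measures converge weakly *)

Section quadrature.
Context {R : realType} {d : nat}.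
Variables (P : probability 'rV[R]_d R) (D : set 'rV[R]_d).
Hypotheses (mD : measurable D) (PD : P D = 1%E).
Variables (s : R) (zs : seq 'rV[R]_d).
Hypotheses (zsD : forall z, z \in zs -> D z)
  (zs_net : forall x, D x -> exists2 z, z \in zs & cell s x = cell s z).

(** [F] is replaced on each cell by its value at a representative, at the price [eta] once for the
    sample and once for [P]. The step function is then integrated cell by cell, where the
    frequencies are accurate up to [e]. *)
Lemma quadrature n (xs : 'I_n -> 'rV[R]_d) (F : 'rV[R]_d -> R) (B eta e : R) :
  (0 < n)%N -> bounded_measurable F -> 0 <= eta -> (forall x, D x -> `|F x| <= B) ->
  (forall x y, D x -> D y -> cell s x = cell s y -> `|F x - F y| <= eta) ->
  (forall i, D (xs i)) ->
  (forall z, z \in zs -> `|avg (fun i => \1_(cell s @^-1` [set cell s z]) (xs i) : R) -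
     \int[P]_x \1_(cell s @^-1` [set cell s z]) x| <= e) ->
  `|avg (fun i => F (xs i)) - \int[P]_x F x| <= 2 * eta + (size zs)%:R * (B * e).
Proof.
move=> n0 bF eta0 FB Fosc xsD xsP.
(* Several net points may share a cell; without repetitions each point of [D] is counted in exactly
   one term of [G]. *)
pose ms := undup (map (cell s) zs).
pose rep m := nth 0 zs (index m (map (cell s) zs)).
have repP m : m \in ms -> rep m \in zs /\ cell s (rep m) = m.
  rewrite mem_undup => mzs; have iz : (index m (map (cell s) zs) < size zs)%N.
    by rewrite -(size_map (cell s)) index_mem.
  by split; [exact: mem_nth|rewrite -[LHS](nth_map 0 (cell s 0))// nth_index].
pose G x := \sum_(m <- ms) F (rep m) * \1_(cell s @^-1` [set m]) x.
have bI m : bounded_measurable (\1_(cell s @^-1` [set m]) : 'rV[R]_d -> R).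
  by apply: bm_indic; exact: measurable_cell.
have bG : bounded_measurable G by apply: bm_sum => m; exact: bmZ.
have FG x : D x -> `|F x - G x| <= eta.
  move=> Dx; have [z zzs xz] := zs_net Dx.
  have cms : cell s x \in ms by rewrite mem_undup xz; apply: map_f.
  have -> : G x = F (rep (cell s x)).
    rewrite /G (bigD1_seq (cell s x))//= ?undup_uniq// big1 => [|m /eqP mx].
      by rewrite indicE mem_set// mulr1 addr0.
    by rewrite indicE memNset ?mulr0//= => /esym.
  have [rz rx] := repP _ cms; apply: Fosc => //; exact: zsD.
have bH := bm_restrict mD (measurable_funB (measurable_funTS (proj1 bF)) (measurable_funTS
  (proj1 bG))) (ex_intro _ eta FG).
have step1 : `|avg (fun i => F (xs i)) - avg (fun i => G (xs i))| <= eta.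
  by rewrite -avgB; apply: norm_avg_le => // i; exact: FG.
have step2 : `|\int[P]_x F x - \int[P]_x G x| <= eta.
  rewrite -bm_RintegralB//.
  have -> : \int[P]_x (F x - G x) = \int[P]_x (((fun x => F x - G x) \_ D) x).
    apply: ae_eq_Rintegral; [by case: (bmB bF bG)|by case: bH|].
    by apply: filterS (full_ae mD PD) => x Dx; rewrite patchE mem_set.
  apply: bm_normr_Rintegral_le => // x.
  by rewrite patchE; case: ifPn => [/set_mem/FG//|_]; rewrite normr0.
have step3 : `|avg (fun i => G (xs i)) - \int[P]_x G x| <= (size zs)%:R * (B * e).
  have -> : avg (fun i => G (xs i)) =
      \sum_(m <- ms) F (rep m) * avg (fun i => \1_(cell s @^-1` [set m]) (xs i)).
    rewrite avg.unlock /G exchange_big mulr_sumr; apply: eq_bigr => m _.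
    by rewrite -mulr_sumr mulrCA.
  rewrite bm_Rintegral_sum; last by move=> m; exact: bmZ.
  rewrite -sumrB (le_trans (ler_norm_sum _ _ _))//.
  apply: (@le_trans _ _ (\sum_(m <- ms) B * e)); last first.
    rewrite big_const_seq count_predT iter_addr addr0 -[leLHS]mulr_natl.
    have Dx := xsD (Ordinal n0); have [z zzs _] := zs_net Dx.
    rewrite ler_wpM2r ?ler_nat ?mulr_ge0//.
    - exact: le_trans (normr_ge0 _) (FB _ Dx).
    - exact: le_trans (normr_ge0 _) (xsP _ zzs).
    - by rewrite (leq_trans (size_undup _))// size_map.
  rewrite big_seq [leRHS]big_seq; apply: ler_sum => m /repP[rz rm].
  rewrite (bm_RintegralZ P (F (rep m)) (bI m)) -mulrBr normrM ler_pM//.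
    by apply: FB; exact: zsD.
  by have := xsP _ rz; rewrite rm.
have := ler_distD (avg (fun i => G (xs i))) (avg (fun i => F (xs i))) (\int[P]_x F x).
have := ler_distD (\int[P]_x G x) (avg (fun i => G (xs i))) (\int[P]_x F x).
rewrite distrC in step2; lra.
Qed.

End quadrature.

Section weak_sampling.
Context {dS} {S : measurableType dS} {R : realType} {d : nat}.
Variables (Pr : probability S R) (P Q : probability 'rV[R]_d R).
Variables (X Y : nat -> S -> 'rV[R]_d).
Hypotheses (mX : forall i, measurable_fun setT (X i))
  (mY : forall j, measurable_fun setT (Y j)).
Hypotheses (X_law : forall i A, measurable A -> Pr (X i @^-1` A) = P A)
  (Y_law : forall j A, measurable A -> Pr (Y j @^-1` A) = Q A).
Hypothesis XY_indep : mutually_independent Pr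
  (fun k : nat + nat => match k with inl i => X i | inr j => Y j end).

Local Notation Z := (fun k : nat + nat => match k with inl i => X i | inr j => Y j end).
Let law (k : nat + nat) := if k is inl _ then P else Q.

Let mZ k : measurable_fun setT (Z k). Proof. by case: k. Qed.

Let Z_law k A : measurable A -> Pr (Z k @^-1` A) = law k A.
Proof. by case: k => m mA; [exact: X_law|exact: Y_law]. Qed.

Lemma sample_law1X i F : bounded_measurable F ->
  \int[Pr]_w F (X i w) = \int[P]_x F x.
Proof. exact: (family_law1 mZ Z_law (inl i)). Qed.

Lemma sample_law1Y i F : bounded_measurable F ->
  \int[Pr]_w F (Y i w) = \int[Q]_x F x.
Proof. exact: (family_law1 mZ Z_law (inr i)). Qed.

Lemma sample_law2 i j F : bounded_measurable F ->
  \int[Pr]_w F (X i w, Y j w) = \int[prod_prob P Q]_z F z.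
Proof. by apply: (family_law2 mZ Z_law XY_indep (k := inl i) (l := inr j)). Qed.

Lemma sample_varianceX n F : (0 < n)%N -> bounded_measurable F ->
  \int[Pr]_w ((avg (fun i : 'I_n => F (X i w)) - \int[P]_x F x) ^+ 2) <=
  (\int[P]_x (F x ^+ 2)) / n%:R.
Proof.
move=> n0; apply: (family_variance mZ Z_law XY_indep (ks := fun i : 'I_n => inl (val i))) => //.
by move=> i j [] /val_inj.
Qed.

Lemma sample_varianceY n F : (0 < n)%N -> bounded_measurable F ->
  \int[Pr]_w ((avg (fun i : 'I_n => F (Y i w)) - \int[Q]_x F x) ^+ 2) <=
  (\int[Q]_x (F x ^+ 2)) / n%:R.
Proof.
move=> n0; apply: (family_variance mZ Z_law XY_indep (ks := fun i : 'I_n => inr (val i))) => //.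
by move=> i j [] /val_inj.
Qed.

Lemma sample_rowX n i D u : (0 < n)%N -> bounded_measurable u -> measurable D ->
  P D = 1%E -> (forall x, D x -> \int[Q]_y u (x, y) = 0) ->
  \int[Pr]_w (avg (fun j : 'I_n => u (X i w, Y j w)) ^+ 2) =
  (\int[prod_prob P Q]_z (u z ^+ 2)) / n%:R.
Proof.
move=> n0 bu mD D1 u0.
apply: (family_row_variance mZ Z_law XY_indep (k := inl i)
  (ls := fun j : 'I_n => inr (val j)) (D := D) n0) => //.
by move=> j l [] /val_inj.
Qed.

Lemma sample_rowY n j D u : (0 < n)%N -> bounded_measurable u -> measurable D ->
  Q D = 1%E -> (forall y, D y -> \int[P]_x u (x, y) = 0) ->
  \int[Pr]_w (avg (fun i : 'I_n => u (X i w, Y j w)) ^+ 2) =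
  (\int[prod_prob P Q]_z (u z ^+ 2)) / n%:R.
Proof.
move=> n0 bu mD D1 u0; pose u' z := u (z.2, z.1).
have bu' : bounded_measurable u' by apply: (bm_comp _ bu); exact: measurable_fun_pair.
have -> : \int[prod_prob P Q]_z (u z ^+ 2) = \int[prod_prob Q P]_z (u' z ^+ 2).
  have [_ ->] := bm_Fubini2 P Q (bmX 2 bu).
  by have [_ ->] := bm_Fubini1 Q P (bmX 2 bu').
apply: (family_row_variance mZ Z_law XY_indep (k := inr j) (u := u')
  (ls := fun i : 'I_n => inl (val i)) (D := D) n0) => //.
by move=> i l [] /val_inj.
Qed.

Lemma sample_ae (D D' : set 'rV[R]_d) : measurable D -> measurable D' ->
  P D = 1%E -> Q D' = 1%E ->
  {ae Pr, forall w, (forall i, D (X i w)) /\ (forall j, D' (Y j w))}.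
Proof.
move=> mD mD' PD QD'.
have aeX : {ae Pr, forall w, forall i, D (X i w)}.
  apply: ae_foralln => i; apply: (@full_ae _ _ _ Pr (X i @^-1` D)).
    by rewrite -[X in measurable X]setTI; exact: mX.
  by rewrite X_law.
have aeY : {ae Pr, forall w, forall i, D' (Y i w)}.
  apply: ae_foralln => i; apply: (@full_ae _ _ _ Pr (Y i @^-1` D')).
    by rewrite -[X in measurable X]setTI; exact: mY.
  by rewrite Y_law.
by apply: filterS2 aeX aeY => w.
Qed.

(** First moment argument: for large [n] the expected total squared deviation is below [e], so it
    cannot exceed [e] on almost every sample, and almost every sample lies in the two sets of full
    mass. *)
Lemma sample_exists (J : Type) (js js' : seq J) (F : J -> 'rV[R]_d -> R)
    (D D' : set 'rV[R]_d) (e : R) :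
  measurable D -> measurable D' -> P D = 1%E -> Q D' = 1%E -> 0 < e ->
  (forall j, bounded_measurable (F j)) ->
  exists n w, [/\ (0 < n)%N, forall i, D (X i w), forall j, D' (Y j w),
    \sum_(j <- js) (avg (fun i : 'I_n => F j (X i w)) - \int[P]_x F j x) ^+ 2 <= e &
    \sum_(j <- js') (avg (fun i : 'I_n => F j (Y i w)) - \int[Q]_x F j x) ^+ 2 <= e].
Proof.
move=> mD mD' PD QD' e0 bF.
pose K := \sum_(j <- js) \int[P]_x (F j x ^+ 2) + \sum_(j <- js') \int[Q]_x (F j x ^+ 2).
pose n := (Num.trunc (K / e)).+1.
have n0 : (0 < n)%N by [].
have Kn : K / n%:R < e.
  by rewrite ltr_pdivrMr ?ltr0n// mulrC -ltr_pdivrMr// truncnS_gt.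
pose VX j w := (avg (fun i : 'I_n => F j (X i w)) - \int[P]_x F j x) ^+ 2.
pose VY j w := (avg (fun i : 'I_n => F j (Y i w)) - \int[Q]_x F j x) ^+ 2.
have bVX j : bounded_measurable (VX j).
  apply: bmX; apply: bmB; last exact: bm_cst.
  by apply: bm_avg => i; exact: bm_comp.
have bVY j : bounded_measurable (VY j).
  apply: bmX; apply: bmB; last exact: bm_cst.
  by apply: bm_avg => i; exact: bm_comp.
pose V w := \sum_(j <- js) VX j w + \sum_(j <- js') VY j w.
have bV : bounded_measurable V by apply: bmD; exact: bm_sum.
have VK : \int[Pr]_w V w <= K / n%:R.
  rewrite bm_RintegralD; [|exact: bm_sum..].
  rewrite !bm_Rintegral_sum// mulrDl !mulr_suml lerD//; apply: ler_sum => j _.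
    exact: sample_varianceX.
  exact: sample_varianceY.
apply: contrapT => nex.
have : e <= \int[Pr]_w V w; last by apply/negP; rewrite -ltNge (le_lt_trans VK).
rewrite -lee_fin -(Rintegral_prob_cst Pr e) -!bm_integralE//; last exact: bm_cst.
apply: ae_le_integral_measurable_l; first exact: (bm_integrable Pr (bm_cst e)).
apply: filterS (sample_ae mD mD' PD QD') => w [wX wY]; rewrite lee_fin leNgt.
apply/negP => Vw; apply: nex; exists n, w.
have VX0 : 0 <= \sum_(j <- js) VX j w by apply: sumr_ge0 => j _; exact: sqr_ge0.
have VY0 : 0 <= \sum_(j <- js') VY j w by apply: sumr_ge0 => j _; exact: sqr_ge0.
by split => //; apply: le_trans (ltW Vw); rewrite /V ?lerDl ?lerDr.
Qed.

End weak_sampling.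

Section weakly_convergent_samples.
Context {dS} {S : measurableType dS} {R : realType} {d : nat}.
Variables (Pr : probability S R) (P Q : probability 'rV[R]_d R).
Variables (X Y : nat -> S -> 'rV[R]_d).
Hypotheses (mX : forall i, measurable_fun setT (X i))
  (mY : forall j, measurable_fun setT (Y j)).
Hypotheses (X_law : forall i A, measurable A -> Pr (X i @^-1` A) = P A)
  (Y_law : forall j A, measurable A -> Pr (Y j @^-1` A) = Q A).
Hypothesis XY_indep : mutually_independent Pr
  (fun k : nat + nat => match k with inl i => X i | inr j => Y j end).
Variables (D D' : set 'rV[R]_d) (M : R).
Hypotheses (mD : measurable D) (mD' : measurable D') (PD : P D = 1%E) (QD' : Q D' = 1%E).
Hypotheses (M0 : 0 <= M) (DM : forall x i, D x -> `|x ord0 i| <= M)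
  (DM' : forall x i, D' x -> `|x ord0 i| <= M).

Definition lipschitz_test (E : set 'rV[R]_d) (F : 'rV[R]_d -> R) : Prop :=
  bounded_measurable F /\
  exists2 K, 0 <= K & forall x y, E x -> E y -> `|F x - F y| <= K * enorm (x - y).

Let approx (E : set 'rV[R]_d) (mu : probability 'rV[R]_d R) k m (xs : 'I_k -> 'rV[R]_d)
    (zs : seq 'rV[R]_d) (N : R) (F : 'rV[R]_d -> R) (B K : R) :
  measurable E -> mu E = 1%E -> (0 < k)%N -> (forall i, E (xs i)) ->
  (forall z, z \in zs -> E z) ->
  (forall x, E x -> exists2 z, z \in zs & cell m.+1%:R x = cell m.+1%:R z) ->
  (size zs)%:R <= N -> 0 < N ->
  \sum_(z <- zs) (avg (fun i => \1_(cell m.+1%:R @^-1` [set cell m.+1%:R z]) (xs i) : R) -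
     \int[mu]_x \1_(cell m.+1%:R @^-1` [set cell m.+1%:R z]) x) ^+ 2 <=
     (m.+1%:R * N) ^- 2 ->
  bounded_measurable F -> (forall x, `|F x| <= B) -> 0 <= K ->
  (forall x y, E x -> E y -> `|F x - F y| <= K * enorm (x - y)) ->
  `|avg (fun i => F (xs i)) - \int[mu]_x F x| <= (2 * K * d%:R + B) / m.+1%:R.
Proof.
move=> mE E1 k0 xsE zsE znet zN N0 zP bF FB K0 FK.
have m0 : 0 < m.+1%:R :> R by rewrite ltr0n.
have B0 : 0 <= B by exact: le_trans (normr_ge0 _) (FB 0).
have e0 : 0 <= (m.+1%:R * N)^-1 by rewrite invr_ge0 mulr_ge0 ?ltW.
apply: (@le_trans _ _ (2 * (K * (d%:R / m.+1%:R)) + (size zs)%:R * (B * (m.+1%:R * N)^-1))).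
  apply: (quadrature mE E1 zsE znet) => //.
  - by rewrite mulr_ge0// divr_ge0// ltW.
  - move=> x y Ex Ey xy; apply: (le_trans (FK x y Ex Ey)).
    by rewrite ler_wpM2l//; exact: cell_dist.
  move=> z zzs; rewrite -(ler_pXn2r (ltn0Sn 1)) ?nnegrE// exprVn.
  rewrite real_normK ?num_real//; apply: le_trans zP.
  by rewrite (big_rem z)//= lerDl; apply: sumr_ge0 => y _; exact: sqr_ge0.
rewrite [leRHS]mulrDl lerD//; first by rewrite !mulrA.
rewrite invfM [B / _]mulrC mulrCA [leRHS]mulrC; apply: ler_wpM2l => //.
  by rewrite mulrCA ler_piMr ?invr_ge0 ?(ltW m0)// ler_pdivrMr// mul1r.
Qed.

Lemma weak_samples : exists (n_ : nat -> nat) (w_ : nat -> S),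
  [/\ forall m, (0 < n_ m)%N, forall m i, D (X i (w_ m)), forall m j, D' (Y j (w_ m)),
    forall F, lipschitz_test D F -> forall e, 0 < e -> exists m0, forall m, (m0 <= m)%N ->
      `|avg (fun i : 'I_(n_ m) => F (X i (w_ m))) - \int[P]_x F x| <= e &
    forall F, lipschitz_test D' F -> forall e, 0 < e -> exists m0, forall m, (m0 <= m)%N ->
      `|avg (fun i : 'I_(n_ m) => F (Y i (w_ m))) - \int[Q]_x F x| <= e].
Proof.
have s0 m : 0 < m.+1%:R :> R by rewrite ltr0n.
have /choice[zs zsP] m := finite_cell_net M0 (s0 m) DM.
have /choice[zs' zsP'] m := finite_cell_net M0 (s0 m) DM'.
(* [N m] dominates the size of both nets, so a tolerance of [1 / (m.+1 * N m)] per cell adds up to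
   at most [1 / m.+1]. *)
pose N m : R := (size (zs m))%:R + (size (zs' m))%:R + 1.
have N0 m : 0 < N m by rewrite ltr_wpDl// addr_ge0.
have ex m := sample_exists mX mY X_law Y_law XY_indep (zs m) (zs' m)
  (F := fun z => \1_(cell m.+1%:R @^-1` [set cell m.+1%:R z])) mD mD' PD QD'
  (e := (m.+1%:R * N m) ^- 2) ltac:(by rewrite invr_gt0 exprn_gt0// mulr_gt0)
  (fun z => bm_indic (@measurable_cell _ _ _ _)).
have {ex} /choice[nw nwP] : forall m, exists nw : nat * S, [/\ (0 < nw.1)%N,
    forall i, D (X i nw.2), forall j, D' (Y j nw.2),
    \sum_(z <- zs m) (avg (fun i : 'I_nw.1 => \1_(cell m.+1%:R @^-1` [set cell m.+1%:R z]) (X i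
      nw.2) : R) -
      \int[P]_x \1_(cell m.+1%:R @^-1` [set cell m.+1%:R z]) x) ^+ 2 <= (m.+1%:R * N m) ^- 2 &
    \sum_(z <- zs' m) (avg (fun i : 'I_nw.1 => \1_(cell m.+1%:R @^-1` [set cell m.+1%:R z]) (Y
      i nw.2) : R) -
      \int[Q]_x \1_(cell m.+1%:R @^-1` [set cell m.+1%:R z]) x) ^+ 2 <= (m.+1%:R * N m) ^- 2].
  by move=> m; have [n [w nwP]] := ex m; exists (n, w).
have rate (C e : R) : 0 < e -> exists m0, forall m, (m0 <= m)%N -> C / m.+1%:R <= e.
  move=> e0; exists (Num.trunc (C / e)) => m m0m; rewrite ler_pdivrMr// mulrC -ler_pdivrMr//.
  by rewrite ltW// (lt_le_trans (truncnS_gt _))// ler_nat ltnS.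
exists (fun m => (nw m).1), (fun m => (nw m).2); split.
- by move=> m; case: (nwP m).
- by move=> m; case: (nwP m).
- by move=> m; case: (nwP m).
- move=> F [bF [K K0 FK]] e e0; have [_ [B FB]] := bF.
  have [m0 m0P] := rate (2 * K * d%:R + B) e e0; exists m0 => m /m0P; apply: le_trans.
  have [n0 nX _ h _] := nwP m; have [_ zsD znet] := zsP m.
  by apply: (approx mD PD n0 _ zsD znet _ (N0 m) h bF FB K0 FK) => //; rewrite /N; have :=
    ler0n R (size (zs m)); have := ler0n R (size (zs' m)); lra.
- move=> F [bF [K K0 FK]] e e0; have [_ [B FB]] := bF.
  have [m0 m0P] := rate (2 * K * d%:R + B) e e0; exists m0 => m /m0P; apply: le_trans.
  have [n0 _ nY _ h] := nwP m; have [_ zsD znet] := zsP' m.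
  by apply: (approx mD' QD' n0 _ zsD znet _ (N0 m) h bF FB K0 FK) => //; rewrite /N; have :=
    ler0n R (size (zs m)); have := ler0n R (size (zs' m)); lra.
Qed.

End weakly_convergent_samples.

Section potentials_limit.
Context {R : realType} {d : nat}.
Variables (phi psi2 : R -> R).
Hypothesis psi2P : nondecreasing_second_derivative (convex_conj phi) psi2.
Local Notation psi1 := (derive1 (convex_conj phi)).
Variables (M L eps B : R).
Hypotheses (M0 : 0 <= M) (L_gt0 : 0 < L) (eps_gt0 : 0 < eps).

(** Pointwise limits of equi-Lipschitz functions are uniform: closeness on a finite net is a finite
    intersection of members of [U], and the common Lipschitz bound extends it to all of [E]. *)
Lemma uniform_ultra_lim (U : set_system nat) (E : set 'rV[R]_d) (u_ : nat -> 'rV[R]_d -> R)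
    (u : 'rV[R]_d -> R) : UltraFilter U -> (forall x i, E x -> `|x ord0 i| <= M) ->
  (forall m x x', E x -> E x' -> `|u_ m x - u_ m x'| <= L * enorm (x - x')) ->
  (forall x, E x -> forall e, 0 < e -> U [set m | `|u_ m x - u x| < e]) ->
  (forall x x', E x -> E x' -> `|u x - u x'| <= L * enorm (x - x')) /\
  (forall e, 0 < e -> U [set m | forall x, E x -> `|u_ m x - u x| <= e]).
Proof.
move=> UU EM u_lip uU.
have lip x x' : E x -> E x' -> `|u x - u x'| <= L * enorm (x - x').
  move=> Ex Ex'; apply/ler_addgt0Pr => e e0; have e2 : 0 < e / 2 by rewrite divr_gt0.
  have [m /= [h1 h2]] := filter_ex (filterI (uU x Ex _ e2) (uU x' Ex' _ e2)).
  have := u_lip m _ _ Ex Ex'; move: h1 h2.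
  rewrite !ltr_norml !ler_norml => /andP[? ?] /andP[? ?] /andP[? ?]; lra.
split=> // e e0.
have s0 : 0 < 3 * L * (d%:R + 1) / e by rewrite divr_gt0// !mulr_gt0// ltr_wpDl.
have [zs [_ zsE zsnet]] := finite_net M0 s0 EM.
have e3 : 0 < e / 3 by rewrite divr_gt0.
have Uzs : U [set m | forall z, z \in zs -> `|u_ m z - u z| < e / 3].
  elim: zs zsE {zsnet} => [|z zs ih] zsE.
    by apply: filterS filterT => m _ z.
  have Uz := uU z (zsE z (mem_head _ _)) _ e3.
  have {}ih := ih (fun y yz => zsE y (mem_behead (s := z :: zs) yz)).
  apply: filterS (filterI Uz ih) => m [/= h1 h2] y.
  by rewrite inE => /predU1P[->//|]; exact: h2.
apply: filterS Uzs => m /= mzs x Ex; have [z zzs xz] := zsnet x Ex.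
have Lz : L * enorm (x - z) <= e / 3.
  apply: (@le_trans _ _ (L * (d%:R / (3 * L * (d%:R + 1) / e)))).
    by rewrite ler_pM2l.
  have d1 : 0 < d%:R + 1 :> R by rewrite ltr_wpDl.
  have -> : L * (d%:R / (3 * L * (d%:R + 1) / e)) = e / 3 * (d%:R / (d%:R + 1)).
    by field; rewrite !lt0r_neq0.
  by rewrite ler_piMr ?(ltW e3)// ler_pdivrMr// mul1r lerDl.
have := u_lip m _ _ Ex (zsE _ zzs); have := lip _ _ Ex (zsE _ zzs); have := mzs _ zzs.
rewrite !ltr_norml !ler_norml => /andP[? ?] /andP[? ?] /andP[? ?]; apply/andP; split; lra.
Qed.


(** Weak convergence is applied only to the limiting integrand [F], which is Lipschitz on [E]; along
    the ultrafilter the integrands before the limit are uniformly close to it, since [psi1] is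
    Lipschitz on bounded sets. *)
Lemma limit_marginal (U : set_system nat) (E : set 'rV[R]_d) (mu : probability 'rV[R]_d R)
    (n_ : nat -> nat) (y_ : nat -> nat -> 'rV[R]_d) (a_ : nat -> R) (a : R)
    (g_ : nat -> 'rV[R]_d -> R) (g k F : 'rV[R]_d -> R) :
  UltraFilter U -> \oo `<=` U -> bounded_measurable F ->
  (forall y, E y -> F y = psi1 ((a + g y - k y) / eps)) ->
  (forall m, (0 < n_ m)%N) -> (forall m i, E (y_ m i)) ->
  (forall F, lipschitz_test E F -> forall e, 0 < e -> exists m0, forall m, (m0 <= m)%N ->
      `|avg (fun i : 'I_(n_ m) => F (y_ m i)) - \int[mu]_x F x| <= e) ->
  (forall m, `|a_ m| <= B) -> `|a| <= B ->
  (forall m y, E y -> `|g_ m y| <= B) -> (forall y, E y -> `|g y| <= B) ->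
  (forall y, E y -> `|k y| <= B) ->
  (forall x x', E x -> E x' -> `|g x - g x'| <= L * enorm (x - x')) ->
  (forall x x', E x -> E x' -> `|k x - k x'| <= L * enorm (x - x')) ->
  (forall e, 0 < e -> U [set m | `|a_ m - a| < e]) ->
  (forall e, 0 < e -> U [set m | forall y, E y -> `|g_ m y - g y| <= e]) ->
  (forall m, avg (fun j : 'I_(n_ m) => psi1 ((a_ m + g_ m (y_ m j) - k (y_ m j)) / eps)) = 1) ->
  \int[mu]_y F y = 1.
Proof.
move=> UU ooU bF FE n0 yE weak a_B aB g_B gB kB g_lip k_lip Ua Ug row.
have [A A0 psiA] := psi1_lipschitz psi2P (3 * B / eps).
have hB u v w : `|u| <= B -> `|v| <= B -> `|w| <= B -> `|(u + v - w) / eps| <= 3 * B / eps.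
  move=> uB vB wB; rewrite normrM [`|eps^-1|]gtr0_norm ?invr_gt0// ler_pM2r ?invr_gt0//.
  by move: uB vB wB; rewrite !ler_norml => /andP[? ?] /andP[? ?] /andP[? ?]; lra.
have psi_diff u v w u' v' w' r : `|u| <= B -> `|v| <= B -> `|w| <= B ->
    `|u'| <= B -> `|v'| <= B -> `|w'| <= B -> `|(u + v - w) - (u' + v' - w')| <= r ->
    `|psi1 ((u + v - w) / eps) - psi1 ((u' + v' - w') / eps)| <= A * (r / eps).
  move=> ? ? ? ? ? ? dr; apply: (le_trans (psiA _ _ (hB _ _ _ _ _ _) (hB _ _ _ _ _ _))) => //.
  by rewrite ler_wpM2l// -mulrBl normrM [`|eps^-1|]gtr0_norm ?invr_gt0// ler_pM2r ?invr_gt0.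
have testF : lipschitz_test E F.
  split=> //; exists (A * (2 * L / eps)); first by rewrite !mulr_ge0// ?invr_ge0 ltW.
  move=> x y Ex Ey; rewrite !FE//.
  apply: (@le_trans _ _ (A * (2 * L * enorm (x - y) / eps))); last by rewrite -!mulrA [enorm _
    / _]mulrC.
  apply: psi_diff => //; [exact: gB|exact: kB|exact: gB|exact: kB|].
  have := g_lip _ _ Ex Ey; have := k_lip _ _ Ex Ey.
  by rewrite !ler_norml => /andP[? ?] /andP[? ?]; apply/andP; split; lra.
apply/eqP; rewrite -subr_eq0 -normr_le0 distrC; apply/ler_addgt0Pr => e e0; rewrite add0r.
have e2 : 0 < e / 2 by rewrite divr_gt0.
have eta0 : 0 < e * eps / (4 * (A + 1)) by rewrite divr_gt0 ?mulr_gt0// ltr_wpDl.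
have [m0 m0P] := weak F testF _ e2.
have Um0 : U [set m | (m0 <= m)%N] by apply: ooU; exists m0.
have [m /= [[h1 h2] h3]] := filter_ex (filterI (filterI (Ua _ eta0) (Ug _ eta0)) Um0).
have h4 := m0P m h3.
have h5 : `|1 - avg (fun i : 'I_(n_ m) => F (y_ m i))| <= e / 2.
  rewrite -[X in `|X - _|](row m) -avgB; apply: norm_avg_le => // i; have Ey := yE m i.
  rewrite FE//; apply: (@le_trans _ _ (A * (2 * (e * eps / (4 * (A + 1))) / eps))).
    apply: psi_diff => //; [exact: g_B|exact: kB|exact: gB|exact: kB|].
    have := h2 _ Ey; move: h1; rewrite !ltr_norml !ler_norml => /andP[? ?] /andP[? ?].
    by apply/andP; split; lra.
  have A1 : 0 < A + 1 by rewrite ltr_wpDl.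
  have -> : A * (2 * (e * eps / (4 * (A + 1))) / eps) = e / 2 * (A / (A + 1)).
    by field; rewrite !lt0r_neq0.
  by rewrite ler_piMr ?(ltW e2)// ler_pdivrMr// mul1r lerDl.
have := ler_distD (avg (fun i : 'I_(n_ m) => F (y_ m i))) 1 (\int[mu]_x F x).
lra.
Qed.

End potentials_limit.

(** * Population potentials *)

Section population_potentials.
Context {dS} {S : measurableType dS} {R : realType} {d : nat}.
Variables (Pr : probability S R) (P Q : probability 'rV[R]_d R).
Variables (X Y : nat -> S -> 'rV[R]_d).
Hypotheses (mX : forall i, measurable_fun setT (X i))
  (mY : forall j, measurable_fun setT (Y j)).
Hypotheses (X_law : forall i A, measurable A -> Pr (X i @^-1` A) = P A)
  (Y_law : forall j A, measurable A -> Pr (Y j @^-1` A) = Q A).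
Hypothesis XY_indep : mutually_independent Pr
  (fun k : nat + nat => match k with inl i => X i | inr j => Y j end).
Variables (phi psi2 : R -> R) (delta t : R).
Hypothesis phi_reg : regularization phi delta t.
Hypothesis psi2P : nondecreasing_second_derivative (convex_conj phi) psi2.
Hypothesis psi2_gt0 : 0 < psi2 (t - delta).
Local Notation psi1 := (derive1 (convex_conj phi)).
Local Notation Omega := (msupport P).
Local Notation Omega' := (msupport Q).
Variables (c : 'rV[R]_d -> 'rV[R]_d -> R) (L Cc Dx M eps : R).
Hypotheses (L_gt0 : 0 < L) (eps_gt0 : 0 < eps) (c_lip : cost_lipschitz Omega Omega' L c).
Hypothesis c_bound : forall x y, Omega x -> Omega' y -> `|c x y| <= Cc.
Hypothesis Omega_diam : forall x x', Omega x -> Omega x' -> enorm (x - x') <= Dx.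
Hypotheses (M0 : 0 <= M) (OM : forall x i, Omega x -> `|x ord0 i| <= M)
  (OM' : forall x i, Omega' x -> `|x ord0 i| <= M).
Hypothesis empirical_ex : forall n (xs ys : n.-tuple 'rV[R]_d), (0 < n)%N ->
  (forall i, Omega (tnth xs i)) -> (forall j, Omega' (tnth ys j)) ->
  exists f g, potentials Omega Omega' c (convex_conj phi) eps
    (empirical xs) (empirical ys) f g.

Definition cost_ext := (fun z => c z.1 z.2) \_ (Omega `*` Omega').

Lemma cost_extE x y : Omega x -> Omega' y -> cost_ext (x, y) = c x y.
Proof. by move=> Ox Oy; rewrite /cost_ext patchE in_setX !mem_set. Qed.

Lemma bm_cost_ext : bounded_measurable cost_ext.
Proof.
have mO := measurable_msupport P; have mO' := measurable_msupport Q.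
apply: bm_restrict; first exact: measurableX.
  apply: (measurable_lipschitz2 mO mO' (ltW L_gt0)) => x1 x2 y1 y2.
  exact: (cost_lip L_gt0 c_lip).
by exists Cc => -[x y] /= [Ox Oy]; exact: c_bound.
Qed.

Lemma population_potentials : exists f g : 'rV[R]_d -> R,
  [/\ bounded_measurable f /\ bounded_measurable g,
    forall x, Omega x -> `|f x| <= L * Dx,
    forall y, Omega' y -> `|g y| <= eps * `|t| + Cc + L * Dx,
    forall x, Omega x -> \int[Q]_y psi1 ((f x + g y - cost_ext (x, y)) / eps) = 1 &
    forall y, Omega' y -> \int[P]_x psi1 ((f x + g y - cost_ext (x, y)) / eps) = 1].
Proof.
have mO := measurable_msupport P; have mO' := measurable_msupport Q.
have [n_ [w_ [n0 xO yO x_weak y_weak]]] := weak_samples mX mY X_law Y_law XY_indep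
  mO mO' (msupport_full P) (msupport_full Q) M0 OM OM'.
pose xs m := sample X (n_ m) (w_ m); pose ys m := sample Y (n_ m) (w_ m).
have xsE m i : tnth (xs m) i = X i (w_ m) by rewrite tnth_mktuple.
have ysE m i : tnth (ys m) i = Y i (w_ m) by rewrite tnth_mktuple.
have xsO m i : Omega (tnth (xs m) i) by rewrite xsE.
have ysO m i : Omega' (tnth (ys m) i) by rewrite ysE.
have /choice[fg_ fgP] : forall m, exists fg : ('rV[R]_d -> R) * ('rV[R]_d -> R),
    potentials Omega Omega' c (convex_conj phi) eps (empirical (xs m)) (empirical (ys m)) fg.1 fg.2.
  by move=> m; have [f [g fgP]] := empirical_ex (n0 m) (xsO m) (ysO m); exists (f, g).
pose f_ m := (fg_ m).1; pose g_ m := (fg_ m).2.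
have [x0 Ox0] := msupport_nonempty P; have [y0 Oy0] := msupport_nonempty Q.
have Cc0 : 0 <= Cc by exact: le_trans (normr_ge0 _) (c_bound Ox0 Oy0).
have et0 : 0 <= eps * `|t| by rewrite mulr_ge0// ltW.
have f_B m x : Omega x -> `|f_ m x| <= L * Dx.
  exact: (pot_bound1 phi_reg psi2P psi2_gt0 mO mO' L_gt0 c_lip c_bound Omega_diam (n0 m)
    eps_gt0 (xsO m) (ysO m) (fgP m)).
have g_B m y : Omega' y -> `|g_ m y| <= eps * `|t| + Cc + L * Dx.
  exact: (pot_bound2 phi_reg psi2P psi2_gt0 mO mO' L_gt0 c_lip c_bound Omega_diam (n0 m)
    eps_gt0 (xsO m) (ysO m) (fgP m)).
have f_lip m x x' : Omega x -> Omega x' -> `|f_ m x - f_ m x'| <= L * enorm (x - x').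
  exact: (pot_lip1 phi_reg psi2P psi2_gt0 mO' L_gt0 c_lip c_bound (n0 m) eps_gt0 (ysO m) (fgP m)).
have g_lip m y y' : Omega' y -> Omega' y' -> `|g_ m y - g_ m y'| <= L * enorm (y - y').
  exact: (pot_lip2 phi_reg psi2P psi2_gt0 mO L_gt0 c_lip c_bound (n0 m) eps_gt0 (xsO m) (fgP m)).
have row m x : Omega x ->
    avg (fun j : 'I_(n_ m) => psi1 ((f_ m x + g_ m (Y j (w_ m)) - c x (Y j (w_ m))) / eps)) = 1.
  move=> Ox; rewrite -[RHS](pot_row phi_reg mO' L_gt0 c_lip c_bound (n0 m) eps_gt0 (ysO m) (fgP
    m) Ox).
  by apply: eq_avg => j; rewrite ysE.
have col m y : Omega' y ->
    avg (fun i : 'I_(n_ m) => psi1 ((f_ m (X i (w_ m)) + g_ m y - c (X i (w_ m)) y) / eps)) = 1.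
  move=> Oy; rewrite -[RHS](pot_col phi_reg mO L_gt0 c_lip c_bound (n0 m) eps_gt0 (xsO m) (fgP
    m) Oy).
  by apply: eq_avg => j; rewrite xsE.
(* An ultrafilter finer than [\oo] stands in for the extraction of a convergent subsequence: limits
   along it exist at all points simultaneously. *)
have [U [UU ooU]] := @ultraFilterLemma nat \oo _.
have /choice[f fU] : forall x, exists l, Omega x -> forall e, 0 < e -> U [set m | `|f_ m x - l|
  < e].
  move=> x; have [Ox|nOx] := pselect (Omega x); last by exists 0.
  by have [l lP] := ultra_lim UU (fun m => f_B m x Ox); exists l.
have /choice[g gU] : forall y, exists l, Omega' y -> forall e, 0 < e -> U [set m | `|g_ m y -
  l| < e].
  move=> y; have [Oy|nOy] := pselect (Omega' y); last by exists 0.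
  by have [l lP] := ultra_lim UU (fun m => g_B m y Oy); exists l.
have [flip fUU] := uniform_ultra_lim M0 L_gt0 UU OM f_lip fU.
have [glip gUU] := uniform_ultra_lim M0 L_gt0 UU OM' g_lip gU.
have lim_bound (u : nat -> R) l B : (forall m, `|u m| <= B) ->
    (forall e, 0 < e -> U [set m | `|u m - l| < e]) -> `|l| <= B.
  move=> uB ul; apply/ler_addgt0Pr => e e0; have [m /= me] := filter_ex (ul e e0).
  have := uB m; move: me; rewrite !ltr_norml !ler_norml => /andP[? ?] /andP[? ?].
  by apply/andP; split; lra.
have fB x : Omega x -> `|f x| <= L * Dx by move=> Ox; exact: lim_bound (fun m => f_B m x Ox)
  (fU x Ox).
have gB y : Omega' y -> `|g y| <= eps * `|t| + Cc + L * Dx.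
  by move=> Oy; exact: lim_bound (fun m => g_B m y Oy) (gU y Oy).
have LD0 : 0 <= L * Dx by exact: le_trans (normr_ge0 _) (fB _ Ox0).
pose B := eps * `|t| + Cc + L * Dx.
have fB' x : Omega x -> `|f x| <= B by move=> Ox; rewrite (le_trans (fB x Ox))// lerDr addr_ge0.
have f_B' m x : Omega x -> `|f_ m x| <= B.
  by move=> Ox; rewrite (le_trans (f_B m x Ox))// lerDr addr_ge0.
have cB x y : Omega x -> Omega' y -> `|c x y| <= B.
  by move=> Ox Oy; rewrite (le_trans (c_bound Ox Oy))// /B addrAC lerDr addr_ge0.
pose fO := f \_ Omega; pose gO := g \_ Omega'.
have bf : bounded_measurable fO.
  apply: bm_restrict => //; last by exists (L * Dx).
  exact: (measurable_lipschitz1 mO (ltW L_gt0)).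
have bg : bounded_measurable gO.
  apply: bm_restrict => //; last by exists B.
  exact: (measurable_lipschitz1 mO' (ltW L_gt0)).
have fE x : Omega x -> fO x = f x by move=> Ox; rewrite /fO patchE mem_set.
have gE y : Omega' y -> gO y = g y by move=> Oy; rewrite /gO patchE mem_set.
have bF : bounded_measurable
    (fun z : 'rV[R]_d * 'rV[R]_d => psi1 ((fO z.1 + gO z.2 - cost_ext z) / eps)).
  apply: (bm_real_comp (measurable_psi1 phi_reg) (psi1_bounded phi_reg)).
  apply: bmM; last exact: bm_cst.
  by apply: bmB; [apply: bmD; exact: bm_comp|exact: bm_cost_ext].
clearbody fO gO; exists fO, gO; split=> //.
- by move=> x Ox; rewrite fE// fB.
- by move=> x Ox; rewrite gE// gB.
- move=> x Ox.
  apply: (limit_marginal psi2P L_gt0 eps_gt0 UU ooU (bm_pair1 x bF) _ n0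
    yO y_weak (fun m => f_B' m x Ox) (fB' x Ox)
    g_B gB (k := c x) (fun y Oy => cB x y Ox Oy) glip
    (fun y y' Oy Oy' => cost_lip2 L_gt0 c_lip Ox Oy Oy') (fU x Ox) gUU (fun m => row m x Ox)).
  by move=> y Oy /=; rewrite fE// gE// cost_extE.
- move=> y Oy.
  (* [limit_marginal] freezes the first summand, so the column equation is read with the roles of
     the two potentials exchanged. *)
  have row' m : avg (fun i : 'I_(n_ m) =>
      psi1 ((g_ m y + f_ m (X i (w_ m)) - c (X i (w_ m)) y) / eps)) = 1.
    by rewrite -(col m y Oy); apply: eq_avg => i; rewrite [g_ m y + _]addrC.
  apply: (limit_marginal psi2P L_gt0 eps_gt0 UU ooU (bm_pair2 y bF) _ n0
    xO x_weak (fun m => g_B m y Oy) (gB y Oy)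
    f_B' fB' (k := c ^~ y) (fun x Ox => cB x y Ox Oy) flip
    (fun x x' Ox Ox' => cost_lip1 L_gt0 c_lip Ox Ox' Oy) (gU y Oy) fUU row').
  by move=> x Ox /=; rewrite fE// gE// cost_extE// [f x + _]addrC.
Qed.

End population_potentials.

(** * The duality gap of a sample *)

Section duality_gap.
Context {R : realType} {d n : nat}.
Variables (phi psi2 : R -> R) (delta t : R).
Hypothesis phi_reg : regularization phi delta t.
Hypothesis psi2P : nondecreasing_second_derivative (convex_conj phi) psi2.
Hypothesis psi2_gt0 : 0 < psi2 (t - delta).
Local Notation psi := (convex_conj phi).
Local Notation psi1 := (derive1 (convex_conj phi)).
Local Notation k := (psi2 (t - delta)).
Hypothesis n_gt0 : (0 < n)%N.
Variables (eps B0 : R) (f g fh gh : 'I_n -> R) (c : 'I_n -> 'I_n -> R).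
Hypotheses (eps_gt0 : 0 < eps) (eps_le1 : eps <= 1).
Hypotheses (f_B : forall i, `|f i| <= B0) (g_B : forall i, `|g i| <= B0)
  (fh_B : forall i, `|fh i| <= B0) (gh_B : forall i, `|gh i| <= B0).
Local Notation h i j := ((f i + g j - c i j) / eps).
Local Notation hh i j := ((fh i + gh j - c i j) / eps).
Hypotheses (row : forall i, avg (fun j => psi1 (hh i j)) = 1)
  (col : forall j, avg (fun i => psi1 (hh i j)) = 1).

(** Up to the factor [1 / n], the partial derivative of [discrete_dual] in the potential at point
    [i]; the marginal equations of [(fh, gh)] say that it vanishes there. *)
Definition dual_grad1 i := 1 - avg (fun j => psi1 (h i j)).
Definition dual_grad2 j := 1 - avg (fun i => psi1 (h i j)).

Definition discrete_dual (u v : 'I_n -> R) : R :=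
  avg u + avg v - eps * avg (fun i => avg (fun j => psi ((u i + v j - c i j) / eps))).

Let gx := dual_grad1.
Let gy := dual_grad2.
(* The dual is invariant under [(u - m, v + m)]: the shift makes [a] centred, which
   the Poincare inequality needs, and changes neither [a i + b j] nor the gap. *)
Let mean_a := avg (fun i => fh i - f i).
Let a i := (fh i - f i) - mean_a.
Let b j := (gh j - g j) + mean_a.

Definition gap_bound : R := avg (fun i => gx i * a i) + avg (fun j => gy j * b j).

Let hhE i j : hh i j - h i j = (a i + b j) / eps.
Proof. by rewrite -mulrBl; congr (_ / _); rewrite /a /b; ring. Qed.

(** Each 1 in the gradient is rewritten as the average of [psi1 (hh i j)]; the pairing becomes an
    average of increments of [psi1] times the increments of its argument, up to [eps], and is thus
    made of nonnegative terms. *)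
Let gap_boundE : gap_bound = avg (fun i => avg (fun j => (psi1 (hh i j) - psi1 (h i j)) * (a i
  + b j))).
Proof.
have e1 i : gx i * a i = avg (fun j => (psi1 (hh i j) - psi1 (h i j)) * a i).
  by under [RHS]eq_avg do rewrite mulrC; rewrite avgZ avgB row mulrC.
have e2 j : gy j * b j = avg (fun i => (psi1 (hh i j) - psi1 (h i j)) * b j).
  by under [RHS]eq_avg do rewrite mulrC; rewrite avgZ avgB col mulrC.
rewrite /gap_bound (eq_avg e1) (eq_avg e2) [X in _ + X]exchange_avg -avgD.
by apply: eq_avg => i; rewrite -avgD; apply: eq_avg => j; rewrite [RHS]mulrDr.
Qed.

Lemma duality_gap_le : discrete_dual fh gh - discrete_dual f g <= gap_bound.
Proof.
have tan i j : psi (h i j) + psi1 (h i j) * ((a i + b j) / eps) <= psi (hh i j).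
  rewrite -hhE; apply: conj_tangent; [exact: (reg_convex phi_reg)|exact: (reg_growth
    phi_reg)|exact: (reg_derivable phi_reg)].
have step : avg (fun i => avg (fun j => psi (h i j))) +
    eps^-1 * avg (fun i => avg (fun j => psi1 (h i j) * (a i + b j))) <=
    avg (fun i => avg (fun j => psi (hh i j))).
  rewrite -avgZ -avgD; apply: le_avg => // i; rewrite -avgZ -avgD; apply: le_avg => // j.
  by apply: le_trans (tan i j); rewrite lerD2l [eps^-1 * _]mulrC -mulrA.
have {}step : eps * avg (fun i => avg (fun j => psi (h i j))) +
    avg (fun i => avg (fun j => psi1 (h i j) * (a i + b j))) <=
    eps * avg (fun i => avg (fun j => psi (hh i j))).
  rewrite -(ler_pM2l eps_gt0) in step; apply: le_trans step.
  by rewrite mulrDr mulVKf ?lt0r_neq0.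
have ga : avg (fun i => avg (fun j => a i + b j)) = avg fh + avg gh - (avg f + avg g).
  under eq_avg do rewrite avgD avg_cst//.
  rewrite avgD avg_cst//.
  have -> : avg a = avg fh - avg f - mean_a.
    by rewrite (avgB (fun i => fh i - f i)) avgB avg_cst.
  have -> : avg b = avg gh - avg g + mean_a.
    by rewrite (avgD (fun i => gh i - g i)) avgB avg_cst.
  ring.
have e : gap_bound = avg (fun i => avg (fun j => a i + b j)) -
    avg (fun i => avg (fun j => psi1 (h i j) * (a i + b j))).
  rewrite gap_boundE.
  have -> : avg (fun i => avg (fun j => a i + b j)) =
      avg (fun i => avg (fun j => psi1 (hh i j) * (a i + b j))).
    transitivity (avg (fun i => avg (fun j => psi1 (hh i j) * a i)) +
      avg (fun i => avg (fun j => psi1 (hh i j) * b j))).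
      rewrite [X in _ = _ + X]exchange_avg.
      under eq_avg do rewrite avgD avg_cst//.
      rewrite avgD avg_cst//; congr (_ + _); apply: eq_avg => i.
        by under eq_avg do rewrite mulrC; rewrite avgZ row mulr1.
      by under eq_avg do rewrite mulrC; rewrite avgZ col mulr1.
    by rewrite -avgD; apply: eq_avg => i; rewrite -avgD; apply: eq_avg => j; rewrite [RHS]mulrDr.
  by rewrite -avgB; apply: eq_avg => i; rewrite -avgB; apply: eq_avg => j; rewrite mulrBl.
rewrite /discrete_dual e ga; lra.
Qed.

Let ab_B i j : `|a i + b j| <= 4 * B0.
Proof.
have -> : a i + b j = fh i - f i + (gh j - g j) by rewrite /a /b; ring.
have := f_B i; have := g_B j; have := fh_B i; have := gh_B j.
by rewrite !ler_norml => /andP[? ?] /andP[? ?] /andP[? ?] /andP[? ?]; apply/andP; split; lra.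
Qed.

Let mean_B : `|mean_a| <= 2 * B0.
Proof.
apply: norm_avg_le => // i; have := f_B i; have := fh_B i.
by rewrite !ler_norml => /andP[? ?] /andP[? ?]; apply/andP; split; lra.
Qed.

Let a_B i : `|a i| <= 4 * B0.
Proof.
have := f_B i; have := fh_B i; have := mean_B; rewrite /a.
by rewrite !ler_norml => /andP[? ?] /andP[? ?] /andP[? ?]; apply/andP; split; lra.
Qed.

Let b_B j : `|b j| <= 4 * B0.
Proof.
have := g_B j; have := gh_B j; have := mean_B; rewrite /b.
by rewrite !ler_norml => /andP[? ?] /andP[? ?] /andP[? ?]; apply/andP; split; lra.
Qed.

Definition grad_norm2 : R := avg (fun i => gx i ^+ 2) + avg (fun j => gy j ^+ 2).

(** [u * v <= tau * u ^ 2 + v ^ 2 / (4 * tau)] with [|v| <= 4 * B0], for both sums; the constant is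
    twice [16 / 4]. *)
Lemma gap_bound_crude tau : 0 < tau -> gap_bound <= tau * grad_norm2 + 8 * B0 ^+ 2 / tau.
Proof.
move=> tau0; have am (u v : R) : `|v| <= 4 * B0 -> u * v <= tau * u ^+ 2 + 4 * B0 ^+ 2 / tau.
  move=> vB; have v2 : v ^+ 2 <= (4 * B0) ^+ 2.
    by rewrite -(real_normK (num_real v)) lerXn2r// nnegrE ?normr_ge0// (le_trans _ vB).
  have := sqr_ge0 (2 * tau * u - v).
  have -> : tau * u ^+ 2 + 4 * B0 ^+ 2 / tau = (tau ^+ 2 * u ^+ 2 + 4 * B0 ^+ 2) / tau.
    by field; rewrite lt0r_neq0.
  rewrite ler_pdivlMr//; rewrite !expr2 in v2 *; lra.
have h1 : avg (fun i => gx i * a i) <= tau * avg (fun i => gx i ^+ 2) + 4 * B0 ^+ 2 / tau.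
  by rewrite -avgZ -[4 * _ / _](avg_cst n_gt0) -avgD; apply: le_avg => // i; exact: am.
have h2 : avg (fun i => gy i * b i) <= tau * avg (fun i => gy i ^+ 2) + 4 * B0 ^+ 2 / tau.
  by rewrite -avgZ -[4 * _ / _](avg_cst n_gt0) -avgD; apply: le_avg => // i; exact: am.
rewrite /gap_bound /grad_norm2 mulrDr.
have -> : 8 * B0 ^+ 2 / tau = 4 * B0 ^+ 2 / tau + 4 * B0 ^+ 2 / tau by ring.
lra.
Qed.

Variable c1 : R.
Hypotheses (c1P : 0 < c1 <= 1) (c1_delta : c1 * (4 * B0) <= delta / 4).

Definition active i j : bool := t - 3 * delta / 4 <= hh i j.

(** On active pairs [psi1_monotone_quadratic] is used with the fraction [c1 * eps]: the argument of
    [psi1] moves by at most [4 * B0 / eps], so this fraction of it is at most [delta / 4], and the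
    powers of [eps] cancel. Inactive pairs contribute nonnegative terms. *)
Lemma gap_bound_ge :
  k * c1 * avg (fun i => avg (fun j => (active i j)%:R * (a i + b j) ^+ 2)) <= gap_bound.
Proof.
have [c10 c11] := andP c1P.
rewrite gap_boundE -avgZ; apply: le_avg => // i; rewrite -avgZ; apply: le_avg => // j.
have mono : 0 <= (psi1 (hh i j) - psi1 (h i j)) * (a i + b j).
  have [ab|ab] := leP 0 (a i + b j).
    rewrite mulr_ge0// subr_ge0; apply: (psi1_homo phi_reg).
    by rewrite -subr_ge0 hhE divr_ge0// ltW.
  rewrite mulr_le0 ?(ltW ab)// subr_le0; apply: (psi1_homo phi_reg).
  by rewrite -subr_le0 hhE pmulr_lle0 ?invr_gt0// ltW.
have [act|_] := boolP (active i j); last by rewrite mul0r mulr0.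
rewrite mul1r; have := psi1_monotone_quadratic phi_reg psi2P psi2_gt0 (c := c1 * eps)
  (a := hh i j) (b := h i j) _ act.
rewrite hhE => /(_ ltac:(by rewrite mulr_gt0//= mulr_ile1// ltW)).
have -> : c1 * eps * `|(a i + b j) / eps| = c1 * `|a i + b j|.
  by rewrite normrM [`|eps^-1|]gtr0_norm ?invr_gt0//; field; rewrite lt0r_neq0.
move=> /(_ ltac:(by apply: le_trans c1_delta; rewrite ler_pM2l)).
have -> : k * (c1 * eps) * ((a i + b j) / eps) ^+ 2 = (k * c1 * (a i + b j) ^+ 2) / eps.
  by field; rewrite lt0r_neq0.
by rewrite [X in _ <= X -> _]mulrA ler_pM2r ?invr_gt0.
Qed.

Lemma gap_bound_le_grad (Kp p gam : R) : 0 < p -> 0 <= Kp -> 0 <= gam ->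
  (forall a b : 'I_n -> R, avg (fun i => avg (fun i' => (a i - a i') ^+ 2)) <=
     Kp * avg (fun i => avg (fun j => (active i j)%:R * (a i + b j) ^+ 2))) ->
  (forall j, p <= avg (fun i => (active i j)%:R)) ->
  (forall i, k * avg (fun j => (active i j)%:R) <= gam) ->
  gap_bound <= (Kp * (1 + 2 * gam / (k * p)) + 2 / p) / (k * c1) * grad_norm2.
Proof.
move=> p0 Kp0 gam0 poin massE degE; have [c10 _] := andP c1P.
apply: (gradient_domination n_gt0 p0 psi2_gt0 (mulr_gt0 psi2_gt0 c10) Kp0 gam0 _ (poin a b)) => //.
- by rewrite /a avgB avg_cst// subrr.
- exact: gap_bound_ge.
Qed.

End duality_gap.

Section good_sample.
Context {R : realType} {d : nat}.
Variables (phi psi2 : R -> R) (delta t : R).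
Hypothesis phi_reg : regularization phi delta t.
Hypothesis psi2P : nondecreasing_second_derivative (convex_conj phi) psi2.
Hypothesis psi2_gt0 : 0 < psi2 (t - delta).
Local Notation k := (psi2 (t - delta)).
Variables (Omega Omega' : set 'rV[R]_d) (c : 'rV[R]_d -> 'rV[R]_d -> R) (L Cc : R).
Hypotheses (mOmega : measurable Omega) (mOmega' : measurable Omega').
Hypotheses (L_gt0 : 0 < L) (c_lip : cost_lipschitz Omega Omega' L c).
Hypothesis c_bound : forall x y, Omega x -> Omega' y -> `|c x y| <= Cc.
Hypothesis Omega_convex : convex_set Omega.
Variables (n : nat) (xs ys : n.-tuple 'rV[R]_d) (eps : R).
Hypotheses (n_gt0 : (0 < n)%N) (eps_gt0 : 0 < eps).
Hypotheses (xsO : forall i, Omega (tnth xs i)) (ysO : forall j, Omega' (tnth ys j)).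
Variables (f g : 'rV[R]_d -> R).
Hypothesis fgP : potentials Omega Omega' c (convex_conj phi) eps
  (empirical xs) (empirical ys) f g.
Local Notation x_ i := (tnth xs i).
Local Notation y_ j := (tnth ys j).
Local Notation h x y := ((f x + g y - c x y) / eps).
Local Notation act := (active delta t eps (fun i => f (x_ i)) (fun j => g (y_ j))
  (fun i j => c (x_ i) (y_ j))).
Variables (rad p q pbar gam : R) (N : nat).
Hypotheses (radE : rad = delta * eps / (16 * L)) (p_gt0 : 0 < p) (q_gt0 : 0 < q)
  (N_gt0 : (0 < N)%N).
Hypothesis mass_p : forall z, Omega z -> p <= avg (fun i => (\1_(eball z rad) (x_ i) : R)).
Hypothesis mass_q : forall y, Omega' y -> q <= avg (fun j => (\1_(eball y (4 * rad)) (y_ j) : R)).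
Hypothesis mass_pbar : forall w, avg (fun i => (\1_(eball w (4 * rad)) (x_ i) : R)) <= pbar.
Hypothesis diam : forall x x', Omega x -> Omega x' -> enorm (x - x') < N%:R * rad.
Hypothesis degree : forall i, avg (fun j => psi2 (h (x_ i) (y_ j) + delta / 4)) <= gam.

Let delta0 := reg_delta_gt0 phi_reg.

Let rad0 : 0 < rad.
Proof. by rewrite radE divr_gt0// mulr_gt0. Qed.

Let Lrad : L / eps * rad = delta / 16.
Proof. by rewrite radE; field; rewrite !lt0r_neq0. Qed.

Let row_ex x : Omega x -> exists j, t <= h x (y_ j).
Proof.
move=> Ox; apply: (avg_psi1_ex_ge phi_reg psi2P psi2_gt0 n_gt0).
exact: (pot_row phi_reg mOmega' L_gt0 c_lip c_bound n_gt0 eps_gt0 ysO fgP Ox).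
Qed.

Let col_ex y : Omega' y -> exists i, t <= h (x_ i) y.
Proof.
move=> Oy; apply: (avg_psi1_ex_ge phi_reg psi2P psi2_gt0 n_gt0).
exact: (pot_col phi_reg mOmega L_gt0 c_lip c_bound n_gt0 eps_gt0 xsO fgP Oy).
Qed.

(** The origin of [rad]: over a distance [6 * rad] a function of Lipschitz constant [2 * L / eps]
    changes by at most [12 * delta / 16 = 3 * delta / 4]. The 6 is [2 * rad] in [x] plus [4 * rad]
    in [y]. *)
Let h_near x x' y y' : Omega x -> Omega x' -> Omega' y -> Omega' y' ->
  enorm (x - x') + enorm (y - y') < 6 * rad -> t <= h x' y' -> t - 3 * delta / 4 <= h x y.
Proof.
move=> Ox Ox' Oy Oy' near6 tx'.
have := pot_h_lip phi_reg psi2P psi2_gt0 mOmega mOmega' L_gt0 c_lip c_bound n_gt0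
  eps_gt0 xsO ysO fgP Ox Ox' Oy Oy'.
have : 2 * L / eps * (enorm (x - x') + enorm (y - y')) <= 3 * delta / 4.
  apply: (@le_trans _ _ (2 * L / eps * (6 * rad))).
    by rewrite ler_wpM2l ?(ltW near6)// divr_ge0// ?mulr_ge0// ltW.
  have -> : 2 * L / eps * (6 * rad) = 12 * (L / eps * rad) by ring.
  by rewrite Lrad; lra.
rewrite ler_norml => h1 /andP[h2 h3]; lra.
Qed.

Lemma active_mass j : p <= avg (fun i => (act i j)%:R).
Proof.
have [i0 ti0] := col_ex (ysO j); apply: (le_trans (mass_p (xsO i0))).
apply: le_avg => // i; rewrite indicE ler_nat.
have [/set_mem xi|] := boolP (_ \in _); last by [].
have -> // : act i j.
apply: h_near (xsO i) (xsO i0) (ysO j) (ysO j) _ ti0.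
by rewrite subrr enorm0 addr0 (lt_le_trans xi)//; have := rad0; lra.
Qed.

(** For an active pair the argument shifted by [delta / 4] is at least [t - delta / 2], hence its
    [psi2] is at least [psi2 (t - delta)]; the other pairs contribute nonnegatively to [degree]. *)
Lemma active_degree i : k * avg (fun j => (act i j)%:R) <= gam.
Proof.
apply: le_trans (degree i); rewrite -avgZ; apply: le_avg => // j.
have := psi2_ge0 phi_reg psi2P (h (x_ i) (y_ j) + delta / 4).
have [aij _|_ h0] := boolP (act i j); last by rewrite mulr0.
rewrite mulr1; case: psi2P => _ _ _ homo _; apply: homo.
by move: aij; rewrite /active; have := delta0; lra.
Qed.

(** The active pairs are counted twice, from below by columns and from above by rows. *)
Lemma degree_ge : k * p <= gam.
Proof.
rewrite -[gam](avg_cst n_gt0) -[k * p](avg_cst n_gt0).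
apply: (@le_trans _ _ (k * avg (fun j => avg (fun i => (act i j)%:R)))).
  by rewrite -avgZ; apply: le_avg => // j; rewrite ler_pM2l// active_mass.
rewrite -exchange_avg -avgZ; apply: le_avg => // i; exact: active_degree.
Qed.

(** The implication sits inside the existential, with a default index outside [Omega], so that
    choice produces a total function. *)
Let y0_ex z : exists j, Omega z -> t <= h z (y_ j).
Proof.
have [Oz|nOz] := pselect (Omega z); last by exists (Ordinal n_gt0).
by have [j tj] := row_ex Oz; exists j.
Qed.

(** The cluster of [z] consists of the sample points within [4 * rad] of a partner [y_ (y0 z)] at
    which the argument is at least [t]; by [h_near] all its pairs with points near [z] are
    active. *)
Lemma active_poincare (a b : 'I_n -> R) :
  avg (fun i => avg (fun i' => (a i - a i') ^+ 2)) <=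
  36 * N%:R ^+ 2 * (pbar / (p * q)) *
  avg (fun i => avg (fun j => (act i j)%:R * (a i + b j) ^+ 2)).
Proof.
have /choice[y0 y0P] := y0_ex.
have indE (w : 'rV[R]_d) r v : (enorm (v - w) < r)%R%:R = \1_(eball w r) v :> R.
  rewrite indicE; have -> // : (v \in eball w r) = (enorm (v - w) < r)%R.
  by apply/idP/idP => [/set_mem|/mem_set].
apply: (chain_poincare n_gt0 (Omega := Omega) (x_ := fun i => x_ i) a b
  (C := fun z j => enorm (y_ j - y_ (y0 z)) < 4 * rad) N_gt0 rad0 p_gt0 q_gt0).
- by move=> i i' s s01; exact: convex_segment.
- by move=> z Oz; rewrite (eq_avg (fun i => indE z rad (x_ i))) mass_p.
- move=> z Oz; rewrite (eq_avg (fun j => indE (y_ (y0 z)) (4 * rad) (y_ j))).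
  exact: mass_q.
- move=> z i j Oz zi zj; apply: h_near (xsO i) Oz (ysO j) (ysO (y0 z)) _ (y0P z Oz).
  by move: zi zj; lra.
- by move=> w; rewrite (eq_avg (fun i => indE w (4 * rad) (x_ i))) mass_pbar.
- by move=> i i'; exact: diam.
Qed.

End good_sample.

(** * Chebyshev control of the empirical masses of balls *)

Section deviation.
Context {R : realType} {d : nat}.
Variables (P Q : probability 'rV[R]_d R).
Variables (rad p b q : R) (zs zs' : seq 'rV[R]_d).
Hypotheses (rad_gt0 : 0 < rad) (p_gt0 : 0 < p) (b_gt0 : 0 < b) (q_gt0 : 0 < q).
Hypotheses (P_ge : forall z, z \in zs -> 2 * p <= fine (P (eball z (rad / 2))))
  (P_le : forall z, fine (P (eball z (9 * rad))) <= b)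
  (Q_ge : forall z, z \in zs' -> 2 * q <= fine (Q (eball z (2 * rad)))).

Definition ball_dev {n} (mu : probability 'rV[R]_d R) (u : 'I_n -> 'rV[R]_d) w r : R :=
  avg (fun i => \1_(eball w r) (u i)) - fine (mu (eball w r)).

(* At least [1] on every sample whose balls do not have the expected masses: a
   Chebyshev surrogate for the indicator of the bad event. *)
Definition dev_sum {n} (x_ y_ : 'I_n -> 'rV[R]_d) : R :=
  \sum_(z <- zs) (p ^- 2 * ball_dev P x_ z (rad / 2) ^+ 2 +
                  b ^- 2 * ball_dev P x_ z (9 * rad) ^+ 2) +
  \sum_(y <- zs') 4 * fine (Q (eball y (2 * rad))) ^- 2 * ball_dev Q y_ y (2 * rad) ^+ 2.

Lemma dev_sum_ge0 n (x_ y_ : 'I_n -> 'rV[R]_d) : 0 <= dev_sum x_ y_.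
Proof.
have sq (u v : R) : 0 <= u ^- 2 * v ^+ 2 by rewrite mulr_ge0 ?invr_ge0 ?sqr_ge0.
apply: addr_ge0; apply: sumr_ge0 => z _; first by rewrite addr_ge0.
by rewrite -mulrA mulr_ge0.
Qed.

Section small_deviation.
Context {n : nat}.
Variables (x_ y_ : 'I_n -> 'rV[R]_d) (Omega Omega' : set 'rV[R]_d).
Hypotheses (n_gt0 : (0 < n)%N) (xO : forall i, Omega (x_ i)).
Hypotheses (net : forall x, Omega x -> exists2 z, z \in zs & enorm (x - z) <= rad / 2)
  (net' : forall y, Omega' y -> exists2 z, z \in zs' & enorm (y - z) <= 2 * rad).
Hypothesis small : dev_sum x_ y_ < 1.

Let lt1_norm (u v : R) : 0 < u -> u ^- 2 * v ^+ 2 < 1 -> `|v| < u.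
Proof.
move=> u0; rewrite mulrC ltr_pdivrMr ?exprn_gt0// mul1r => uv.
by rewrite -(@ltr_pXn2r _ 2) ?nnegrE ?(ltW u0)// real_normK ?num_real.
Qed.

Let small_zs z : z \in zs -> p ^- 2 * ball_dev P x_ z (rad / 2) ^+ 2 +
  b ^- 2 * ball_dev P x_ z (9 * rad) ^+ 2 < 1.
Proof.
move=> zzs; apply: le_lt_trans small; rewrite /dev_sum (big_rem z)//= -addrA lerDl.
have sq (u v : R) : 0 <= u ^- 2 * v ^+ 2 by rewrite mulr_ge0 ?invr_ge0 ?sqr_ge0.
apply: addr_ge0; apply: sumr_ge0 => y _; first by rewrite addr_ge0.
by rewrite -mulrA mulr_ge0.
Qed.

Let small_zs' z : z \in zs' ->
  4 * fine (Q (eball z (2 * rad))) ^- 2 * ball_dev Q y_ z (2 * rad) ^+ 2 < 1.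
Proof.
move=> zzs; apply: le_lt_trans small; rewrite /dev_sum [X in _ + X](big_rem z)//= addrCA lerDl.
have sq (u v : R) : 0 <= u ^- 2 * v ^+ 2 by rewrite mulr_ge0 ?invr_ge0 ?sqr_ge0.
apply: addr_ge0; apply: sumr_ge0 => y _; first by rewrite addr_ge0.
by rewrite -mulrA mulr_ge0.
Qed.

Let indic_le (A B : set 'rV[R]_d) v : (A v -> B v) -> \1_A v <= \1_B v :> R.
Proof.
move=> AB; rewrite !indicE ler_nat.
by have [/set_mem/AB/mem_set ->|] := boolP (v \in A).
Qed.

Lemma small_mass_p z : Omega z -> p <= avg (fun i => (\1_(eball z rad) (x_ i) : R)).
Proof.
move=> /net[w wzs zw].
apply: (@le_trans _ _ (avg (fun i => (\1_(eball w (rad / 2)) (x_ i) : R)))); last first.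
  apply: le_avg => // i; apply: indic_le; apply: sub_eball.
  by rewrite enorm_distC; lra.
have sq : 0 <= b ^- 2 * ball_dev P x_ w (9 * rad) ^+ 2.
  by rewrite mulr_ge0 ?invr_ge0 ?sqr_ge0.
have sm : p ^- 2 * ball_dev P x_ w (rad / 2) ^+ 2 < 1.
  by apply: le_lt_trans (small_zs wzs); rewrite lerDl.
have := lt1_norm p_gt0 sm; rewrite /ball_dev ltr_norml => /andP[h _].
by have := P_ge wzs; lra.
Qed.

(** The centre [w] is arbitrary. If its ball contains a sample point, a net point lies within
    [rad / 2] of that point, and the ball around the net point reaches [4 + 4 + 1 / 2 <= 9] radii;
    otherwise the average is zero. *)
Lemma small_mass_pbar w : avg (fun i => (\1_(eball w (4 * rad)) (x_ i) : R)) <= 2 * b.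
Proof.
have [[i iw]|none] := pselect (exists i, eball w (4 * rad) (x_ i)); last first.
  rewrite (eq_avg (G := fun=> 0)) ?avg_cst// ?mulr_ge0// ?ltW// => i.
  by rewrite indicE memNset// => iw; apply: none; exists i.
have [z zzs xz] := net (xO i).
apply: (@le_trans _ _ (avg (fun i => (\1_(eball z (9 * rad)) (x_ i) : R)))).
  apply: le_avg => // j; apply: indic_le; apply: sub_eball.
  have := enorm_dist_triangle (x_ i) w z; rewrite [enorm (w - x_ i)]enorm_distC.
  by move: iw xz; rewrite /eball/=; have := rad_gt0; lra.
have sq : 0 <= p ^- 2 * ball_dev P x_ z (rad / 2) ^+ 2.
  by rewrite mulr_ge0 ?invr_ge0 ?sqr_ge0.
have sm : b ^- 2 * ball_dev P x_ z (9 * rad) ^+ 2 < 1.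
  by apply: le_lt_trans (small_zs zzs); rewrite lerDr.
have := lt1_norm b_gt0 sm; rewrite /ball_dev ltr_norml => /andP[_ h].
by have := P_le z; lra.
Qed.

(** The deviation is weighted by the mass [m] of the ball itself: below 1, it leaves an empirical
    mass of at least [m / 2], hence [q]. The relative weight keeps its expectation of order [1 / m]
    rather than [1 / q ^ 2]. *)
Lemma small_mass_q y : Omega' y -> q <= avg (fun j => (\1_(eball y (4 * rad)) (y_ j) : R)).
Proof.
move=> /net'[w wzs yw].
apply: (@le_trans _ _ (avg (fun i => (\1_(eball w (2 * rad)) (y_ i) : R)))); last first.
  apply: le_avg => // i; apply: indic_le; apply: sub_eball.
  by rewrite enorm_distC; lra.
have Qw := Q_ge wzs; have := small_zs' wzs.
set m := fine _ in Qw *; have m0 : 0 < m / 2 by move: q_gt0; lra.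
have -> : 4 * m ^- 2 = (m / 2) ^- 2.
  by field; move: m0; rewrite lt0r => /andP[+ _]; apply: contra_neq => ->; rewrite mul0r.
move=> /(lt1_norm m0); rewrite /ball_dev -/m ltr_norml => /andP[h _].
by move: h Qw; lra.
Qed.

End small_deviation.

End deviation.

(** * Expectations *)

Section expectations.
Context {dS} {S : measurableType dS} {R : realType} {d : nat}.
Variables (Pr : probability S R) (P Q : probability 'rV[R]_d R).
Variables (X Y : nat -> S -> 'rV[R]_d).
Hypotheses (mX : forall i, measurable_fun setT (X i))
  (mY : forall j, measurable_fun setT (Y j)).
Hypotheses (X_law : forall i A, measurable A -> Pr (X i @^-1` A) = P A)
  (Y_law : forall j A, measurable A -> Pr (Y j @^-1` A) = Q A).
Hypothesis XY_indep : mutually_independent Pr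
  (fun k : nat + nat => match k with inl i => X i | inr j => Y j end).
Variable n : nat.
Hypothesis n_gt0 : (0 < n)%N.

Let n0 : 0 < n%:R :> R. Proof. by rewrite ltr0n. Qed.

Let int_ball (mu : probability 'rV[R]_d R) z (r : R) :
  \int[mu]_x \1_(eball z r) x = fine (mu (eball z r)) /\
  \int[mu]_x ((\1_(eball z r) x : R) ^+ 2) = fine (mu (eball z r)).
Proof.
have e : \int[mu]_x \1_(eball z r) x = fine (mu (eball z r)).
  by rewrite /Rintegral integral_indic ?setIT//; exact: measurable_eball.
split=> //; rewrite -[RHS]e; apply: eq_Rintegral => x _.
by rewrite indicE; case: (x \in _); rewrite ?expr1n ?expr0n.
Qed.

Let bm_ball z (r : R) : bounded_measurable (\1_(eball z r) : 'rV[R]_d -> R).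
Proof. by apply: bm_indic; exact: measurable_eball. Qed.

Let bm_devX z r : bounded_measurable (fun w => ball_dev P (fun i : 'I_n => X i w) z r).
Proof.
apply: bmB; last exact: bm_cst.
by apply: bm_avg => i; exact: (bm_comp (mX i) (bm_ball z r)).
Qed.

Let bm_devY z r : bounded_measurable (fun w => ball_dev Q (fun i : 'I_n => Y i w) z r).
Proof.
apply: bmB; last exact: bm_cst.
by apply: bm_avg => i; exact: (bm_comp (mY i) (bm_ball z r)).
Qed.

Let dev_expectX z r : \int[Pr]_w (ball_dev P (fun i : 'I_n => X i w) z r ^+ 2) <=
  fine (P (eball z r)) / n%:R.
Proof.
have [e1 e2] := int_ball P z r; rewrite /ball_dev -{1}e1 -{1}e2.
exact: (sample_varianceX mX mY X_law Y_law XY_indep n_gt0 (bm_ball z r)).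
Qed.

Let dev_expectY z r : \int[Pr]_w (ball_dev Q (fun i : 'I_n => Y i w) z r ^+ 2) <=
  fine (Q (eball z r)) / n%:R.
Proof.
have [e1 e2] := int_ball Q z r; rewrite /ball_dev -{1}e1 -{1}e2.
exact: (sample_varianceY mX mY X_law Y_law XY_indep n_gt0 (bm_ball z r)).
Qed.

Section deviation_sum.
Variables (rad p b q : R) (zs zs' : seq 'rV[R]_d).
Hypotheses (rad_gt0 : 0 < rad) (b_gt0 : 0 < b) (q_gt0 : 0 < q).
Hypotheses (P_le : forall z, fine (P (eball z (9 * rad))) <= b)
  (Q_ge : forall z, z \in zs' -> 2 * q <= fine (Q (eball z (2 * rad)))).

Local Notation dev w := (dev_sum P Q rad p b zs zs'
  (fun i : 'I_n => X i w) (fun i : 'I_n => Y i w)).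

Lemma bm_dev_sum : bounded_measurable (fun w => dev w).
Proof.
apply: bmD; apply: bm_sum => z; last by apply: bmZ; exact: bmX.
by apply: bmD; apply: bmZ; exact: bmX.
Qed.

(** The variance of an indicator average is at most the mass of the ball over [n], and here this
    mass is comparable to the weights. *)
Lemma dev_sum_expect : \int[Pr]_w dev w <=
  ((size zs)%:R * (b / p ^+ 2 + b^-1) + (size zs')%:R * (2 / q)) / n%:R.
Proof.
have half z : fine (P (eball z (rad / 2))) <= b.
  apply: le_trans (P_le z); apply: fine_prob_homo; [exact: measurable_eball..|].
  apply: sub_eball; rewrite subrr enorm0 add0r.
  by rewrite ler_pdivrMr// mulrAC ler_peMl ?(ltW rad_gt0)// -natrM ler1n.
rewrite bm_RintegralD; last 2 first.
- by apply: bm_sum => z; apply: bmD; apply: bmZ; exact: bmX.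
- by apply: bm_sum => z; apply: bmZ; exact: bmX.
rewrite !bm_Rintegral_sum; last 2 first.
- by move=> z; apply: bmZ; exact: bmX.
- by move=> z; apply: bmD; apply: bmZ; exact: bmX.
have sum_le (J : eqType) (s : seq J) (F : J -> R) (m : R) :
    (forall z, z \in s -> F z <= m) -> \sum_(z <- s) F z <= (size s)%:R * m.
  move=> Fm; rewrite big_seq (le_trans (ler_sum _ Fm))//.
  by rewrite -big_seq big_const_seq count_predT iter_addr addr0 mulr_natl.
rewrite [leRHS]mulrDl -[X in _ <= X + _]mulrA -[X in _ <= _ + X]mulrA.
apply: lerD; apply: sum_le => z zzs.
  rewrite bm_RintegralD ?bm_RintegralZ; last 4 first.
  - exact: bmX.
  - exact: bmX.
  - by apply: bmZ; exact: bmX.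
  - by apply: bmZ; exact: bmX.
  rewrite [leRHS]mulrDl; apply: lerD.
    rewrite [leLHS]mulrC -[leRHS]mulrA [_^-1 * _]mulrC mulrA ler_wpM2r ?invr_ge0 ?sqr_ge0//.
    by apply: (le_trans (dev_expectX _ _)); apply: ler_wpM2r => //; rewrite invr_ge0 ler0n.
  rewrite [b^-1](_ : _ = b ^- 2 * b); last by field; exact: lt0r_neq0.
  rewrite -mulrA ler_wpM2l ?invr_ge0 ?sqr_ge0//.
  by apply: (le_trans (dev_expectX _ _)); apply: ler_wpM2r => //; rewrite invr_ge0 ler0n.
rewrite bm_RintegralZ; last exact: bmX.
have Qz := Q_ge zzs; set m := fine _ in Qz *; have m0 : 0 < m by move: q_gt0; lra.
apply: (@le_trans _ _ (4 * m ^- 2 * (m / n%:R))).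
  by rewrite ler_wpM2l ?dev_expectY// mulr_ge0// invr_ge0 sqr_ge0.
have -> : 4 * m ^- 2 * (m / n%:R) = 4 / m / n%:R by field; rewrite !lt0r_neq0.
rewrite ler_pM2r ?invr_gt0// ler_pdivrMr// mulrAC ler_pdivlMr//; lra.
Qed.

End deviation_sum.

Section dual_expectation.
Variables (phi : R -> R) (delta t eps : R).
Hypothesis phi_reg : regularization phi delta t.
Local Notation psi := (convex_conj phi).
Local Notation psi1 := (derive1 (convex_conj phi)).
Variables (f g : 'rV[R]_d -> R) (c0 : 'rV[R]_d * 'rV[R]_d -> R).
Hypotheses (f_bm : bounded_measurable f) (g_bm : bounded_measurable g)
  (c0_bm : bounded_measurable c0).

Local Notation fX w := (fun i : 'I_n => f (X i w)).
Local Notation gY w := (fun j : 'I_n => g (Y j w)).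
Local Notation cXY w := (fun i j : 'I_n => c0 (X i w, Y j w)).
Local Notation h z := ((f z.1 + g z.2 - c0 z) / eps).

Let h_bm : bounded_measurable (fun z => h z).
Proof.
apply: bmM; last exact: bm_cst.
by apply: bmB => //; apply: bmD; exact: bm_comp.
Qed.

Let psi_h_bm : bounded_measurable (fun z => psi (h z)).
Proof. exact: (bm_real_comp (measurable_psi phi_reg) (psi_bounded phi_reg)). Qed.

Let psi1_h_bm : bounded_measurable (fun z => psi1 (h z)).
Proof. exact: (bm_real_comp (measurable_psi1 phi_reg) (psi1_bounded phi_reg)). Qed.

Let bmXY (F : 'rV[R]_d * 'rV[R]_d -> R) i j : bounded_measurable F ->
  bounded_measurable (fun w => F (X i w, Y j w)).
Proof. by apply: bm_comp; exact: measurable_fun_pair. Qed.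

Lemma bm_discrete_dual :
  bounded_measurable (fun w => discrete_dual phi eps (cXY w) (fX w) (gY w)).
Proof.
apply: bmB.
  by apply: bmD; apply: bm_avg => i; exact: bm_comp.
by apply: bmZ; apply: bm_avg => i; apply: bm_avg => j; exact: (bmXY i j psi_h_bm).
Qed.

(** At potentials independent of the sample every summand depends on a single point or a single
    pair, so linearity suffices. *)
Lemma discrete_dual_expect :
  \int[Pr]_w discrete_dual phi eps (cXY w) (fX w) (gY w) = dual_value phi P Q c0 eps f g.
Proof.
have bfX i : bounded_measurable (fun w => f (X i w)) by exact: bm_comp.
have bgY i : bounded_measurable (fun w => g (Y i w)) by exact: bm_comp.
have bpsi i j := bmXY i j psi_h_bm.
rewrite /discrete_dual bm_RintegralB; last 2 first.
- by apply: bmD; exact: bm_avg.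
- by apply: bmZ; apply: bm_avg => i; apply: bm_avg => j; exact: bpsi.
rewrite bm_RintegralD; [|exact: bm_avg..].
rewrite bm_RintegralZ; last by apply: bm_avg => i; apply: bm_avg => j; exact: bpsi.
rewrite !Rintegral_avg//; last by move=> i; apply: bm_avg => j; exact: bpsi.
rewrite /dual_value; congr (_ + _ - _ * _).
- rewrite (eq_avg (G := fun=> \int[P]_x f x)) ?avg_cst// => i.
  exact: (sample_law1X (Y := Y) mX mY X_law Y_law i f_bm).
- rewrite (eq_avg (G := fun=> \int[Q]_x g x)) ?avg_cst// => i.
  exact: (sample_law1Y (X := X) mX mY X_law Y_law i g_bm).
rewrite (eq_avg (G := fun=> \int[prod_prob P Q]_z psi (h z))) ?avg_cst// => i.
rewrite Rintegral_avg; last by move=> j; exact: bpsi.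
rewrite (eq_avg (G := fun=> \int[prod_prob P Q]_z psi (h z))) ?avg_cst// => j.
exact: (sample_law2 mX mY X_law Y_law XY_indep i j psi_h_bm).
Qed.

Variables (D D' : set 'rV[R]_d).
Hypotheses (mD : measurable D) (mD' : measurable D') (PD : P D = 1%E) (QD' : Q D' = 1%E).
Hypotheses (marg1 : forall x, D x -> \int[Q]_y psi1 ((f x + g y - c0 (x, y)) / eps) = 1)
  (marg2 : forall y, D' y -> \int[P]_x psi1 ((f x + g y - c0 (x, y)) / eps) = 1).

Let u z := 1 - psi1 (h z).

Let u_bm : bounded_measurable u.
Proof. by apply: bmB => //; exact: bm_cst. Qed.

Let grad1E w i : dual_grad1 phi eps (fX w) (gY w) (cXY w) i =
  avg (fun j : 'I_n => u (X i w, Y j w)).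
Proof. by rewrite /dual_grad1 /u avgB avg_cst. Qed.

Let grad2E w j : dual_grad2 phi eps (fX w) (gY w) (cXY w) j =
  avg (fun i : 'I_n => u (X i w, Y j w)).
Proof. by rewrite /dual_grad2 /u avgB avg_cst. Qed.

Let bm_row i : bounded_measurable (fun w => avg (fun j : 'I_n => u (X i w, Y j w)) ^+ 2).
Proof. by apply: bmX; apply: bm_avg => j; exact: bmXY. Qed.

Let bm_col j : bounded_measurable (fun w => avg (fun i : 'I_n => u (X i w, Y j w)) ^+ 2).
Proof. by apply: bmX; apply: bm_avg => i; exact: bmXY. Qed.

Let grad_norm2E w : grad_norm2 phi eps (fX w) (gY w) (cXY w) =
  avg (fun i : 'I_n => avg (fun j : 'I_n => u (X i w, Y j w)) ^+ 2) +
  avg (fun j : 'I_n => avg (fun i : 'I_n => u (X i w, Y j w)) ^+ 2).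
Proof.
by rewrite /grad_norm2; congr (_ + _); apply: eq_avg => i; rewrite ?grad1E ?grad2E.
Qed.

Lemma bm_grad_norm2 :
  bounded_measurable (fun w => grad_norm2 phi eps (fX w) (gY w) (cXY w)).
Proof.
rewrite (_ : (fun w => _) = fun w =>
    avg (fun i : 'I_n => avg (fun j : 'I_n => u (X i w, Y j w)) ^+ 2) +
    avg (fun j : 'I_n => avg (fun i : 'I_n => u (X i w, Y j w)) ^+ 2)).
  by apply: bmD; exact: bm_avg.
by apply/funext => w; exact: grad_norm2E.
Qed.

(** By the marginal equations [u] integrates to zero in each variable, so every row and every column
    average has second moment exactly [1 / n] times that of [u]. *)
Lemma grad_norm2_expect :
  \int[Pr]_w grad_norm2 phi eps (fX w) (gY w) (cXY w) =
  2 * (\int[prod_prob P Q]_z ((psi1 (h z) - 1) ^+ 2)) / n%:R.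
Proof.
under eq_Rintegral do rewrite grad_norm2E.
rewrite bm_RintegralD; [|exact: bm_avg..].
rewrite !Rintegral_avg//; set v := \int[_]_z _.
have vE : v = \int[prod_prob P Q]_z (u z ^+ 2).
  by apply: eq_Rintegral => z _; rewrite -sqrrN opprB.
have u1 x : D x -> \int[Q]_y u (x, y) = 0.
  move=> Dx; rewrite bm_RintegralB; [|exact: bm_cst|exact: (bm_pair1 x psi1_h_bm)].
  by rewrite Rintegral_prob_cst marg1// subrr.
have u2 y : D' y -> \int[P]_x u (x, y) = 0.
  move=> Dy; rewrite bm_RintegralB; [|exact: bm_cst|exact: (bm_pair2 y psi1_h_bm)].
  by rewrite Rintegral_prob_cst marg2// subrr.
have row (i : 'I_n) : \int[Pr]_w (avg (fun j : 'I_n => u (X i w, Y j w)) ^+ 2) = v / n%:R.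
  by rewrite vE; exact: (sample_rowX mX mY X_law Y_law XY_indep i n_gt0 u_bm mD PD u1).
have col (j : 'I_n) : \int[Pr]_w (avg (fun i : 'I_n => u (X i w, Y j w)) ^+ 2) = v / n%:R.
  by rewrite vE; exact: (sample_rowY mX mY X_law Y_law XY_indep j n_gt0 u_bm mD' QD' u2).
clearbody v; rewrite [X in X + _](eq_avg row) [X in _ + X](eq_avg col) (avg_cst n_gt0).
by rewrite -mulrA mulr_natl mulr2n.
Qed.

End dual_expectation.

End expectations.

Section empirical_dual.
Context {R : realType} {d n : nat}.
Variables (phi : R -> R) (delta t eps : R).
Hypothesis phi_reg : regularization phi delta t.
Hypothesis n_gt0 : (0 < n)%N.
Variables (xs ys : n.-tuple 'rV[R]_d).
Variables (f g : 'rV[R]_d -> R) (c0 : 'rV[R]_d * 'rV[R]_d -> R).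
Hypotheses (f_bm : bounded_measurable f) (g_bm : bounded_measurable g)
  (c0_bm : bounded_measurable c0).

Lemma dual_value_empirical :
  dual_value phi (empirical xs) (empirical ys) c0 eps f g =
  discrete_dual phi eps (fun i j => c0 (tnth xs i, tnth ys j))
    (fun i => f (tnth xs i)) (fun j => g (tnth ys j)).
Proof.
have h_bm : bounded_measurable (fun z => (f z.1 + g z.2 - c0 z) / eps).
  apply: bmM; last exact: bm_cst.
  by apply: bmB => //; apply: bmD; exact: bm_comp.
have psi_bm := bm_real_comp (measurable_psi phi_reg) (psi_bounded phi_reg) h_bm.
rewrite /dual_value /discrete_dual !empirical_Rintegral//.
have [bI ->] := bm_Fubini1 (empirical xs) (empirical ys) psi_bm.
rewrite empirical_Rintegral//; congr (_ - _ * _); apply: eq_avg => i.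
by rewrite empirical_Rintegral//; exact: (bm_pair1 _ psi_bm).
Qed.

End empirical_dual.

(** * The bias *)

(** Nothing is assumed on [H] itself: the two bounds also force its integral to be finite, so that
    [fine] is harmless. *)
Lemma sandwich_expectation {d} {T : measurableType d} {R : realType} (Pr : probability T R)
    (U H V : T -> R) : bounded_measurable U -> bounded_measurable V ->
  {ae Pr, forall w, U w <= H w <= V w} ->
  \int[Pr]_w U w <= fine 'E_Pr[H] <= \int[Pr]_w V w.
Proof.
move=> bU bV UHV; rewrite expectation.unlock.
have lo : (\int[Pr]_w (U w)%:E <= \int[Pr]_w (H w)%:E)%E.
  apply: ae_le_integral_measurable_l; first exact: (bm_integrable Pr bU).
  by apply: filterS UHV => w /andP[+ _]; rewrite lee_fin.
have hi : (\int[Pr]_w (H w)%:E <= \int[Pr]_w (V w)%:E)%E.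
  apply: ae_le_integral_measurable_r; first exact: (bm_integrable Pr bV).
  by apply: filterS UHV => w /andP[_ +]; rewrite lee_fin.
move: lo hi; rewrite (bm_integralE Pr bU) (bm_integralE Pr bV).
by case: (\int[Pr]_w (H w)%:E)%E => [r| |]//=; rewrite !lee_fin => -> ->.
Qed.

(** The optimal choice would be [tau = sqrt (m / v)]. Working with the excess [e = x - A] avoids the
    root: [tau = e / (2 * v)] gives [e ^ 2 <= 4 * v * m], and a large [tau] rules out [v = 0]. *)
Lemma optimize_rate {R : realFieldType} (x A v m : R) : 0 <= x -> 0 <= A -> 0 <= v -> 0 <= m ->
  (forall tau, 0 < tau -> x <= A + tau * v + m / tau) ->
  x ^+ 2 <= 2 * A ^+ 2 + 8 * (v * m).
Proof.
move=> x0 A0 v0 m0 xP; have vm0 := mulr_ge0 v0 m0.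
have [xA|Ax] := leP x A.
  have : x ^+ 2 <= A ^+ 2 by rewrite lerXn2r.
  have := sqr_ge0 A; lra.
pose e := x - A; have e0 : 0 < e by rewrite subr_gt0.
have eP tau : 0 < tau -> e * tau <= tau ^+ 2 * v + m.
  move=> t0; have := xP tau t0; rewrite -(ler_pM2r t0).
  have -> : (A + tau * v + m / tau) * tau = A * tau + tau ^+ 2 * v + m.
    by field; rewrite lt0r_neq0.
  by rewrite /e mulrBl; lra.
have e2 : e ^+ 2 <= 4 * (v * m).
  have [v1|v1] := eqVneq v 0.
    have := eP ((m + 1) / e) ltac:(by rewrite divr_gt0// ltr_wpDl).
    by rewrite v1 mulr0 add0r mulrC divfK ?lt0r_neq0// gerDl ler10.
  have vp : 0 < v by rewrite lt0r v1.
  have := eP (e / (2 * v)) ltac:(by rewrite divr_gt0// mulr_gt0).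
  have -> : e * (e / (2 * v)) = 2 * (e ^+ 2 / (4 * v)) by field; rewrite lt0r_neq0.
  have -> : (e / (2 * v)) ^+ 2 * v = e ^+ 2 / (4 * v) by field; rewrite lt0r_neq0.
  move=> h; have : e ^+ 2 / (4 * v) <= m by lra.
  by rewrite ler_pdivrMr ?mulr_gt0//; lra.
have -> : x = A + e by rewrite /e; ring.
by have := sqr_ge0 (A - e); rewrite !expr2 in e2 *; lra.
Qed.

Section bias.
Context {dS} {S : measurableType dS} {R : realType} {d : nat}.
Variables (Pr : probability S R) (P Q : probability 'rV[R]_d R).
Variables (X Y : nat -> S -> 'rV[R]_d).
Hypotheses (mX : forall i, measurable_fun setT (X i))
  (mY : forall j, measurable_fun setT (Y j)).
Hypotheses (X_law : forall i A, measurable A -> Pr (X i @^-1` A) = P A)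
  (Y_law : forall j A, measurable A -> Pr (Y j @^-1` A) = Q A).
Hypothesis XY_indep : mutually_independent Pr
  (fun k : nat + nat => match k with inl i => X i | inr j => Y j end).
Variables (phi psi2 : R -> R) (delta t : R).
Hypothesis phi_reg : regularization phi delta t.
Hypothesis psi2P : nondecreasing_second_derivative (convex_conj phi) psi2.
Hypothesis psi2_gt0 : 0 < psi2 (t - delta).
Local Notation psi1 := (derive1 (convex_conj phi)).
Local Notation k := (psi2 (t - delta)).
Local Notation Omega := (msupport P).
Local Notation Omega' := (msupport Q).
Variables (c : 'rV[R]_d -> 'rV[R]_d -> R) (L Cc Dx M eps : R).
Hypotheses (L_gt0 : 0 < L) (eps_gt0 : 0 < eps) (eps_le1 : eps <= 1)
  (c_lip : cost_lipschitz Omega Omega' L c).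
Hypothesis c_bound : forall x y, Omega x -> Omega' y -> `|c x y| <= Cc.
Hypothesis Omega_diam : forall x x', Omega x -> Omega x' -> enorm (x - x') <= Dx.
Hypotheses (M0 : 0 <= M) (OM : forall x i, Omega x -> `|x ord0 i| <= M)
  (OM' : forall x i, Omega' x -> `|x ord0 i| <= M).
Hypothesis Omega_convex : convex_set Omega.
Variables (fhat ghat : forall n : nat, n.-tuple 'rV[R]_d -> n.-tuple 'rV[R]_d -> 'rV[R]_d -> R).
Hypothesis fghatP : forall n (xs ys : n.-tuple 'rV[R]_d), (0 < n)%N ->
  (forall i, Omega (tnth xs i)) -> (forall j, Omega' (tnth ys j)) ->
  potentials Omega Omega' c (convex_conj phi) eps
    (empirical xs) (empirical ys) (fhat xs ys) (ghat xs ys).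
Variable n : nat.
Hypothesis n_gt0 : (0 < n)%N.
Variable gam : R.
Hypothesis gamP : {ae Pr, forall w, forall i : 'I_n,
  avg (fun j : 'I_n => psi2 ((fhat (sample X n w) (sample Y n w) (X i w) +
    ghat (sample X n w) (sample Y n w) (Y j w) - c (X i w) (Y j w)) / eps + delta / 4)) <= gam}.
Variables (rad p b q c1 K : R) (N : nat) (zs zs' : seq 'rV[R]_d).
Hypotheses (radE : rad = delta * eps / (16 * L)) (p_gt0 : 0 < p) (b_gt0 : 0 < b)
  (q_gt0 : 0 < q) (N_gt0 : (0 < N)%N).
Hypothesis diam_N : forall x x', Omega x -> Omega x' -> enorm (x - x') < N%:R * rad.
Hypotheses (P_ge : forall z, z \in zs -> 2 * p <= fine (P (eball z (rad / 2))))
  (P_le : forall z, fine (P (eball z (9 * rad))) <= b)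
  (Q_ge : forall z, z \in zs' -> 2 * q <= fine (Q (eball z (2 * rad)))).
Hypotheses (net : forall x, Omega x -> exists2 z, z \in zs & enorm (x - z) <= rad / 2)
  (net' : forall y, Omega' y -> exists2 z, z \in zs' & enorm (y - z) <= 2 * rad).
Local Notation B0 := (`|t| + Cc + L * Dx).
Hypotheses (c1P : 0 < c1 <= 1) (c1_delta : c1 * (4 * B0) <= delta / 4).
Hypotheses (K_ge0 : 0 <= K) (KP : k * p <= gam ->
  (36 * N%:R ^+ 2 * (2 * b / (p * q)) * (1 + 2 * gam / (k * p)) + 2 / p) / (k * c1) <= K).
Variable pi : probability ('rV[R]_d * 'rV[R]_d)%type R.
Hypothesis pi_opt : OT_optimizer Omega Omega' c phi eps P Q pi.

Let OT_hat w := fine (OT Omega Omega' c phi eps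
  (empirical (sample X n w)) (empirical (sample Y n w))).
Let OT_PQ := fine (OT Omega Omega' c phi eps P Q).
Let var := fine 'V_(prod_prob P Q)[coupling_density P Q pi].
Let c0 := cost_ext P Q c.

Let mO := measurable_msupport P.
Let mO' := measurable_msupport Q.

Let rad0 : 0 < rad.
Proof. by rewrite radE divr_gt0// mulr_gt0// (reg_delta_gt0 phi_reg). Qed.

Let c0_bm : bounded_measurable c0. Proof. exact: (bm_cost_ext L_gt0 c_lip c_bound). Qed.

Let c0E x y : Omega x -> Omega' y -> c x y = c0 (x, y).
Proof. by move=> Ox Oy; rewrite /c0 cost_extE. Qed.

Section one_sample.
Variable w : S.
Hypotheses (XO : forall i, Omega (X i w)) (YO : forall j, Omega' (Y j w)).
Local Notation xs := (sample X n w).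
Local Notation ys := (sample Y n w).

Let xsE i : tnth xs i = X i w. Proof. by rewrite tnth_mktuple. Qed.
Let ysE i : tnth ys i = Y i w. Proof. by rewrite tnth_mktuple. Qed.
Let xsO i : Omega (tnth xs i). Proof. by rewrite xsE. Qed.
Let ysO i : Omega' (tnth ys i). Proof. by rewrite ysE. Qed.

Local Notation fh := (fhat xs ys).
Local Notation gh := (ghat xs ys).
Let fgP := fghatP n_gt0 xsO ysO.

Let row i : avg (fun j : 'I_n => psi1 ((fh (X i w) + gh (Y j w) - c (X i w) (Y j w)) / eps)) = 1.
Proof.
rewrite -[RHS](pot_row phi_reg mO' L_gt0 c_lip c_bound n_gt0 eps_gt0 ysO fgP (XO i)).
by apply: eq_avg => j; rewrite ysE.
Qed.

Let col j : avg (fun i : 'I_n => psi1 ((fh (X i w) + gh (Y j w) - c (X i w) (Y j w)) / eps)) = 1.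
Proof.
rewrite -[RHS](pot_col phi_reg mO L_gt0 c_lip c_bound n_gt0 eps_gt0 xsO fgP (YO j)).
by apply: eq_avg => i; rewrite xsE.
Qed.

Let full_x := empirical_full (R := R) n_gt0 mO xsO.
Let full_y := empirical_full (R := R) n_gt0 mO' ysO.

Local Notation cw := (fun i j : 'I_n => c0 (X i w, Y j w)).

Let emp_dual (f g : 'rV[R]_d -> R) : bounded_measurable f -> bounded_measurable g ->
  dual_value phi (empirical xs) (empirical ys) c0 eps f g =
  discrete_dual phi eps cw (fun i => f (X i w)) (fun j => g (Y j w)).
Proof.
move=> bf bg; rewrite (dual_value_empirical _ phi_reg)//.
by congr discrete_dual; [do 2 apply/funext => ?|apply/funext => ?|apply/funext => ?]; rewrite
  ?xsE ?ysE.
Qed.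

Lemma OT_hat_ge f g : bounded_measurable f -> bounded_measurable g ->
  ((discrete_dual phi eps cw (fun i => f (X i w)) (fun j => g (Y j w)))%:E <=
   OT Omega Omega' c phi eps (empirical xs) (empirical ys))%E.
Proof.
move=> bf bg; rewrite -emp_dual//; apply: le_ereal_inf_tmp => _ [pi' cpi <-].
exact: (weak_duality phi_reg mO mO' full_x full_y c0_bm c0E eps_gt0 bf bg cpi).
Qed.

Lemma OT_hatE : OT Omega Omega' c phi eps (empirical xs) (empirical ys) =
  (discrete_dual phi eps cw (fun i => fh (X i w)) (fun j => gh (Y j w)))%:E.
Proof.
have f_B := pot_bound1 phi_reg psi2P psi2_gt0 mO mO' L_gt0 c_lip c_bound Omega_diam
  n_gt0 eps_gt0 xsO ysO fgP.
have g_B := pot_bound2 phi_reg psi2P psi2_gt0 mO mO' L_gt0 c_lip c_bound Omega_diam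
  n_gt0 eps_gt0 xsO ysO fgP.
case: (fgP) => [[mf _]] [mg _] _ _ _.
(* The empirical potentials are controlled on the supports only, so they are extended by zero before
   the duality theorem is applied. *)
pose fO := fh \_ Omega; pose gO := gh \_ Omega'.
have bf : bounded_measurable fO by apply: bm_restrict => //; exists (L * Dx).
have bg : bounded_measurable gO by apply: bm_restrict => //; exists (eps * `|t| + Cc + L * Dx).
have fE x : Omega x -> fO x = fh x by move=> Ox; rewrite /fO patchE mem_set.
have gE y : Omega' y -> gO y = gh y by move=> Oy; rewrite /gO patchE mem_set.
clearbody fO gO.
have bh : bounded_measurable
    (fun z : 'rV[R]_d * 'rV[R]_d => psi1 ((fO z.1 + gO z.2 - c0 z) / eps)).
  apply: (bm_real_comp (measurable_psi1 phi_reg) (psi1_bounded phi_reg)).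
  apply: bmM; last exact: bm_cst.
  by apply: bmB; [apply: bmD; exact: bm_comp|exact: c0_bm].
rewrite (OT_dual (f := fO) (g := gO) phi_reg mO mO' full_x full_y c0_bm c0E eps_gt0 bf bg).
- rewrite emp_dual//; congr EFin; congr discrete_dual; apply/funext => i; [exact: fE|exact: gE].
- move=> x Ox; rewrite (empirical_Rintegral _ n_gt0 (bm_pair1 x bh)).
  rewrite -[RHS](pot_row phi_reg mO' L_gt0 c_lip c_bound n_gt0 eps_gt0 ysO fgP Ox).
  by apply: eq_avg => j; rewrite /= fE// gE// c0E.
- move=> y Oy; rewrite (empirical_Rintegral _ n_gt0 (bm_pair2 y bh)).
  rewrite -[RHS](pot_col phi_reg mO L_gt0 c_lip c_bound n_gt0 eps_gt0 xsO fgP Oy).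
  by apply: eq_avg => j; rewrite /= fE// gE// c0E.
Qed.

Local Notation fhX := (fun i : 'I_n => fh (X i w)).
Local Notation ghY := (fun j : 'I_n => gh (Y j w)).

Let row0 i : avg (fun j => psi1 ((fhX i + ghY j - cw i j) / eps)) = 1.
Proof. by rewrite -[RHS](row i); apply: eq_avg => j; rewrite c0E. Qed.

Let col0 j : avg (fun i => psi1 ((fhX i + ghY j - cw i j) / eps)) = 1.
Proof. by rewrite -[RHS](col j); apply: eq_avg => i; rewrite c0E. Qed.

Let f_bound i : `|fhX i| <= B0.
Proof.
have Cc0 : 0 <= Cc by exact: le_trans (normr_ge0 _) (c_bound (XO i) (YO i)).
have := pot_bound1 phi_reg psi2P psi2_gt0 mO mO' L_gt0 c_lip c_bound Omega_diam
  n_gt0 eps_gt0 xsO ysO fgP (XO i).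
by move=> /le_trans; apply; rewrite lerDr addr_ge0.
Qed.

Let g_bound j : `|ghY j| <= B0.
Proof.
have := pot_bound2 phi_reg psi2P psi2_gt0 mO mO' L_gt0 c_lip c_bound Omega_diam
  n_gt0 eps_gt0 xsO ysO fgP (YO j).
by move=> /le_trans; apply; rewrite !lerD2r ler_piMl.
Qed.

Hypothesis degree : forall i : 'I_n,
  avg (fun j : 'I_n => psi2 ((fh (X i w) + gh (Y j w) - c (X i w) (Y j w)) / eps + delta / 4))
    <= gam.

Local Notation dev := (dev_sum P Q rad p b zs zs'
  (fun i : 'I_n => X i w) (fun i : 'I_n => Y i w)).

(** If [dev >= 1], multiplying the constant term of the crude bound by [dev] only enlarges it. If
    [dev < 1], the balls have the expected masses and the gap is at most [K] times the squared
    gradient. The right-hand side covers both cases. *)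
Lemma OT_hat_gap (f g : 'I_n -> R) tau :
  (forall i, `|f i| <= B0) -> (forall j, `|g j| <= B0) -> 0 < tau ->
  discrete_dual phi eps cw fhX ghY - discrete_dual phi eps cw f g <=
  (K + tau) * grad_norm2 phi eps f g cw + 8 * B0 ^+ 2 / tau * dev.
Proof.
move=> fB gB tau0.
apply: (le_trans (duality_gap_le phi_reg n_gt0 f g eps_gt0 row0 col0)).
have W0 : 0 <= grad_norm2 phi eps f g cw.
  by apply: addr_ge0; apply: avg_ge0 => // i; exact: sqr_ge0.
have S0 : 0 <= dev by exact: dev_sum_ge0.
have C0 : 0 <= 8 * B0 ^+ 2 / tau by rewrite divr_ge0 ?(ltW tau0)// mulr_ge0// sqr_ge0.
have [S1|S1] := leP 1 dev.
  apply: (le_trans (gap_bound_crude phi n_gt0 eps cw fB gB f_bound g_bound tau0)).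
  by apply: lerD; [rewrite ler_wpM2r// lerDr|rewrite ler_peMr].
have xE : (fun i => tnth xs i) = (fun i : 'I_n => X i w) by apply/funext => i; exact: xsE.
have yE : (fun i => tnth ys i) = (fun i : 'I_n => Y i w) by apply/funext => i; exact: ysE.
have actE : active delta t eps fhX ghY cw = active delta t eps (fun i => fh (tnth xs i))
    (fun j => gh (tnth ys j)) (fun i j => c (tnth xs i) (tnth ys j)).
  by apply/funext => i; apply/funext => j; rewrite /active xsE ysE c0E.
have mass1 z : Omega z -> p <= avg (fun i => (\1_(eball z rad) (tnth xs i) : R)).
  move=> Oz; rewrite (eq_avg (G := fun i : 'I_n => \1_(eball z rad) (X i w))); last by move=>
    i; rewrite xsE.
  exact: (small_mass_p p_gt0 P_ge n_gt0 net S1 Oz).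
have mass2 y : Omega' y -> q <= avg (fun i => (\1_(eball y (4 * rad)) (tnth ys i) : R)).
  move=> Oy; rewrite (eq_avg (G := fun i : 'I_n => \1_(eball y (4 * rad)) (Y i w))); last by
    move=> i; rewrite ysE.
  exact: (small_mass_q q_gt0 Q_ge n_gt0 net' S1 Oy).
have mass3 v : avg (fun i => (\1_(eball v (4 * rad)) (tnth xs i) : R)) <= 2 * b.
  rewrite (eq_avg (G := fun i : 'I_n => \1_(eball v (4 * rad)) (X i w))); last by move=> i;
    rewrite xsE.
  exact: (small_mass_pbar rad0 b_gt0 P_le n_gt0 (fun i => XO i) net S1 v).
have deg i : avg (fun j => psi2 ((fh (tnth xs i) + gh (tnth ys j) - c (tnth xs i) (tnth ys j))
  / eps + delta / 4)) <= gam.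
  apply: le_trans (degree i); rewrite le_eqVlt; apply/orP; left; apply/eqP.
  by apply: eq_avg => j; rewrite xsE ysE.
(* This relation is derived from the good sample itself, which is why [KP] may be stated
   conditionally on it. *)
have kp := degree_ge phi_reg psi2P psi2_gt0 mO mO' L_gt0 c_lip c_bound n_gt0 eps_gt0 xsO ysO fgP
  radE mass1 deg.
have gam0 : 0 <= gam by apply: le_trans kp; rewrite mulr_ge0// ltW.
have Kp0 : 0 <= 36 * N%:R ^+ 2 * (2 * b / (p * q)).
  by rewrite mulr_ge0// ?divr_ge0// ?mulr_ge0// ?sqr_ge0// ltW.
have := gap_bound_le_grad phi_reg psi2P psi2_gt0 n_gt0 eps_gt0 eps_le1 fB gB f_bound g_bound
  row0 col0
  c1P c1_delta p_gt0 Kp0 gam0.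
rewrite actE => /(_ (active_poincare phi_reg psi2P psi2_gt0 mO mO' L_gt0 c_lip c_bound Omega_convex
  n_gt0 eps_gt0 xsO ysO fgP radE p_gt0 q_gt0 N_gt0 mass1 mass2 mass3 diam_N)).
move=> /(_ (active_mass phi_reg psi2P psi2_gt0 mO mO' L_gt0 c_lip c_bound n_gt0 eps_gt0 xsO ysO
  fgP radE mass1)).
move=> /(_ (active_degree phi_reg psi2P n_gt0 deg)) /le_trans; apply.
apply: (le_trans (ler_wpM2r W0 (KP kp))).
by rewrite [X in _ <= X + _]mulrDl -addrA lerDl addr_ge0// mulr_ge0// ltW.
Qed.

End one_sample.

Let dev_rate := ((size zs)%:R * (b / p ^+ 2 + b^-1) + (size zs')%:R * (2 / q)) / n%:R.

(** Nonnegativity comes from weak duality on each sample at the population potentials. As [tau] does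
    not depend on the sample, it stays free after integration. *)
Lemma bias_bound : 0 <= fine 'E_Pr[OT_hat] - OT_PQ /\
  forall tau, 0 < tau -> fine 'E_Pr[OT_hat] - OT_PQ <=
    (K + tau) * (2 * var / n%:R) + 8 * B0 ^+ 2 / tau * dev_rate.
Proof.
have PO : P Omega = 1%E by exact: msupport_full.
have QO : Q Omega' = 1%E by exact: msupport_full.
have [f [g [[bf bg] f_B g_B marg1 marg2]]] := population_potentials mX mY X_law Y_law XY_indep
  phi_reg psi2P psi2_gt0 L_gt0 eps_gt0 c_lip c_bound Omega_diam M0 OM OM'
  (fun m xs ys m0 xsO ysO => ex_intro _ _ (ex_intro _ _ (fghatP m0 xsO ysO))).
have OT_PQE : OT_PQ = dual_value phi P Q c0 eps f g.
  by rewrite /OT_PQ (OT_dual phi_reg mO mO' PO QO c0_bm c0E eps_gt0 bf bg marg1 marg2).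
pose W w := grad_norm2 phi eps (fun i : 'I_n => f (X i w)) (fun j : 'I_n => g (Y j w))
  (fun i j => c0 (X i w, Y j w)).
pose U w := discrete_dual phi eps (fun i j : 'I_n => c0 (X i w, Y j w))
  (fun i => f (X i w)) (fun j => g (Y j w)).
pose D w := dev_sum P Q rad p b zs zs' (fun i : 'I_n => X i w) (fun i : 'I_n => Y i w).
have bU : bounded_measurable U by exact: (bm_discrete_dual mX mY n eps phi_reg bf bg c0_bm).
have bW : bounded_measurable W by exact: (bm_grad_norm2 mX mY n_gt0 eps phi_reg bf bg c0_bm).
have bD : bounded_measurable D by exact: bm_dev_sum.
have EU : \int[Pr]_w U w = OT_PQ.
  rewrite OT_PQE; exact: (discrete_dual_expect mX mY X_law Y_law XY_indep n_gt0 eps phi_reg bf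
    bg c0_bm).
have EW : \int[Pr]_w W w = 2 * var / n%:R.
  rewrite /var (optimizer_variance phi_reg mO mO' PO QO c0_bm c0E eps_gt0 bf bg marg1 marg2 pi_opt).
  exact: (grad_norm2_expect mX mY X_law Y_law XY_indep n_gt0 phi_reg bf bg c0_bm mO mO' PO QO
    marg1 marg2).
have ED : \int[Pr]_w D w <= dev_rate.
  exact: (dev_sum_expect mX mY X_law Y_law XY_indep n_gt0 p zs rad0 b_gt0 q_gt0 P_le Q_ge).
have f_B' x : Omega x -> `|f x| <= B0.
  have [x0 Ox0] := msupport_nonempty P; have [y0 Oy0] := msupport_nonempty Q.
  have Cc0 : 0 <= Cc by exact: le_trans (normr_ge0 _) (c_bound Ox0 Oy0).
  by move=> /f_B /le_trans; apply; rewrite lerDr addr_ge0.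
have g_B' y : Omega' y -> `|g y| <= B0.
  by move=> /g_B /le_trans; apply; rewrite !lerD2r ler_piMl.
have aeUV tau : 0 < tau -> {ae Pr, forall w, U w <= OT_hat w <=
    U w + ((K + tau) * W w + 8 * B0 ^+ 2 / tau * D w)}.
  move=> tau0; have ae_sample := sample_ae mX mY X_law Y_law mO mO' PO QO.
  apply: filterS2 ae_sample gamP => w [XO YO] deg.
  have := OT_hat_ge XO YO bf bg; rewrite /OT_hat OT_hatE//= lee_fin => ->/=.
  by rewrite -lerBlDl; apply: OT_hat_gap => // i; [exact: f_B'|exact: g_B'].
have key tau (tau0 : 0 < tau) : 0 <= fine 'E_Pr[OT_hat] - OT_PQ <=
    (K + tau) * (2 * var / n%:R) + 8 * B0 ^+ 2 / tau * dev_rate.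
  have bV : bounded_measurable (fun w => (K + tau) * W w + 8 * B0 ^+ 2 / tau * D w).
    by apply: bmD; exact: bmZ.
  have /andP[lo hi] := sandwich_expectation bU (bmD bU bV) (aeUV tau tau0).
  rewrite EU in lo; rewrite (bm_RintegralD Pr bU bV) EU in hi.
  rewrite subr_ge0 lo lerBlDl (le_trans hi)// lerD2l.
  rewrite bm_RintegralD; [|exact: bmZ..]; rewrite !bm_RintegralZ// EW.
  by rewrite lerD2l ler_wpM2l// divr_ge0 ?(ltW tau0)// mulr_ge0// sqr_ge0.
split; first by have /andP[] := key 1 ltr01.
by move=> tau /key /andP[].
Qed.

End bias.

(** * Rates *)

Lemma expr_3d2 {R : comPzRingType} (e : R) d :
  e ^+ (3 * d + 2) = e ^+ d * e ^+ (d + 2) * e ^+ d.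
Proof. by rewrite -!exprD; congr (_ ^+ _); ring. Qed.

Section rate_constants.
Context {R : realType} (d : nat).
Variables (k lam Lam e c4 mP mQ gam N' : R).
Hypotheses (k_gt0 : 0 < k) (lam_gt0 : 0 < lam) (Lam_gt0 : 0 < Lam) (e01 : 0 < e <= 1).
Hypotheses (mP_gt0 : 0 < mP) (mQ_gt0 : 0 < mQ) (gam_gt0 : 0 < gam) (N'_gt0 : 0 < N').

Local Notation alpha := (alpha_const d lam Lam k mQ gam N').
Local Notation beta := (beta_const alpha k mP gam).

Let e0 : 0 < e. Proof. by case/andP: e01. Qed.
Let e1 : e <= 1. Proof. by case/andP: e01. Qed.

Let alpha_gt0 : 0 < alpha.
Proof. by rewrite /alpha_const divr_gt0// !mulr_gt0// exprn_gt0. Qed.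

Let den_gt0 : 0 < k * mP + 8 * gam.
Proof. by rewrite addr_gt0// mulr_gt0. Qed.

Lemma beta_gt0 : 0 < beta.
Proof.
move: (alpha) alpha_gt0 => al al0.
by rewrite /beta_const lt_min; apply/andP; split; rewrite divr_gt0 ?mulr_gt0 ?mulr_gt0 ?mulr_gt0.
Qed.

(** Converts the constant of the gradient bound into [1 / beta]. The first argument of the minimum
    in [beta] absorbs the Poincare term, through [N' >= c5 / e] in [alpha]; the second absorbs
    [2 / p], since [mP] and [p] are both of order [e ^+ d]. *)
Lemma theta_le_beta (c1 P0 b0 cN c5 Nn p b q : R) :
  0 < c1 -> 0 < P0 -> 0 < b0 -> 0 < c5 -> 0 < c4 ->
  p = P0 * e ^+ d -> b = b0 * e ^+ d -> q = mQ / 2 -> k * p <= gam ->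
  0 <= Nn -> Nn * e <= cN -> c5 <= N' * e -> mP <= c4 * e ^+ d ->
  (36 * Nn ^+ 2 * (2 * b / (p * q)) * (1 + 2 * gam / (k * p)) + 2 / p) / (k * c1) <=
  (27 * cN ^+ 2 * b0 * lam ^+ 2 * k * c4 / (P0 ^+ 3 * Lam ^+ 2 * c5 ^+ (d + 2)) +
    k * c4 / P0) / (k * c1) / beta.
Proof.
move=> c10 P00 b00 c50 c40 pE bE qE kp N0 Ne N'e mPc.
have E0 : 0 < e ^+ d by rewrite exprn_gt0.
have p0 : 0 < p by rewrite pE mulr_gt0.
have b_gt0 : 0 < b by rewrite bE mulr_gt0.
have q0 : 0 < q by rewrite qE divr_gt0.
have kp0 : 0 < k * p by rewrite mulr_gt0.
have al : alpha <= lam ^+ 2 * k ^+ 2 * mQ * (e ^+ d * e ^+ 2) / (8 * Lam ^+ 2 * gam * c5 ^+ (d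
  + 2)).
  have -> : lam ^+ 2 * k ^+ 2 * mQ * (e ^+ d * e ^+ 2) / (8 * Lam ^+ 2 * gam * c5 ^+ (d + 2)) =
      lam ^+ 2 * k ^+ 2 * mQ / (8 * Lam ^+ 2 * gam) * ((e ^+ d * e ^+ 2) / c5 ^+ (d + 2)).
    by field; rewrite !lt0r_neq0// exprn_gt0.
  have -> : alpha = lam ^+ 2 * k ^+ 2 * mQ / (8 * Lam ^+ 2 * gam) * (N' ^+ (d + 2))^-1.
    by rewrite /alpha_const [(_ * N' ^+ _)^-1]invfM [LHS]mulrA.
  rewrite ler_pM2l; last by rewrite divr_gt0// !mulr_gt0// exprn_gt0.
  rewrite -exprD -lef_pV2 ?posrE ?invr_gt0 ?divr_gt0 ?exprn_gt0// invrK invf_div.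
  rewrite ler_pdivrMr ?exprn_gt0// -exprMn; apply: lerXn2r => //.
  - by rewrite nnegrE ltW.
  - by rewrite nnegrE ltW// mulr_gt0.
move: (alpha) alpha_gt0 beta_gt0 al => a a0 bet0 al.
rewrite ler_pdivlMr// mulrAC ler_pM2r ?invr_gt0 ?mulr_gt0//.
have b1 : beta_const a k mP gam <= a * k * mP / (2 * gam).
  apply: (@le_trans _ _ (4 * a * k * mP / (k * mP + 8 * gam))).
    by rewrite /beta_const ge_min lexx.
  have -> : a * k * mP / (2 * gam) = 4 * a * k * mP / (8 * gam).
    by field; rewrite lt0r_neq0.
  apply: ler_wpM2l; first by rewrite !mulr_ge0// ltW.
  by rewrite lef_pV2 ?posrE// ?mulr_gt0// lerDr mulr_ge0// ltW.
have b2 : beta_const a k mP gam <= k * (c4 * e ^+ d) / 2.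
  apply: (@le_trans _ _ (k * mP / 2)); first by rewrite /beta_const ge_min lexx orbT.
  by rewrite ler_pM2r// ler_pM2l.
rewrite mulrDl; apply: lerD; last first.
  apply: (@le_trans _ _ (2 / p * (k * (c4 * e ^+ d) / 2))).
    by rewrite ler_wpM2l// divr_ge0// ltW.
  by rewrite pE le_eqVlt; apply/orP; left; apply/eqP; field; rewrite !lt0r_neq0.
have Nn2 : Nn ^+ 2 <= cN ^+ 2 / e ^+ 2.
  rewrite ler_pdivlMr ?exprn_gt0// -exprMn lerXn2r ?nnegrE ?mulr_ge0// ?(ltW e0)//.
  by apply: le_trans Ne; rewrite mulr_ge0// ltW.
have g1 : 1 + 2 * gam / (k * p) <= 3 * gam / (k * p).
  have : 1 <= gam / (k * p) by rewrite ler_pdivlMr// mul1r.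
  rewrite -!mulrA; lra.
have mPg : mP / gam <= c4 / (k * P0).
  rewrite ler_pdivrMr// mulrAC ler_pdivlMr ?mulr_gt0//.
  apply: (@le_trans _ _ (c4 * e ^+ d * (k * P0))); first by rewrite ler_pM2r ?mulr_gt0.
  by rewrite -mulrA ler_pM2l//; apply: le_trans kp; rewrite pE; lra.
pose T := 36 * (cN ^+ 2 / e ^+ 2) * (2 * b / (p * q)) * (3 * gam / (k * p)).
pose A := lam ^+ 2 * k ^+ 2 * mQ * (e ^+ d * e ^+ 2) / (8 * Lam ^+ 2 * gam * c5 ^+ (d + 2)).
apply: (@le_trans _ _ (T * (A * k * mP / (2 * gam)))).
  apply: ler_pM.
  - by rewrite !mulr_ge0 ?sqr_ge0 ?invr_ge0 ?addr_ge0 ?mulr_ge0 ?invr_ge0 ?mulr_ge0 ?(ltW p0)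
    ?(ltW q0) ?(ltW b_gt0) ?(ltW gam_gt0) ?(ltW k_gt0).
  - exact: ltW.
  - apply: ler_pM => //.
    + by rewrite !mulr_ge0 ?sqr_ge0 ?invr_ge0 ?mulr_ge0 ?(ltW p0) ?(ltW q0) ?(ltW b_gt0).
    + by rewrite addr_ge0 ?divr_ge0 ?mulr_ge0 ?(ltW p0) ?(ltW gam_gt0) ?(ltW k_gt0).
    + rewrite ler_wpM2r ?ler_wpM2l//.
      by rewrite divr_ge0 ?mulr_ge0 ?(ltW p0) ?(ltW q0) ?(ltW b_gt0).
  apply: (le_trans b1); rewrite ler_pM2r ?invr_gt0 ?mulr_gt0// ler_pM2r// ler_pM2r//.
(* The coefficient is [27 = 36 * 4 * 3 / (8 * 2)], the 4 coming from [2 * b] and [q = mQ / 2]. *)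
have -> : T * (A * k * mP / (2 * gam)) =
    27 * cN ^+ 2 * b0 * lam ^+ 2 * k ^+ 2 / (P0 ^+ 2 * Lam ^+ 2 * c5 ^+ (d + 2)) * (mP / gam).
  by rewrite /T /A pE bE qE; field; rewrite !lt0r_neq0// exprn_gt0.
have -> : 27 * cN ^+ 2 * b0 * lam ^+ 2 * k * c4 / (P0 ^+ 3 * Lam ^+ 2 * c5 ^+ (d + 2)) =
    27 * cN ^+ 2 * b0 * lam ^+ 2 * k ^+ 2 / (P0 ^+ 2 * Lam ^+ 2 * c5 ^+ (d + 2)) * (c4 / (k * P0)).
  by field; rewrite !lt0r_neq0// exprn_gt0.
apply: ler_wpM2l => //.
have cN0 : 0 <= cN by apply: le_trans Ne; rewrite mulr_ge0// ltW.
by apply: divr_ge0; rewrite ?mulr_ge0 ?exprn_ge0 ?(ltW c50) ?(ltW b00) ?(ltW lam_gt0) ?(ltW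
  Lam_gt0) ?(ltW k_gt0) ?(ltW P00).
Qed.

(** The exponent [3 * d + 2] collects [e ^+ d] from [mP], [e ^+ d] from [mQ] and [e ^+ (d + 2)] from
    the power of [N'] in [alpha]. *)
Lemma beta_lower (G aP aQ c6 : R) : 0 < aP -> 0 < aQ -> 0 < c6 -> 0 < c4 -> gam <= G ->
  aP * e ^+ d <= mP -> mP <= c4 * e ^+ d -> aQ * e ^+ d <= mQ -> N' * e <= c6 ->
  Num.min (4 * (lam ^+ 2 * k ^+ 2 * aQ / (8 * Lam ^+ 2 * G * c6 ^+ (d + 2))) * k * aP /
    (k * c4 + 8 * G)) (k * aP / 2) * e ^+ (3 * d + 2) <= beta.
Proof.
move=> aP0 aQ0 c60 c40 gG mPl mPu mQl N'e.
have G0 : 0 < G by exact: lt_le_trans gam_gt0 gG.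
have E0 : 0 < e ^+ d by rewrite exprn_gt0.
have E1 m : e ^+ m <= 1 by rewrite exprn_ile1// ltW.
pose a0 := lam ^+ 2 * k ^+ 2 * aQ / (8 * Lam ^+ 2 * G * c6 ^+ (d + 2)).
have al : a0 * (e ^+ d * e ^+ (d + 2)) <= alpha.
  have -> : a0 * (e ^+ d * e ^+ (d + 2)) =
      (lam ^+ 2 * k ^+ 2 * (aQ * e ^+ d)) / (8 * Lam ^+ 2 * (G * (c6 / e) ^+ (d + 2))).
    rewrite /a0 exprMn exprVn; field.
    by rewrite !lt0r_neq0// ?exprn_gt0.
  rewrite /alpha_const; apply: ler_pM.
  - by rewrite ltW// !mulr_gt0// exprn_gt0.
  - by rewrite invr_ge0 ltW// !mulr_gt0 ?exprn_gt0 ?divr_gt0.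
  - by rewrite ler_pM2l// mulr_gt0// exprn_gt0.
  rewrite lef_pV2 ?posrE; last 2 first.
  - by rewrite !mulr_gt0 ?exprn_gt0// ?divr_gt0.
  - by rewrite !mulr_gt0 ?exprn_gt0.
  rewrite -[8 * Lam ^+ 2 * gam * _]mulrA ler_pM2l; last by rewrite mulr_gt0// exprn_gt0.
  apply: ler_pM => //; [exact: ltW|by rewrite exprn_ge0// ltW|].
  apply: lerXn2r; rewrite ?nnegrE.
  - exact: ltW.
  - by rewrite ltW// divr_gt0.
  - by rewrite ler_pdivlMr.
have a00 : 0 < a0 by rewrite divr_gt0// !mulr_gt0// exprn_gt0.
rewrite -/a0; clearbody a0; move: (alpha) al => a al.
rewrite /beta_const le_min; apply/andP; split.
  apply: (@le_trans _ _ (4 * a0 * k * aP / (k * c4 + 8 * G) * e ^+ (3 * d + 2))).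
    by rewrite ler_pM2r ?exprn_gt0// ge_min lexx.
  have -> : 4 * a0 * k * aP / (k * c4 + 8 * G) * e ^+ (3 * d + 2) =
      (4 * (a0 * (e ^+ d * e ^+ (d + 2))) * k * (aP * e ^+ d)) / (k * c4 + 8 * G).
    rewrite [in LHS]expr_3d2 !exprD; field.
    by rewrite lt0r_neq0// addr_gt0// mulr_gt0.
  apply: ler_pM.
  - by rewrite !mulr_ge0 ?exprn_ge0 ?(ltW a00) ?(ltW k_gt0) ?(ltW aP0) ?(ltW e0).
  - by rewrite invr_ge0 addr_ge0// mulr_ge0// ltW.
  - apply: ler_pM => //.
    + by rewrite !mulr_ge0 ?exprn_ge0 ?(ltW a00) ?(ltW k_gt0) ?(ltW e0).
    + by rewrite mulr_ge0// ltW.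
    + by rewrite ler_pM2r// ler_pM2l.
  - rewrite lef_pV2 ?posrE//; last by rewrite addr_gt0// mulr_gt0.
    rewrite lerD ?ler_pM2l// (le_trans mPu)//.
    by rewrite ger_pMr.
apply: (@le_trans _ _ (k * aP / 2 * e ^+ (3 * d + 2))).
  by rewrite ler_pM2r ?exprn_gt0// ge_min lexx orbT.
apply: (@le_trans _ _ (k * aP / 2 * e ^+ d)).
  rewrite ler_pM2l ?divr_gt0 ?mulr_gt0// expr_3d2 -mulrA ger_pMr//.
  by rewrite -exprD E1.
have -> : k * aP / 2 * e ^+ d = k * (aP * e ^+ d) / 2 by ring.
by rewrite ler_pM2r// ler_pM2l.
Qed.

End rate_constants.

Section diameter.
Context {R : realType} {d : nat}.
Variables (P : probability 'rV[R]_d R) (rho : 'rV[R]_d -> R) (lam Lam Dx : R).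
Hypotheses (d_gt0 : (0 < d)%N) (lam_gt0 : 0 < lam) (rho_density : has_lebesgue_density P rho)
  (rho_bounds : forall x, msupport P x -> lam <= rho x <= Lam).
Hypothesis diam : forall x x', msupport P x -> msupport P x' -> enorm (x - x') <= Dx.

(** Zero diameter would put all the mass in a ball of radius [1 / (2 * (Lam + 1))], although the
    density bound and [0 < d] make its mass smaller than 1. *)
Lemma ediam_gt0 : 0 < ediam (msupport P).
Proof.
have [x0 Ox0] := msupport_nonempty P.
have L0 := density_upper_gt0 lam_gt0 rho_bounds.
rewrite ltNge; apply/negP => diam0.
have sub0 x : msupport P x -> enorm (x - x0) <= 0.
  move=> Ox; apply: le_trans diam0; apply: sup_ubound; last by exists x => //; exists x0.
  by exists Dx => _ [u Ou [v Ov <-]]; exact: diam.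
have r0 : 0 < (2 * (Lam + 1))^-1 by rewrite invr_gt0 mulr_gt0// addr_gt0.
have := prob_eball_le lam_gt0 rho_density rho_bounds x0 (ltW r0).
apply/negP; rewrite -ltNge.
apply: (@lt_le_trans _ _ 1%E); last first.
  rewrite -(msupport_full P); apply: le_measure; rewrite ?inE.
  - exact: measurable_msupport.
  - exact: measurable_eball.
  - by move=> x /sub0 x0x; rewrite /eball/= (le_lt_trans x0x).
have L1 : 0 < Lam + 1 by rewrite addr_gt0.
rewrite lte_fin invfM mulrA divff// mul1r.
apply: (@le_lt_trans _ _ (Lam * (Lam + 1)^-1)).
  rewrite ler_pM2l// -[leRHS]expr1 ler_wiXn2l ?invr_ge0 ?(ltW L1)//.
  by rewrite invf_le1// lerDr ltW.
by rewrite ltr_pdivrMr// mul1r ltrDl.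
Qed.

End diameter.

Section ball_mass_lower.
Context {R : realType} {d : nat}.
Variables (P : probability 'rV[R]_d R) (rho : 'rV[R]_d -> R) (lam Lam kap : R).
Hypotheses (lam_gt0 : 0 < lam) (rho_density : has_lebesgue_density P rho)
  (rho_bounds : forall x, msupport P x -> lam <= rho x <= Lam)
  (P_convex : convex_set (msupport P)) (kap_gt0 : 0 < kap).

Let Lam_gt0 : 0 < Lam := density_upper_gt0 lam_gt0 rho_bounds.

Lemma support_diam M : (forall x i, (msupport P) x -> `|x ord0 i| <= M) ->
  forall x x', (msupport P) x -> (msupport P) x' -> enorm (x - x') <= d%:R * (M + M).
Proof.
move=> OM x x' Ox Ox'; apply: enorm_le_coord => i; rewrite !mxE.
by rewrite (le_trans (ler_normB _ _))// lerD ?OM.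
Qed.

Lemma prob_eball_lower M z a eps : (forall x i, (msupport P) x -> `|x ord0 i| <= M) -> 0 < a <= 1 ->
  0 < eps <= 1 -> (msupport P) z ->
  lam / Lam * (a * kap / (d%:R * (M + M) + kap)) ^+ d * eps ^+ d <=
  fine (P (eball z (a * (kap * eps)))).
Proof.
move=> OM /andP[a0 a1] /andP[e0 e1] Oz.
have DM0 : 0 <= d%:R * (M + M).
  by apply: le_trans (support_diam OM Oz Oz); exact: enorm_ge0.
have D0 : 0 < d%:R * (M + M) + kap by exact: ltr_wpDl.
have akap : a * (kap * eps) <= d%:R * (M + M) + kap.
  apply: (@le_trans _ _ kap); last by rewrite lerDr.
  rewrite mulrCA -[leRHS]mulr1 ler_pM2l//.
  by rewrite mulr_ile1// ltW.
have r0 : 0 < a * (kap * eps) by exact: mulr_gt0 a0 (mulr_gt0 kap_gt0 e0).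
have := prob_eball_ge lam_gt0 rho_density rho_bounds P_convex Oz (r := a * (kap * eps))
  (D := d%:R * (M + M) + kap) _ _.
rewrite r0 akap => /(_ isT).
have OD x : (msupport P) x -> enorm (x - z) < d%:R * (M + M) + kap.
  by move=> Ox; rewrite (le_lt_trans (support_diam OM Ox Oz))// ltrDl.
move=> /(_ OD).
rewrite -prob_fineK ?lee_fin//; last exact: measurable_eball.
apply: le_trans; rewrite -mulrA -exprMn ler_wpM2l//; last first.
  by rewrite le_eqVlt; apply/orP; left; apply/eqP; congr (_ ^+ _); ring.
by rewrite divr_ge0// ltW.
Qed.

Lemma min_ball_mass_lower M : (forall x i, msupport P x -> `|x ord0 i| <= M) ->
  exists2 a, 0 < a & forall eps, 0 < eps <= 1 ->
    a * eps ^+ d <= min_ball_mass P (msupport P) (2 * (kap * eps)).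
Proof.
move=> OM; have [x0 Ox0] := msupport_nonempty P.
have D0 : 0 < d%:R * (M + M) + kap.
  by apply: ltr_wpDl kap_gt0; apply: le_trans (support_diam OM Ox0 Ox0); exact: enorm_ge0.
exists (lam / Lam * (1 * kap / (d%:R * (M + M) + kap)) ^+ d).
  by apply: mulr_gt0; [exact: divr_gt0|rewrite exprn_gt0// divr_gt0// mul1r].
move=> eps e01; have [e0 _] := andP e01.
apply: le_min_ball_mass; first by exists x0.
move=> x Ox; apply: (le_trans (prob_eball_lower OM _ e01 Ox)); first by rewrite ltr01 lexx.
apply: fine_prob_homo; [exact: measurable_eball..|apply: sub_eball].
rewrite subrr enorm0 add0r mul1r ler_peMl ?ler1n//.
exact: ltW (mulr_gt0 kap_gt0 e0).
Qed.

End ball_mass_lower.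

Section rate.
Variables (R : realType) (d : nat) (P Q : probability 'rV[R]_d R).
Local Notation Omega := (msupport P).
Local Notation Omega' := (msupport Q).
Variables (c : 'rV[R]_d -> 'rV[R]_d -> R) (L : R) (phi psi2 : R -> R) (delta t : R)
  (rho : 'rV[R]_d -> R) (lam Lam : R) (pi_ : R -> probability ('rV[R]_d * 'rV[R]_d)%type R)
  (dS : measure_display) (S : measurableType dS) (Pr : probability S R)
  (X Y : nat -> S -> 'rV[R]_d)
  (fhat ghat : forall n : nat, R ->
    n.-tuple 'rV[R]_d -> n.-tuple 'rV[R]_d -> 'rV[R]_d -> R)
  (gamma : nat -> R -> R).
Hypotheses (d_gt0 : (0 < d)%N) (Omega_compact : compact Omega)
  (Omega_compact' : compact Omega') (L_gt0 : 0 < L) (c_lip : cost_lipschitz Omega Omega' L c)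
  (phi_reg : regularization phi delta t)
  (psi2P : nondecreasing_second_derivative (convex_conj phi) psi2)
  (psi2_gt0 : 0 < psi2 (t - delta)) (Omega_convex : convex_set Omega)
  (lam_gt0 : 0 < lam) (rho_density : has_lebesgue_density P rho)
  (rho_bounds : forall x, Omega x -> lam <= rho x <= Lam)
  (pi_opt : forall eps, 0 < eps -> OT_optimizer Omega Omega' c phi eps P Q (pi_ eps))
  (mX : forall i, measurable_fun setT (X i)) (mY : forall j, measurable_fun setT (Y j))
  (X_law : forall i A, measurable A -> Pr (X i @^-1` A) = P A)
  (Y_law : forall j A, measurable A -> Pr (Y j @^-1` A) = Q A)
  (XY_indep : mutually_independent Pr
    (fun k : nat + nat => match k with inl i => X i | inr j => Y j end))
  (fghatP : forall n eps (xs ys : n.-tuple 'rV[R]_d), (0 < n)%N -> 0 < eps ->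
    (forall i, Omega (tnth xs i)) -> (forall j, Omega' (tnth ys j)) ->
    potentials Omega Omega' c (convex_conj phi) eps
      (empirical xs) (empirical ys) (fhat eps xs ys) (ghat eps xs ys))
  (gamma_gt0 : forall n eps, (0 < n)%N -> 0 < eps -> 0 < gamma n eps)
  (gammaP : forall n eps, (0 < n)%N -> 0 < eps -> {ae Pr, forall w, forall i : 'I_n,
    avg (fun j : 'I_n => psi2 ((fhat eps (sample X n w) (sample Y n w) (X i w) +
      ghat eps (sample X n w) (sample Y n w) (Y j w) - c (X i w) (Y j w)) / eps + delta / 4))
      <= gamma n eps}).

Local Notation k := (psi2 (t - delta)).
Local Notation ballP eps := (min_ball_mass P Omega (delta * eps / (8 * L))).
Local Notation ballQ eps := (min_ball_mass Q Omega' (delta * eps / (8 * L))).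
Local Notation Nc eps := ((Num.ceil (16 * L * ediam Omega / (delta * eps)))%:~R : R).
Local Notation alpha n eps := (alpha_const d lam Lam k (ballQ eps) (gamma n eps) (Nc eps)).
Local Notation beta n eps := (beta_const (alpha n eps) k (ballP eps) (gamma n eps)).
Local Notation var_rho eps := (fine 'V_(prod_prob P Q)[coupling_density P Q (pi_ eps)]).
Local Notation OT_PQ eps := (fine (OT Omega Omega' c phi eps P Q)).
Local Notation OT_hat n eps := (fun w => fine (OT Omega Omega' c phi eps
  (empirical (sample X n w)) (empirical (sample Y n w)))).
Local Notation bias n eps := (fine 'E_Pr[OT_hat n eps] - OT_PQ eps).

Let delta_gt0 : 0 < delta := reg_delta_gt0 phi_reg.
Let Lam_gt0 : 0 < Lam := density_upper_gt0 lam_gt0 rho_bounds.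
Variable kap : R.
Hypothesis kapE : kap = delta / (16 * L).
Let kap_gt0 : 0 < kap. Proof. by rewrite kapE divr_gt0// mulr_gt0. Qed.

(** The radius in the statement is twice [rad = kap * eps], the radius of the balls of the chain. *)
Let ball_radius eps : delta * eps / (8 * L) = 2 * (kap * eps).
Proof. by rewrite kapE; field; rewrite lt0r_neq0. Qed.

Lemma support_bound : exists2 M, 0 <= M &
  (forall x i, Omega x -> `|x ord0 i| <= M) /\ (forall y i, Omega' y -> `|y ord0 i| <= M).
Proof.
have [M1 M10 OM1] := compact_coord_bounded Omega_compact.
have [M2 M20 OM2] := compact_coord_bounded Omega_compact'.
exists (M1 + M2); first by rewrite addr_ge0.
split=> x i Ox; first by rewrite (le_trans (OM1 x i Ox))// lerDl.
by rewrite (le_trans (OM2 x i Ox))// lerDr.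
Qed.

Lemma ballP_gt0 eps : 0 < eps -> 0 < ballP eps.
Proof.
move=> e0; have [M _ [OM _]] := support_bound; apply: (min_ball_mass_gt0 OM).
by rewrite divr_gt0 ?mulr_gt0.
Qed.

Lemma ballQ_gt0 eps : 0 < eps -> 0 < ballQ eps.
Proof.
move=> e0; have [M _ [_ OM]] := support_bound; apply: (min_ball_mass_gt0 OM).
by rewrite divr_gt0 ?mulr_gt0.
Qed.

Lemma prob_eball_upper z a eps : 0 <= a -> 0 <= eps ->
  fine (P (eball z (a * (kap * eps)))) <= Lam * (2 * a * kap) ^+ d * eps ^+ d.
Proof.
move=> a0 e0; have r0 : 0 <= a * (kap * eps) by exact: mulr_ge0 a0 (mulr_ge0 (ltW kap_gt0) e0).
have := prob_eball_le lam_gt0 rho_density rho_bounds z r0.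
rewrite -prob_fineK ?lee_fin//; last exact: measurable_eball.
by move=> /le_trans; apply; rewrite -mulrA -exprMn !mulrA.
Qed.

Lemma ballP_upper eps : 0 < eps -> ballP eps <= Lam * (4 * kap) ^+ d * eps ^+ d.
Proof.
move=> e0; have [x0 Ox0] := msupport_nonempty P.
apply: (le_trans (min_ball_mass_le P _ Ox0)); rewrite ball_radius.
have -> : 4 = 2 * 2 :> R by rewrite -natrM.
by apply: prob_eball_upper => //; exact: ltW.
Qed.

Lemma net_exists (D : set 'rV[R]_d) M eps : 0 <= M -> (forall x i, D x -> `|x ord0 i| <= M) ->
  0 < eps <= 1 -> exists zs : seq 'rV[R]_d,
  [/\ (size zs)%:R * eps ^+ d <= (4 * M * d%:R / kap + 4) ^+ d,
      forall z, z \in zs -> D z &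
      forall x, D x -> exists2 z, z \in zs & enorm (x - z) <= kap * eps / 2].
Proof.
move=> M0 DM /andP[e0 e1]; have d0 : 0 < d%:R :> R by rewrite ltr0n.
have rad0 : 0 < kap * eps by exact: mulr_gt0.
have s0 : 0 < 2 * d%:R / (kap * eps) by rewrite divr_gt0 ?mulr_gt0.
have [zs [zsn zsD net]] := finite_net M0 s0 DM.
have ds : d%:R / (2 * d%:R / (kap * eps)) = kap * eps / 2.
  by field; rewrite !lt0r_neq0.
exists zs; split=> //; last by rewrite -ds.
apply: (@le_trans _ _ ((2 * M * (2 * d%:R / (kap * eps)) + 4) ^+ d * eps ^+ d)).
  by rewrite ler_wpM2r// exprn_ge0// ltW.
rewrite -exprMn; have e : (2 * M * (2 * d%:R / (kap * eps)) + 4) * eps = 4 * M * d%:R / kap + 4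
  * eps.
  by field; rewrite !lt0r_neq0.
have q0 : 0 <= 4 * M * d%:R / kap by apply: divr_ge0 (ltW kap_gt0); rewrite !mulr_ge0.
have e4 : 0 <= 4 * eps by rewrite mulr_ge0// ltW.
rewrite e; apply: lerXn2r; [exact: addr_ge0|exact: addr_ge0|].
by rewrite lerD2l ler_piMr.
Qed.

(** Fixes every constant before [n] and [eps]: the powers of [eps] are split off from the masses,
    the net sizes and the chain length, then compared with [beta] and the minimal ball masses. *)
Lemma rate_bound : exists2 K, 0 < K & forall n eps, (0 < n)%N -> 0 < eps <= 1 ->
  bias n eps ^+ 2 <= K * (var_rho eps ^+ 2 / (beta n eps ^+ 2 * n%:R ^+ 2) +
    var_rho eps / n%:R ^+ 2 * (ballP eps ^- 2 + ballQ eps ^- 2)).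
Proof.
have [M M0 [OM OM']] := support_bound.
have diam := support_diam OM; set Dx := d%:R * (M + M) in diam.
have [x0 Ox0] := msupport_nonempty P; have [y0 Oy0] := msupport_nonempty Q.
have Dx0 : 0 <= Dx by exact: le_trans (enorm_ge0 _) (diam _ _ Ox0 Ox0).
have ed0 : 0 < ediam Omega by exact: ediam_gt0 d_gt0 lam_gt0 rho_density rho_bounds diam.
have diam' y y' : Omega' y -> Omega' y' -> enorm (y - y') <= Dx.
  move=> Oy Oy'; apply: enorm_le_coord => i; rewrite !mxE.
  by rewrite (le_trans (ler_normB _ _))// lerD ?OM'.
pose Cc := `|c x0 y0| + L * (Dx + Dx).
have c_bound x y : Omega x -> Omega' y -> `|c x y| <= Cc.
  move=> Ox Oy; have := cost_lip L_gt0 c_lip Ox Ox0 Oy Oy0.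
  have : L * (enorm (x - x0) + enorm (y - y0)) <= L * (Dx + Dx).
    by rewrite ler_pM2l//; apply: lerD; [exact: diam|exact: diam'].
  have := ler_normD (c x y - c x0 y0) (c x0 y0); rewrite subrK /Cc; lra.
have Cc0 : 0 <= Cc by exact: le_trans (normr_ge0 _) (c_bound _ _ Ox0 Oy0).
clearbody Cc; pose B0 := `|t| + Cc + L * Dx.
have B00 : 0 <= B0 by rewrite !addr_ge0// mulr_ge0// ltW.
(* The [+ 1] keeps the denominator positive even if [B0] vanishes. *)
pose c1 := Num.min 1 (delta / 4 / (4 * B0 + 1)).
have q1 : 0 < 4 * B0 + 1 by rewrite ltr_wpDl// mulr_ge0.
have c10 : 0 < c1 by rewrite lt_min ltr01/= !divr_gt0.
have c1P : 0 < c1 <= 1 by rewrite c10 ge_min lexx.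
have c1_delta : c1 * (4 * B0) <= delta / 4.
  apply: (@le_trans _ _ (c1 * (4 * B0 + 1))); first by rewrite ler_pM2l// lerDl.
  by rewrite -ler_pdivlMr// ge_min lexx orbT.
(* Half of the lower bound for balls of radius [rad / 2], the other half being the margin allowed to
   the sample. *)
pose P0 := lam / Lam * (1 / 2 * kap / (Dx + kap)) ^+ d / 2.
have Dk : 0 < Dx + kap by exact: ltr_wpDl.
have P00 : 0 < P0.
  by rewrite divr_gt0// mulr_gt0 ?divr_gt0// exprn_gt0// divr_gt0// mulr_gt0.
pose b0 := Lam * (2 * 9 * kap) ^+ d.
have b00 : 0 < b0 by rewrite mulr_gt0// exprn_gt0// mulr_gt0// mulr_gt0.
pose c4 := Lam * (4 * kap) ^+ d.
have c40 : 0 < c4 by rewrite mulr_gt0// exprn_gt0// mulr_gt0.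
pose cN := Dx / kap + 1.
pose c5 := 16 * L * ediam Omega / delta.
have c50 : 0 < c5 by rewrite divr_gt0// !mulr_gt0.
pose A0 := (4 * M * d%:R / kap + 4) ^+ d.
have A00 : 0 <= A0.
  by rewrite exprn_ge0// addr_ge0// divr_ge0 ?(ltW kap_gt0)// !mulr_ge0.
pose K0 := (27 * cN ^+ 2 * b0 * lam ^+ 2 * k * c4 / (P0 ^+ 3 * Lam ^+ 2 * c5 ^+ (d + 2)) +
    k * c4 / P0) / (k * c1).
have K00 : 0 <= K0.
  apply: divr_ge0; last by rewrite mulr_ge0// ltW.
  have h : 0 <= 27 * cN ^+ 2 * b0 * lam ^+ 2 * k * c4.
    by rewrite mulr_ge0 ?(ltW c40)// mulr_ge0 ?(ltW psi2_gt0)// mulr_ge0 ?sqr_ge0// mulr_ge0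
      ?(ltW b00)// mulr_ge0// sqr_ge0.
  apply: addr_ge0; first apply: divr_ge0 h _.
    by apply: ltW; apply: mulr_gt0; [apply: mulr_gt0; exact: exprn_gt0|exact: exprn_gt0].
  by apply: divr_ge0 (ltW P00); apply: mulr_ge0; exact: ltW.
pose C5 := (A0 * (b0 / P0 ^+ 2 + b0^-1) + 2 * A0) * c4 ^+ 2 + 2 * A0.
have C50 : 0 <= C5.
  have h : 0 <= b0 / P0 ^+ 2 + b0^-1.
    by apply: addr_ge0; [apply: divr_ge0; [exact: ltW|exact: sqr_ge0]|rewrite invr_ge0 ltW].
  apply: addr_ge0; last exact: mulr_ge0.
  by apply: mulr_ge0 (sqr_ge0 _); apply: addr_ge0; exact: mulr_ge0.
exists (8 * K0 ^+ 2 + 128 * B0 ^+ 2 * C5 + 1).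
  by rewrite ltr_wpDl// addr_ge0// mulr_ge0 ?sqr_ge0// mulr_ge0 ?sqr_ge0.
move=> n eps n_gt0 e01; have [e0 e1] := andP e01.
have nR : 0 < n%:R :> R by rewrite ltr0n.
have mP0 := ballP_gt0 e0; have mQ0 := ballQ_gt0 e0.
have mPc := ballP_upper e0; rewrite -/c4 in mPc.
have E0 : 0 < eps ^+ d by rewrite exprn_gt0.
have [zs [zsn zsO net]] := net_exists M0 OM e01.
have [zs' [zsn' zsO' net']] := net_exists M0 OM' e01.
pose rad := kap * eps; have rad0 : 0 < rad by exact: mulr_gt0.
have radE : rad = delta * eps / (16 * L) by rewrite /rad kapE mulrAC.
(* The number of steps making each piece of a segment in [Omega] shorter than [rad]. *)
pose N := (Num.trunc (Dx / rad)).+1.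
have N_diam : Dx < N%:R * rad by rewrite -ltr_pdivrMr// truncnS_gt.
have Ne : N%:R * eps <= cN.
  have Nd : N%:R <= Dx / rad + 1.
    rewrite /N -natr1 lerD2r; have := trunc_itv (divr_ge0 Dx0 (ltW rad0)).
    by case/andP.
  apply: (le_trans (ler_wpM2r (ltW e0) Nd)).
  rewrite mulrDl mul1r /cN lerD// le_eqVlt; apply/orP; left; apply/eqP.
  by rewrite /rad invfM mulrA divfK// lt0r_neq0.
have N'0 : 0 < Nc eps.
  apply: (@lt_le_trans _ _ (16 * L * ediam Omega / (delta * eps))); last exact: ceil_ge.
  by rewrite divr_gt0// !mulr_gt0.
have N'e : c5 <= Nc eps * eps.
  rewrite -ler_pdivrMr// (_ : c5 / eps = 16 * L * ediam Omega / (delta * eps)); first exact: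
    ceil_ge.
  by rewrite /c5 invfM mulrA.
pose p := P0 * eps ^+ d; pose b := b0 * eps ^+ d; pose q := ballQ eps / 2.
have p0 : 0 < p by rewrite mulr_gt0.
have bb0 : 0 < b by rewrite mulr_gt0.
have q0 : 0 < q by rewrite divr_gt0.
have gam0 := gamma_gt0 n_gt0 e0.
have beta0 := beta_gt0 d psi2_gt0 lam_gt0 Lam_gt0 mP0 mQ0 gam0 N'0.
have P_ge z : z \in zs -> 2 * p <= fine (P (eball z (rad / 2))).
  move=> zzs; have h12 : 0 < (1 / 2 : R) <= 1 by apply/andP; split; lra.
  have := prob_eball_lower lam_gt0 rho_density rho_bounds Omega_convex kap_gt0 OM h12 e01 (zsO
    z zzs).
  have -> : 1 / 2 * (kap * eps) = rad / 2 by rewrite mul1r mulrC.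
  by apply: le_trans; rewrite /p /P0 -/Dx mulrA [2 * _]mulrC divfK.
have P_le z : fine (P (eball z (9 * rad))) <= b.
  exact: prob_eball_upper (ltW e0).
have Q_ge z : z \in zs' -> 2 * q <= fine (Q (eball z (2 * rad))).
  move=> zzs; rewrite /q mulrC divfK// -ball_radius; apply: min_ball_mass_le; exact: zsO'.
have net2 y : Omega' y -> exists2 z, z \in zs' & enorm (y - z) <= 2 * rad.
  move=> /net'[z zzs yz]; exists z => //; apply: (le_trans yz).
  by rewrite -/rad; lra.
have [bias0 biasP] := bias_bound mX mY X_law Y_law XY_indep phi_reg psi2P psi2_gt0
  L_gt0 e0 e1 c_lip c_bound diam M0 OM OM' Omega_convex
  (fun m xs ys m0 xsO ysO => fghatP m0 e0 xsO ysO) n_gt0 (gammaP n_gt0 e0)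
  radE p0 bb0 q0 (ltn0Sn _ : (0 < N)%N)
  (fun x x' Ox Ox' => le_lt_trans (diam x x' Ox Ox') N_diam) P_ge P_le Q_ge net net2 c1P c1_delta
  (divr_ge0 K00 (ltW beta0))
  (fun kp => theta_le_beta psi2_gt0 lam_gt0 Lam_gt0 e01 mP0 mQ0 gam0 N'0 c10 P00 b00 c50 c40
     (erefl _) (erefl _) (erefl _) kp (ler0n _ _) Ne N'e mPc) (pi_opt e0).
move: bias0 biasP; set x := bias n eps; set dr := ((size zs)%:R * (b / p ^+ 2 + b^-1) + (size
  zs')%:R * (2 / q)) / n%:R => bias0 biasP.
have {P_ge P_le Q_ge net net' net2} var0 : 0 <= var_rho eps by apply: fine_ge0; exact: variance_ge0.
pose mm := ballP eps ^- 2 + ballQ eps ^- 2.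
have mm0 : 0 <= mm by apply: addr_ge0; rewrite invr_ge0 sqr_ge0.
have drP : dr <= C5 * mm / n%:R.
  rewrite /dr ler_pM2r ?invr_gt0//; set w := (eps ^+ d)^-1.
  have w0 : 0 <= w by rewrite invr_ge0 ltW.
  have size_le (s : nat) : s%:R * eps ^+ d <= A0 -> s%:R <= A0 * w.
    by move=> ?; rewrite /w ler_pdivlMr.
  (* Net sizes and reciprocal masses are powers of [w], that is [eps] to the [-d]; the upper density
     bound on [ballP] turns these powers into reciprocal ball masses, as the bound requires. *)
  have w_mP : w <= c4 / ballP eps by rewrite /w -div1r ler_pdivrMr// mulrAC ler_pdivlMr// mul1r.
  have w2 : w ^+ 2 <= c4 ^+ 2 * ballP eps ^- 2.
    by rewrite -exprVn -exprMn; apply: lerXn2r => //; rewrite nnegrE// divr_ge0// ltW.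
  have t1 : (size zs)%:R * (b / p ^+ 2 + b^-1) <= A0 * (b0 / P0 ^+ 2 + b0^-1) * w ^+ 2.
    have -> : b / p ^+ 2 + b^-1 = (b0 / P0 ^+ 2 + b0^-1) * w.
      by rewrite /b /p /w; field; rewrite !lt0r_neq0.
    have -> : A0 * (b0 / P0 ^+ 2 + b0^-1) * w ^+ 2 = A0 * w * ((b0 / P0 ^+ 2 + b0^-1) * w) by ring.
    apply: ler_wpM2r; last exact: size_le.
    apply: mulr_ge0 w0; apply: addr_ge0; last by rewrite invr_ge0 ltW.
    by apply: divr_ge0; [exact: ltW|exact: sqr_ge0].
  have t2 : (size zs')%:R * (2 / q) <= 2 * A0 * (w ^+ 2 + ballQ eps ^- 2).
    have -> : 2 / q = 4 * (ballQ eps)^-1 by rewrite /q; field; rewrite lt0r_neq0.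
    set v := (ballQ eps)^-1; have v0 : 0 <= v by rewrite invr_ge0 ltW.
    apply: (@le_trans _ _ (A0 * w * (4 * v))).
      by apply: ler_wpM2r (size_le _ zsn'); exact: mulr_ge0.
    have -> : A0 * w * (4 * v) = 2 * A0 * (2 * (w * v)) by ring.
    apply: ler_wpM2l; first exact: mulr_ge0.
    by rewrite -exprVn -/v; have := sqr_ge0 (w - v); rewrite !expr2; lra.
  apply: (le_trans (lerD t1 t2)).
  have c2 : 0 <= A0 * (b0 / P0 ^+ 2 + b0^-1) + 2 * A0.
    apply: addr_ge0; apply: mulr_ge0 => //; apply: addr_ge0; last by rewrite invr_ge0 ltW.
    by apply: divr_ge0; [exact: ltW|exact: sqr_ge0].
  have c2w := ler_wpM2l c2 w2.
  have -> : C5 * mm = (A0 * (b0 / P0 ^+ 2 + b0^-1) + 2 * A0) * (c4 ^+ 2 * ballP eps ^- 2) +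
    (A0 * (b0 / P0 ^+ 2 + b0^-1) + 2 * A0) * c4 ^+ 2 * ballQ eps ^- 2 +
    2 * A0 * ballP eps ^- 2 + 2 * A0 * ballQ eps ^- 2 by rewrite /C5 /mm; ring.
  have z1 : 0 <= (A0 * (b0 / P0 ^+ 2 + b0^-1) + 2 * A0) * c4 ^+ 2 * ballQ eps ^- 2.
    by apply: mulr_ge0; [apply: mulr_ge0 c2 (sqr_ge0 _)|rewrite invr_ge0 sqr_ge0].
  have z2 : 0 <= 2 * A0 * ballP eps ^- 2.
    by apply: mulr_ge0; [exact: mulr_ge0|rewrite invr_ge0 sqr_ge0].
  rewrite mulrDl in c2w; rewrite mulrDr; lra.
set var := var_rho eps in var0 biasP *; set bet := beta n eps in beta0 biasP *.
have A0' : 0 <= K0 / bet * (2 * var / n%:R).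
  by apply: mulr_ge0; [apply: divr_ge0 K00 (ltW beta0)|apply: divr_ge0 (ltW nR); exact: mulr_ge0].
have v0 : 0 <= 2 * var / n%:R by apply: divr_ge0 (ltW nR); exact: mulr_ge0.
have B02 : 0 <= 8 * B0 ^+ 2 by apply: mulr_ge0 (sqr_ge0 _).
have m0 : 0 <= 8 * B0 ^+ 2 * (C5 * mm / n%:R).
  by apply: mulr_ge0 B02 _; apply: divr_ge0 (ltW nR); exact: mulr_ge0.
(* Both the part proportional to [tau] and the part proportional to [1 / tau] carry a factor
   [1 / n], so their product has the announced [1 / n ^ 2]; the constants are [8 = 2 * 2 ^ 2] and
   [128 = 8 * 2 * 8]. *)
have := optimize_rate bias0 A0' v0 m0 _ => /(_ _)/le_trans; apply.
  move=> tau tau0; apply: (le_trans (biasP tau tau0)).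
  rewrite [(K0 / bet + tau) * _]mulrDl lerD2l.
  rewrite [leLHS]mulrAC ler_pM2r ?invr_gt0//; exact: ler_wpM2l.
have -> : 2 * (K0 / bet * (2 * var / n%:R)) ^+ 2 +
    8 * (2 * var / n%:R * (8 * B0 ^+ 2 * (C5 * mm / n%:R))) =
    8 * K0 ^+ 2 * (var ^+ 2 / (bet ^+ 2 * n%:R ^+ 2)) +
    128 * B0 ^+ 2 * C5 * (var / n%:R ^+ 2 * mm).
  by field; rewrite !lt0r_neq0.
have k1 : 0 <= 8 * K0 ^+ 2 by exact: mulr_ge0 (sqr_ge0 _).
have k2 : 0 <= 128 * B0 ^+ 2 * C5 by apply: mulr_ge0 C50; exact: mulr_ge0 (sqr_ge0 _).
rewrite -/mm; move: (8 * K0 ^+ 2) (128 * B0 ^+ 2 * C5) k1 k2 => u v u0 v1.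
rewrite [leRHS]mulrDr; apply: lerD; apply: ler_wpM2r.
- by apply: divr_ge0; [exact: sqr_ge0|apply: mulr_ge0; exact: sqr_ge0].
- lra.
- by apply: mulr_ge0 mm0; apply: divr_ge0 var0 _; exact: sqr_ge0.
- lra.
Qed.

(** Convexity and two-sided density bounds on both sides make the two minimal ball masses at least a
    multiple of [eps ^+ d]; squaring the lower bound on [beta] doubles [3 * d + 2]. *)
Lemma rate_bound_uniform : convex_set Omega' ->
  (exists (rho' : 'rV[R]_d -> R) (lam' Lam' : R),
     [/\ 0 < lam', has_lebesgue_density Q rho' &
         forall y, Omega' y -> lam' <= rho' y <= Lam']) ->
  (exists G : R, forall n eps, (0 < n)%N -> 0 < eps -> gamma n eps <= G) ->
  exists2 K, 0 < K & forall n eps, (0 < n)%N -> 0 < eps <= 1 ->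
    bias n eps ^+ 2 <= K * (eps ^- (6 * d + 4) * var_rho eps ^+ 2 / n%:R ^+ 2 +
      eps ^- (2 * d) * var_rho eps / n%:R ^+ 2).
Proof.
move=> convQ [rho' [lam' [Lam' [lam'0 dens' bounds']]]] [G gamG].
have [M M0 [OM OM']] := support_bound.
have diam := support_diam OM; have ed0 := ediam_gt0 d_gt0 lam_gt0 rho_density rho_bounds diam.
have [aP aP0 mPl] := min_ball_mass_lower lam_gt0 rho_density rho_bounds Omega_convex kap_gt0 OM.
have [aQ aQ0 mQl] := min_ball_mass_lower lam'0 dens' bounds' convQ kap_gt0 OM'.
have [K K0 rate] := rate_bound.
pose c4 := Lam * (4 * kap) ^+ d.
have c40 : 0 < c4 by apply: mulr_gt0 => //; apply: exprn_gt0; exact: mulr_gt0.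
pose c6 := 16 * L * ediam Omega / delta + 1.
have c60 : 0 < c6 by apply: addr_gt0 => //; apply: divr_gt0 => //; rewrite !mulr_gt0.
(* Positivity of the uniform bound is read off at [n = 1], [eps = 1]. *)
have G0 : 0 < G by exact: lt_le_trans (gamma_gt0 (ltn0Sn 0) ltr01) (gamG _ _ (ltn0Sn 0) ltr01).
pose cb := Num.min (4 * (lam ^+ 2 * k ^+ 2 * aQ / (8 * Lam ^+ 2 * G * c6 ^+ (d + 2))) * k * aP /
    (k * c4 + 8 * G)) (k * aP / 2).
have cb0 : 0 < cb.
  rewrite lt_min; apply/andP; split; last by rewrite divr_gt0// mulr_gt0.
  apply: divr_gt0; last by apply: addr_gt0; exact: mulr_gt0.
  apply: mulr_gt0 aP0; apply: mulr_gt0 psi2_gt0; apply: mulr_gt0 => //.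
  by apply: divr_gt0; apply: mulr_gt0; rewrite ?exprn_gt0// mulr_gt0// ?exprn_gt0// mulr_gt0//
    exprn_gt0.
exists (K * (cb ^- 2 + aP ^- 2 + aQ ^- 2)).
  by apply: mulr_gt0 K0 _; rewrite !addr_gt0// invr_gt0 exprn_gt0.
move=> n eps n_gt0 e01; have [e0 e1] := andP e01.
apply: (le_trans (rate n eps n_gt0 e01)); rewrite -[leRHS]mulrA ler_pM2l//.
have {}mPl := mPl _ e01; have {}mQl := mQl _ e01; rewrite -ball_radius in mPl mQl.
have mP0 := ballP_gt0 e0; have mPc := ballP_upper e0; rewrite -/c4 in mPc.
have gam0 := gamma_gt0 n_gt0 e0.
have N'0 : 0 < Nc eps.
  apply: (@lt_le_trans _ _ (16 * L * ediam Omega / (delta * eps))); last exact: ceil_ge.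
  by rewrite divr_gt0// !mulr_gt0.
have N'e : Nc eps * eps <= c6.
  have N'1 : Nc eps <= 16 * L * ediam Omega / (delta * eps) + 1.
    by rewrite -lerBlDr ltW// -[1]/(1%:~R) -intrB ceilB1_lt.
  apply: (le_trans (ler_wpM2r (ltW e0) N'1)); rewrite mulrDl mul1r /c6 lerD//.
  by rewrite invfM mulrA divfK ?lt0r_neq0.
have := beta_lower psi2_gt0 lam_gt0 Lam_gt0 e01 mP0 gam0 N'0 aP0 aQ0 c60 c40
  (gamG _ _ n_gt0 e0) mPl mPc mQl N'e.
rewrite -/cb; set bet := beta n eps => betl.
have var0 : 0 <= var_rho eps by apply: fine_ge0; exact: variance_ge0.
have nR : 0 < n%:R :> R by rewrite ltr0n.
have sq_inv (x a y : R) : 0 < a -> 0 < y -> a * y <= x -> x ^- 2 <= a ^- 2 * y ^- 2.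
  move=> a0 y0 ax; have ay0 := mulr_gt0 a0 y0; have x0 := lt_le_trans ay0 ax.
  rewrite -invfM -exprMn lef_pV2 ?posrE ?exprn_gt0//.
  by apply: lerXn2r; rewrite ?nnegrE// ltW.
have E0 m : 0 < eps ^+ m by rewrite exprn_gt0.
have b2 := sq_inv _ _ _ cb0 (E0 _) betl.
have p2 := sq_inv _ _ _ aP0 (E0 _) mPl; have q2 := sq_inv _ _ _ aQ0 (E0 _) mQl.
rewrite -[eps ^+ (3 * d + 2) ^+ 2]exprM in b2; rewrite -[eps ^+ d ^+ 2]exprM in p2 q2.
have e64 : ((3 * d + 2) * 2 = 6 * d + 4)%N by rewrite mulnDl mulnAC.
rewrite e64 in b2; rewrite mulnC in p2 q2.
set v := var_rho eps in var0 *; set KK := cb ^- 2 + aP ^- 2 + aQ ^- 2.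
have i2 (x : R) : 0 <= x ^- 2 by rewrite invr_ge0 sqr_ge0.
have w1 : 0 <= eps ^- (6 * d + 4) by rewrite invr_ge0 ltW.
have w2 : 0 <= eps ^- (2 * d) by rewrite invr_ge0 ltW.
rewrite [leRHS]mulrDr; apply: lerD.
  have -> : v ^+ 2 / (bet ^+ 2 * n%:R ^+ 2) = bet ^- 2 * (v ^+ 2 / n%:R ^+ 2).
    by rewrite invfM mulrCA mulrA.
  have -> : KK * (eps ^- (6 * d + 4) * v ^+ 2 / n%:R ^+ 2) =
    (KK * eps ^- (6 * d + 4)) * (v ^+ 2 / n%:R ^+ 2) by ring.
  apply: ler_wpM2r; first by apply: divr_ge0; exact: sqr_ge0.
  apply: (le_trans b2); apply: ler_wpM2r => //.
  by rewrite /KK -addrA lerDl addr_ge0.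
have -> : KK * (eps ^- (2 * d) * v / n%:R ^+ 2) = v / n%:R ^+ 2 * (KK * eps ^- (2 * d)) by ring.
apply: ler_wpM2l; first by apply: divr_ge0 var0 _; exact: sqr_ge0.
have : 0 <= cb ^- 2 * eps ^- (2 * d) by apply: mulr_ge0.
by rewrite /KK; move: p2 q2; lra.
Qed.

End rate.

Theorem theorem4p8 (R : realType) (d : nat) (d_gt0 : (0 < d)%N)
  (P Q : probability 'rV[R]_d R) (Omega Omega' : set 'rV[R]_d)
  (OmegaE : Omega = msupport P) (OmegaE' : Omega' = msupport Q)
  (Omega_compact : compact Omega) (Omega_compact' : compact Omega')
  (c : 'rV[R]_d -> 'rV[R]_d -> R) (L : R) (L_gt0 : 0 < L)
  (c_lip : cost_lipschitz Omega Omega' L c)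
  (phi psi2 : R -> R) (delta t : R)
  (phi_reg : regularization phi delta t)
  (psi2P : nondecreasing_second_derivative (convex_conj phi) psi2)
  (psi2_gt0 : 0 < psi2 (t - delta))
  (Omega_convex : convex_set Omega)
  (rho : 'rV[R]_d -> R) (lam Lam : R) (lam_gt0 : 0 < lam)
  (rho_density : has_lebesgue_density P rho)
  (rho_bounds : forall x, Omega x -> lam <= rho x <= Lam)
  (pi_ : R -> probability ('rV[R]_d * 'rV[R]_d)%type R)
  (pi_opt : forall eps, 0 < eps ->
    OT_optimizer Omega Omega' c phi eps P Q (pi_ eps))
  (dS : measure_display) (S : measurableType dS) (Pr : probability S R)
  (X Y : nat -> {RV Pr >-> 'rV[R]_d})
  (X_law : forall i A, measurable A -> distribution Pr (X i) A = P A)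
  (Y_law : forall j A, measurable A -> distribution Pr (Y j) A = Q A)
  (XY_indep : mutually_independent Pr (fun k : nat + nat =>
    match k with inl i => X i : S -> 'rV[R]_d | inr j => Y j end))
  (fhat ghat : forall n : nat, R ->
    n.-tuple 'rV[R]_d -> n.-tuple 'rV[R]_d -> 'rV[R]_d -> R)
  (potentialsP : forall n eps, (0 < n)%N -> 0 < eps ->
    empirical_potentials Omega Omega' c (convex_conj phi) eps
      (fhat n eps) (ghat n eps))
  (gamma : nat -> R -> R)
  (gamma_gt0 : forall n eps, (0 < n)%N -> 0 < eps -> 0 < gamma n eps)
  (gammaP : forall n eps, (0 < n)%N -> 0 < eps ->
    let pi1 (w : S) (i j : 'I_n) :=
      let xs := sample X n w in let ys := sample Y n w in
      psi2 ((fhat n eps xs ys (X i w) + ghat n eps xs ys (Y j w)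
             - c (X i w) (Y j w)) / eps + delta / 4) in
    {ae Pr, forall w, forall j, n%:R^-1 * \sum_(i < n) pi1 w i j <= gamma n eps}
    /\
    {ae Pr, forall w, forall i, n%:R^-1 * \sum_(j < n) pi1 w i j <= gamma n eps}) :
  let ballP eps := min_ball_mass P Omega (delta * eps / (8 * L)) in
  let ballQ eps := min_ball_mass Q Omega' (delta * eps / (8 * L)) in
  let N eps := (Num.ceil (16 * L * ediam Omega / (delta * eps)))%:~R : R in
  let alpha n eps :=
    alpha_const d lam Lam (psi2 (t - delta)) (ballQ eps) (gamma n eps) (N eps) in
  let beta n eps :=
    beta_const (alpha n eps) (psi2 (t - delta)) (ballP eps) (gamma n eps) in
  let var_rho eps :=
    fine 'V_(prod_prob P Q)[coupling_density P Q (pi_ eps)] in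
  let OT_PQ eps := fine (OT Omega Omega' c phi eps P Q) in
  let OT_hat n eps (w : S) := fine (OT Omega Omega' c phi eps
    (empirical (sample X n w)) (empirical (sample Y n w))) in
  let bias n eps := fine 'E_Pr[OT_hat n eps] - OT_PQ eps in
  (forall u : R, Num.max d%:R 2 < u ->
    exists (K C : R) (n0 : nat), [/\ 0 < K, 0 < C &
      forall n eps, (n0 <= n)%N -> 0 < eps <= 1 ->
        bias n eps ^+ 2 <=
        K * (var_rho eps ^+ 2 / (beta n eps ^+ 2 * n%:R ^+ 2) +
             var_rho eps / n%:R ^+ 2 *
               ((eps `^ u)^-1 + C / ballP eps ^+ 2 + C / ballQ eps ^+ 2))]) /\
  ((2 <= d)%N -> convex_set Omega' ->
   (exists (rho' : 'rV[R]_d -> R) (lam' Lam' : R),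
      [/\ 0 < lam', has_lebesgue_density Q rho' &
          forall y, Omega' y -> lam' <= rho' y <= Lam']) ->
   (exists G : R, forall n eps, (0 < n)%N -> 0 < eps -> gamma n eps <= G) ->
    exists (K' : R) (n0 : nat), 0 < K' /\
      forall n eps, (n0 <= n)%N -> 0 < eps <= 1 ->
        bias n eps ^+ 2 <=
        K' * (eps ^- (6 * d + 4) * var_rho eps ^+ 2 / n%:R ^+ 2 +
              eps ^- (2 * d) * var_rho eps / n%:R ^+ 2)).
Proof.
subst Omega Omega'; cbv zeta.
have mX i : measurable_fun setT (X i : S -> 'rV[R]_d) by exact: measurable_funPT.
have mY i : measurable_fun setT (Y i : S -> 'rV[R]_d) by exact: measurable_funPT.
have fghatP n eps (xs ys : n.-tuple 'rV[R]_d) : (0 < n)%N -> 0 < eps ->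
    (forall i, msupport P (tnth xs i)) -> (forall j, msupport Q (tnth ys j)) ->
    potentials (msupport P) (msupport Q) c (convex_conj phi) eps
      (empirical xs) (empirical ys) (fhat n eps xs ys) (ghat n eps xs ys).
  move=> n0 e0 xsO ysO; have [+ _ _] := potentialsP n eps n0 e0.
  by move=> /(_ xs ys); apply.
have gamP n eps : (0 < n)%N -> 0 < eps -> {ae Pr, forall w, forall i : 'I_n,
    avg (fun j : 'I_n => psi2 ((fhat n eps (sample X n w) (sample Y n w) (X i w) +
      ghat n eps (sample X n w) (sample Y n w) (Y j w) - c (X i w) (Y j w)) / eps + delta / 4))
      <= gamma n eps}.
  move=> n0 e0; have [_] := gammaP n eps n0 e0; apply: filterS => w h i.
  by rewrite avg.unlock; exact: h.
split.
  move=> u _; have [K K0 rate] := rate_bound d_gt0 Omega_compact Omega_compact' L_gt0 c_lip phi_reg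
    psi2P psi2_gt0 Omega_convex lam_gt0 rho_density rho_bounds pi_opt mX mY X_law Y_law XY_indep
    fghatP gamma_gt0 gamP (erefl _).
  (* With [C = 1] the ball-mass terms are those of [rate_bound], which holds from [n = 1] on; the
     bracket only grows by the nonnegative power of [eps]. *)
  exists K, 1, 1%N; split=> // n eps n0 e01; apply: (le_trans (rate n eps n0 e01)).
  apply: ler_wpM2l; first exact: ltW.
  rewrite lerD2l !div1r; apply: ler_wpM2l.
    by apply: divr_ge0; [apply: fine_ge0; exact: variance_ge0|exact: sqr_ge0].
  by rewrite -addrA lerDr invr_ge0 powR_ge0.
move=> d2 convQ densQ gamG.
have [K K0 rate] := rate_bound_uniform d_gt0 Omega_compact Omega_compact' L_gt0 c_lip phi_reg
  psi2P psi2_gt0 Omega_convex lam_gt0 rho_density rho_bounds pi_opt mX mY X_law Y_law XY_indep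
  fghatP gamma_gt0 gamP (erefl _) convQ densQ gamG.
by exists K, 1%N; split=> // n eps n0 e01; exact: rate.
Qed.
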